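(* Let $1<p<\infty$, $0<r\le\infty$, $K\in\mathbb{N}_0$, and let $f\in L^{p,r}(\mathbb{R}^n)$. Then there exists a triplet $\{\lambda_j\}_{j=1}^\infty\subset[0,\infty)$, $\{Q_j\}_{j=1}^\infty\subset\mathcal{Q}(\mathbb{R}^n)$ and $\{a_j\}_{j=1}^\infty\subset L^\infty(\mathbb{R}^n)\cap\mathcal{P}_K(\mathbb{R}^n)^\perp$ such that $f=\sum_{j=1}^\infty\lambda_ja_j$ in $\mathcal{S}'(\mathbb{R}^n)$ and that $|a_j|\le\chi_{Q_j}$ for all $j$ and, for all $v>0$, $$\left\|\left(\sum_{j=1}^\infty(\lambda_j\chi_{Q_j})^v\right)^{\frac1v}\right\|_{L^{p,r}}\le C_v\|f\|_{L^{p,r}},$$ where the constant $C_v>0$ depends on $v$ (and on the fixed parameters $n,p,r,K$) but not on $f$.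
   Context: $\mathbb{N}_0=\mathbb{N}\cup\{0\}$. $L^0(\mathbb{R}^n)$ is the set of all measurable functions on $\mathbb{R}^n$, $\mathcal{Q}(\mathbb{R}^n)$ is the family of all cubes in $\mathbb{R}^n$ with sides parallel to the coordinate axes, $\chi_E$ is the indicator function of $E$, and $\mathcal{S}'(\mathbb{R}^n)$ is the space of tempered distributions. For measurable $f$ put $\lambda_f(\alpha)=|\{x:|f(x)|>\alpha\}|$ ($\alpha>0$) and $f^\ast(t)=\inf\{\alpha>0:\lambda_f(\alpha)\le t\}$ ($t>0$). The Lorentz quasi-norm is $\|f\|_{L^{p,r}}=\left(\int_0^\infty(t^{1/p}f^\ast(t))^r\frac{dt}{t}\right)^{1/r}$ for $0<p,r<\infty$ and $\|f\|_{L^{p,\infty}}=\sup_{t>0}t^{1/p}f^\ast(t)$; $L^{p,r}(\mathbb{R}^n)$ is the set of measurable $f$ with finite quasi-norm. $\mathcal{P}_K(\mathbb{R}^n)^\perp$ denotes the set of all $f\in L^0(\mathbb{R}^n)$ for which $\langle\cdot\rangle^Kf\in L^1(\mathbb{R}^n)$ and $\int_{\mathbb{R}^n}x^\alpha f(x)\,dx=0$ for every $\alpha\in\mathbb{N}_0^n$ with $|\alpha|\le K$, where $\langle x\rangle=(1+|x|^2)^{1/2}$. *)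

(* Defs.v *)
From HB Require Import structures.
From mathcomp Require Import all_boot all_order all_algebra.
From mathcomp Require Import all_classical all_reals all_analysis.
From mathcomp Require Import complex.

Set Implicit Arguments.
Unset Strict Implicit.
Unset Printing Implicit Defensive.

Import Order.TTheory GRing.Theory Num.Theory.
Import numFieldNormedType.Exports.

Local Open Scope classical_set_scope.
Local Open Scope ring_scope.

(* R^n is 'rV[R]_n.  Its Borel sigma-algebra is the one generated by the
   coordinate maps, exactly as the library does for n.-tuple. *)
Definition rV_coord (R : realType) (n : nat) (i : 'I_n) (x : 'rV[R]_n) : R :=
  x 0 i.

Definition rV_display : measure_display. Proof. by constructor. Qed.

Section rV_measurable.
Context (R : realType) (n : nat).

Let mrV : set (set 'rV[R]_n) :=
  g_sigma_preimage (@rV_coord R n : 'I_n -> 'rV[R]_n -> measurableTypeR R).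

Let mrV0 : mrV set0. Proof. exact: sigma_algebra0. Qed.

Let mrVC A : mrV A -> mrV (~` A). Proof. exact: sigma_algebraC. Qed.

Let mrV_bigcup (F : (set 'rV[R]_n)^nat) :
  (forall i, mrV (F i)) -> mrV (\bigcup_i F i).
Proof. exact: sigma_algebra_bigcup. Qed.

HB.instance Definition _ := @isMeasurable.Build rV_display 'rV[R]_n mrV
  mrV0 mrVC mrV_bigcup.

End rV_measurable.

Lemma measurable_fun_rVP d (T : measurableType d) (R : realType) (n : nat)
    (f : T -> 'rV[R]_n) :
  (forall i, measurable_fun setT (fun x => f x 0 i : measurableTypeR R)) ->
  measurable_fun setT f.
Proof.
move=> mf _ Y mY; rewrite setTI; move: Y mY.
change ((measurable : set (set 'rV[R]_n)) `<=` [set Y | measurable (f @^-1` Y)]).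
apply: smallest_sub.
  split => [|A mA|F mF] /=.
  - by rewrite preimage_set0.
  - by rewrite setTD preimage_setC; exact: measurableC.
  - by rewrite preimage_bigcup; exact: bigcupT_measurable.
rewrite -bigcup_seq/= => Y [i _ [B mB <-]] /=.
by rewrite setTI; have := mf i measurableT _ mB; rewrite setTI.
Qed.

Definition rV_snoc (R : realType) (n : nat)
    (u : 'rV[R]_n * measurableTypeR R) : 'rV[R]_n.+1 :=
  \row_(j < n.+1) (if unlift ord_max j is Some k then u.1 0 k else u.2).

Section snoc_measure.
Context (R : realType) (n : nat).
Variable m : {measure set 'rV[R]_n -> \bar R}.

Lemma measurable_rV_snoc : measurable_fun setT (@rV_snoc R n).
Proof.
apply: measurable_fun_rVP => i.
case: (unliftP ord_max i) => [k ik|im].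
- have -> : (fun x => @rV_snoc R n x 0 i) = @rV_coord R n k \o fst.
    by apply/funext => x /=; rewrite /rV_snoc mxE ik liftK.
  apply: measurableT_comp; last exact: measurable_fst.
  move=> _ Y mY; rewrite setTI; apply: sub_sigma_algebra.
  rewrite -bigcup_seq/=; exists k; first by rewrite /= mem_index_enum.
  by exists Y => //; rewrite setTI.
- have -> : (fun x => @rV_snoc R n x 0 i) = snd.
    by apply/funext => x /=; rewrite /rV_snoc mxE im unlift_none.
  exact: measurable_snd.
Qed.

Definition snoc_measure : set 'rV[R]_n.+1 -> \bar R :=
  pushforward (m \x @lebesgue_measure R)%E (@rV_snoc R n).

Let snoc_measure0 : snoc_measure set0 = 0%E.
Proof. by rewrite /snoc_measure /pushforward preimage_set0 measure0. Qed.

Let snoc_measure_ge0 A : (0 <= snoc_measure A)%E.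
Proof. by rewrite /snoc_measure /pushforward; exact: measure_ge0. Qed.

Let snoc_measure_sigma_additive : semi_sigma_additive snoc_measure.
Proof.
move=> F mF tF mUF; rewrite /snoc_measure /pushforward preimage_bigcup.
apply: measure_semi_sigma_additive.
- by move=> k; rewrite -[X in measurable X]setTI; exact: measurable_rV_snoc.
- apply/trivIsetP => /= i j _ _ ij; rewrite -preimage_setI.
  by move/trivIsetP : tF => /(_ _ _ _ _ ij) ->//; rewrite preimage_set0.
- rewrite -preimage_bigcup -[X in measurable X]setTI.
  exact: measurable_rV_snoc.
Qed.

HB.instance Definition _ := isMeasure.Build _ _ _ snoc_measure
  snoc_measure0 snoc_measure_ge0 snoc_measure_sigma_additive.

End snoc_measure.

(* n-fold product of the one-dimensional Lebesgue measure, on Borel sets *)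
Fixpoint borel_lebesgue (R : realType) (n : nat) :
    {measure set 'rV[R]_n -> \bar R} :=
  match n with
  | 0 => [the {measure set 'rV[R]_0 -> \bar R} of dirac (0 : 'rV[R]_0)]
  | n'.+1 =>
    [the {measure set 'rV[R]_n'.+1 -> \bar R} of
      snoc_measure (borel_lebesgue R n')]
  end.

(* R^n equipped with the sigma-algebra of Lebesgue measurable sets, obtained
   by the Caratheodory completion of the product measure on Borel sets *)
Definition LebRn (R : realType) (n : nat) : Type :=
  caratheodory_type (mu_ext (borel_lebesgue R n)).
HB.instance Definition _ (R : realType) (n : nat) :=
  Measurable.on (LebRn R n).

Definition lebRn (R : realType) (n : nat) : set (LebRn R n) -> \bar R :=
  @completed_measure_extension _ _ _ (borel_lebesgue R n).
HB.instance Definition _ (R : realType) (n : nat) := Measure.on (@lebRn R n).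

Definition rV_box (R : realType) (n : nat) (B : 'I_n -> set R) : set 'rV[R]_n :=
  [set x | forall i, B i (x 0 i)].

Lemma measurable_rV_box (R : realType) n (B : 'I_n -> set (measurableTypeR R)) :
  (forall i, measurable (B i)) -> measurable (@rV_box R n B : set 'rV[R]_n).
Proof.
move=> mB.
have -> : @rV_box R n B = \bigcap_(i in [set: 'I_n]) (@rV_coord R n i @^-1` B i).
  by apply/seteqP; split=> x /= H i; [move=> _; exact: H|exact: H].
apply: fin_bigcap_measurable => // i _.
apply: sub_sigma_algebra.
rewrite -bigcup_seq/=; exists i; first by rewrite /= mem_index_enum.
by exists (B i) => //; rewrite setTI.
Qed.

Lemma borel_lebesgue_box (R : realType) n (B : 'I_n -> set (measurableTypeR R)) :
  (forall i, measurable (B i)) ->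
  borel_lebesgue R n (rV_box B) = (\prod_(i < n) lebesgue_measure (B i))%E.
Proof.
elim: n B => [|n IH] B mB /=.
  rewrite big_ord0 diracE mem_set //; by case.
rewrite /snoc_measure /pushforward.
have -> : @rV_snoc R n @^-1` rV_box B =
  (rV_box (fun i => B (widen_ord (leqnSn n) i))) `*` B ord_max.
  have E (i : 'I_n) : widen_ord (leqnSn n) i = lift ord_max i.
    by apply: val_inj; rewrite /= /bump leqNgt ltn_ord.
  apply/seteqP; split=> -[x t] /= H.
    split.
      by move=> i /=; have := H (widen_ord (leqnSn n) i); rewrite E /rV_snoc mxE liftK.
    by have := H ord_max; rewrite /rV_snoc mxE unlift_none.
  move=> i; rewrite /rV_snoc mxE; case: (unliftP ord_max i) => [k ->|->] /=.
    by have := H.1 k; rewrite E.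
  exact: H.2.
rewrite product_measure1E//; last by apply: measurable_rV_box.
by rewrite big_ord_recr /= IH.
Qed.

Lemma lebRn_box (R : realType) n (B : 'I_n -> set (measurableTypeR R)) :
  (forall i, measurable (B i)) ->
  @lebRn R n (rV_box B) = (\prod_(i < n) lebesgue_measure (B i))%E.
Proof.
move=> mB; rewrite -borel_lebesgue_box //; apply: measurable_mu_extE.
exact: measurable_rV_box.
Qed.

Section function_spaces.
Context (R : realType) (n : nat).
Local Notation Rn := (LebRn R n).
Local Notation leb := (@lebRn R n).
Implicit Types (f g a : 'rV[R]_n -> R[i]) (x : 'rV[R]_n).

(* L^0(R^n) *)
Definition cmeasurable f : Prop :=
  measurable_fun (setT : set Rn) (fun x : Rn => complex.Re (f x)) /\
  measurable_fun (setT : set Rn) (fun x : Rn => complex.Im (f x)).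

(* L^1(R^n) *)
Definition cintegrable f : Prop :=
  leb.-integrable (setT : set Rn) (fun x : Rn => (complex.Re (f x))%:E) /\
  leb.-integrable (setT : set Rn) (fun x : Rn => (complex.Im (f x))%:E).

Definition cintegral f : R[i] :=
  Complex (\int[leb]_x complex.Re (f x)) (\int[leb]_x complex.Im (f x)).

(* |f|, as an extended real function *)
Definition cabs f x : \bar R := (ComplexField.Normc.normc (f x))%:E.

(* L^infty(R^n) *)
Definition cLinfty f : Prop :=
  cmeasurable f /\ (Lnorm leb +oo (fun x : Rn => cabs f x) < +oo)%E.

(* The Lorentz quasi-norm is defined on extended real functions because
   (sum_j (lambda_j chi_{Q_j})^v)^(1/v) is a priori [0, +oo]-valued. *)
Definition distribution_fun (g : 'rV[R]_n -> \bar R) (alpha : R) : \bar R :=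
  leb [set x : Rn | (alpha%:E < `|g x|)%E].

Definition rearrangement (g : 'rV[R]_n -> \bar R) (t : R) : \bar R :=
  ereal_inf [set alpha%:E | alpha in
    [set alpha : R | 0 < alpha /\ (distribution_fun g alpha <= t%:E)%E]].

(* junk value 0 for r = -oo *)
Definition lorentz_norm (p : R) (r : \bar R) (g : 'rV[R]_n -> \bar R) :
    \bar R :=
  match r with
  | s%:E => ((\int[@lebesgue_measure R]_(t in `]0%R, +oo[)
      (((t `^ p^-1)%:E * rearrangement g t) `^ s * (t^-1)%:E)) `^ s^-1)%E
  | +oo%E => ereal_sup [set ((t `^ p^-1)%:E * rearrangement g t)%E | t in
      [set t : R | 0 < t]]
  | -oo%E => 0%E
  end.

(* L^{p,r}(R^n) *)
Definition lorentz (p : R) (r : \bar R) f : Prop :=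
  cmeasurable f /\ (lorentz_norm p r (cabs f) < +oo)%E.

Definition monomial (alpha : {ffun 'I_n -> nat}) x : R :=
  \prod_(i < n) x 0 i ^+ alpha i.

Definition mdeg (alpha : {ffun 'I_n -> nat}) : nat := (\sum_(i < n) alpha i)%N.

(* <x> for the Euclidean norm (the library norm on 'rV is the max norm) *)
Definition japanese x : R := Num.sqrt (1 + \sum_(i < n) x 0 i ^+ 2).

(* P_K(R^n)^perp *)
Definition PKperp (K : nat) f : Prop :=
  [/\ cmeasurable f,
      cintegrable (fun x => real_complex R (japanese x ^+ K) * f x) &
      forall alpha, (mdeg alpha <= K)%N ->
        cintegral (fun x => real_complex R (monomial alpha x) * f x) = 0].

(* closed cubes of positive side length with sides parallel to the axes *)
Definition is_cube (Q : set 'rV[R]_n) : Prop :=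
  exists (c : 'rV[R]_n) (l : R), 0 < l /\
    Q = [set x | forall i, c 0 i <= x 0 i <= c 0 i + l].

Definition iter_partial (s : seq 'I_n) (phi : 'rV[R]_n -> R) :
    'rV[R]_n -> R :=
  foldr (fun i h => 'D_('e_i) h) phi s.

Definition schwartzR (phi : 'rV[R]_n -> R) : Prop :=
  forall s : seq 'I_n,
  [/\ continuous (iter_partial s phi),
      forall i x, derivable (iter_partial s phi) x 'e_i &
      forall alpha, exists M : R, forall x,
        `|monomial alpha x * iter_partial s phi x| <= M].

Definition schwartz (phi : 'rV[R]_n -> R[i]) : Prop :=
  schwartzR (fun x => complex.Re (phi x)) /\
  schwartzR (fun x => complex.Im (phi x)).

(* A measurable f stands for the distribution phi |-> \int f phi, which is
   tempered as soon as all these integrals converge absolutely (closed graph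
   theorem). *)
Definition tempered f : Prop :=
  cmeasurable f /\ forall phi, schwartz phi -> cintegrable (fun x => f x * phi x).

(* u_N --> f in S'(R^n) (weak-* convergence) *)
Definition cvg_tempered (u : nat -> 'rV[R]_n -> R[i]) f : Prop :=
  [/\ forall N, tempered (u N), tempered f &
      forall phi, schwartz phi ->
        (fun N => ComplexField.Normc.normc (cintegral (fun x => u N x * phi x) -
                         cintegral (fun x => f x * phi x))) @ \oo --> (0 : R)].

(* (sum_j (lambda_j chi_{Q_j})^v)^(1/v) *)
Definition lv_sum (v : R) (lam : nat -> R) (Q : nat -> set 'rV[R]_n) x :
    \bar R :=
  ((\sum_(0 <= j <oo) ((lam j * \1_(Q j) x) `^ v)%:E) `^ v^-1)%E.

End function_spaces.

(* Main.v *)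
(* Let w = |f|.  For every integer k let Omega_k be the union of the maximal
   dyadic cubes on which the mean of w exceeds 2 ^ k.  Replacing f on each of
   these cubes by a bounded function with the same moments up to order K gives
   a good part g_k = O(2 ^ k), and f is the telescoping sum of the differences
   g_(k+1) - g_k.  Omega_(k+1) is contained in Omega_k and its cubes are nested
   in those of Omega_k, so each difference splits over the cubes of Omega_k into
   pieces of size O(2 ^ k) with vanishing moments: these are the atoms.

   The cubes of one level are disjoint, so sum_j (lam_j chi_(Q_j)) ^ v is a
   geometric sum, of order 2 ^ (v k) off Omega_(k+1).  Hence its 1/v-th power F
   exceeds a multiple of 2 ^ k only on Omega_k, whose measure is bounded through
   the weak type inequality by sum_m 2 ^ m d_w (c 2 ^ (m + k)), with d_w the
   distribution function of w.  This gives F^*(t) <= sup_m C 2 ^ -m w^*(c rho ^ m t)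
   for any rho < 1/2, and choosing rho with rho ^ (- 1/p) < 2, possible because
   p > 1, makes the dilation series for the Lorentz quasi-norm converge.

   The case v = 1 dominates all partial sums by a function in weak L^p, so
   dominated convergence against Schwartz functions gives convergence in S'. *)

Require Import Defs.
From HB Require Import structures.
From mathcomp Require Import all_boot all_order all_algebra.
From mathcomp Require Import all_classical all_reals all_analysis.
From mathcomp Require Import measurable_realfun ess_sup_inf complex ring lra zify.

Set Implicit Arguments.
Unset Strict Implicit.
Unset Printing Implicit Defensive.

Import Order.TTheory GRing.Theory Num.Theory.
Import numFieldNormedType.Exports.

Local Open Scope classical_set_scope.
Local Open Scope ring_scope.

(** Cubes and coefficients are selected by [w] alone, so the real and imaginary parts of f share
    them; real atoms are kept below 1/2, so that two of them form a complex atom of modulus at most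
    1. The parameter v enters only the constant.

    As r may be below 1, the Lorentz quasi-norm cannot be treated as a norm. All estimates therefore
    go through distribution functions, and one implication, from a series bound on d_F to a bound on
    F^*, serves every r.

    f need not be integrable: only the integrals of w over {w > a}, a > 0, are finite, by p > 1.
    They also keep cubes of large scale from being heavy, which requires positive dimension.

    The atoms are bounded at every point, but means control w only almost everywhere: f is first set
    to 0 on the null set where this fails. Likewise the cubes of the statement are closed and the
    dyadic ones half-open, so a countable union of boundaries is discarded. Finally, the atoms are
    enumerated by an encoding of pairs (level, cube), so at each point the series has to be compared
    with the one in level order. *)

Section tail.
Local Open Scope ereal_scope.
Context d (T : measurableType d) (R : realType).
Variable mu : {measure set T -> \bar R}.

(** If m is the largest index with [2 ^+ m * a] below [G x], the m-th term alone is at least [G x];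
    where [G x] is infinite the terms are unbounded. *)
Lemma integral_tail_le (G : T -> \bar R) (a : R) :
  measurable_fun setT G -> (forall x, 0 <= G x) -> (0 < a)%R ->
  \int[mu]_(x in [set x | a%:E < G x]) G x <=
  \sum_(m <oo) (2 ^+ m.+1 * a)%:E * mu [set x | (2 ^+ m * a)%:E < G x].
Proof.
move=> mG G0 a0.
pose D (m : nat) := [set x | (2 ^+ m * a)%:E < G x].
have mD m : measurable (D m).
  by rewrite -[X in measurable X]setTI; exact: emeasurable_fun_o_infty.
have mDa : measurable [set x | a%:E < G x].
  by rewrite -[X in measurable X]setTI; exact: emeasurable_fun_o_infty.
rewrite [leRHS](_ : _ =
    \int[mu]_x \sum_(m <oo) (2 ^+ m.+1 * a)%:E * (\1_(D m) x)%:E); last first.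
  rewrite integral_nneseries//; last 2 first.
  - move=> m; apply: measurable_funeM; apply/measurable_EFinP.
    exact: measurable_indic.
  - by move=> m x _; rewrite -EFinM lee_fin mulr_ge0// mulr_ge0// ltW.
  apply: eq_eseriesr => m _; rewrite ge0_integralZl ?integral_indic ?setIT//.
  - by apply/measurable_EFinP; exact: measurable_indic.
  - by rewrite lee_fin mulr_ge0// ltW.
rewrite integral_mkcond; apply: ge0_le_integral => //=.
- by move=> x _; apply: erestrict_ge0 => y _.
- by apply/(measurable_restrictT _ _).1 => //; exact: measurable_funS mG.
- apply: ge0_emeasurable_sum => //.
  - by move=> m x _ _; rewrite -EFinM lee_fin mulr_ge0// mulr_ge0// ltW.
  - move=> m _; apply: measurable_funeM; apply/measurable_EFinP.
    exact: measurable_indic.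
move=> x _.
have term0 m : 0 <= (2 ^+ m.+1 * a)%:E * (\1_(D m) x)%:E.
  by rewrite -EFinM lee_fin mulr_ge0// mulr_ge0// ltW.
have term_le m : D m x ->
    (2 ^+ m.+1 * a)%:E <= \sum_(m <oo) (2 ^+ m.+1 * a)%:E * (\1_(D m) x)%:E.
  move=> Dx.
  apply: (@le_trans _ _ (\sum_(0 <= i < m.+1) (2 ^+ i.+1 * a)%:E * (\1_(D i) x)%:E)).
    rewrite big_nat_recr//= indicE mem_set// mule1 leeDr//.
    by apply: sume_ge0.
  exact: nneseries_lim_ge.
rewrite patchE; case: ifPn => [|_]; last exact: nneseries_ge0.
rewrite inE /= => aG.
have Garch (b : R) : exists m : nat, (b <= 2 ^+ m * a)%R.
  exists (Num.truncn (b / a)).+1; rewrite -ler_pdivrMr//.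
  apply: le_trans (ltW (truncnS_gt _)) _.
  by rewrite -natrX ler_nat; apply: ltnW; exact: ltn_expl.
have [Gx|Gx] := eqVneq (G x) +oo.
  rewrite Gx leye_eq; apply/eqP; apply/eqyP => b b0.
  have [m bm] := Garch b.
  apply: le_trans (term_le m _).
    rewrite lee_fin (le_trans bm)// ler_pM2r// ler_weXn2l// ler1n//.
  by rewrite /D /= Gx ltry.
have Gf : G x \is a fin_num by rewrite ge0_fin_numE// ltey.
have exm : exists m : nat, G x <= (2 ^+ m * a)%:E.
  by have [m Hm] := Garch (fine (G x)); exists m; rewrite -(fineK Gf) lee_fin.
(* The least index with [G x <= 2 ^+ m * a] is positive because [a < G x]; its predecessor indexes
   the term wanted. *)
have [[|m] Gm minm] := ex_minnP exm.
  by move: Gm; rewrite expr0 mul1r leNgt aG.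
apply: le_trans Gm (term_le _ _).
by rewrite /D /= ltNge; apply/negP => /minm; rewrite ltnn.
Qed.

End tail.

(** * Dilation of integrals over the half-line *)

Section scaling.
Context {R : realType}.
Local Notation mu := (@lebesgue_measure R).
Let T := measurableTypeR R.

Let mulr_measurable (c : R) : measurable_fun setT (fun x : T => c * x : T).
Proof. exact: mulrl_measurable. Qed.

Lemma preimage_scale_itvoc (c a b : R) : 0 < c ->
  [set x | `]a, b]%classic (c * x)] = `]c^-1 * a, c^-1 * b]%classic.
Proof.
move=> c0; apply/seteqP; split=> x /=; rewrite !in_itv/=;
  by rewrite -![c^-1 * _]mulrC ltr_pdivrMr// ler_pdivlMr// [x * c]mulrC.
Qed.

Lemma preimage_scale_itvoy (c : R) : 0 < c ->
  [set x | `]0%R, +oo[%classic (c * x)] = `]0, +oo[%classic.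
Proof.
by move=> c0; apply/seteqP; split=> x /=; rewrite !in_itv/= !andbT pmulr_rgt0.
Qed.

(** Lebesgue measure again: multiplication by [c] pushes it forward to [c^-1] times itself, which
    the scaling by [c] undoes. *)
Let scaled_lebesgue (c : R) (c0 : 0 < c) : {measure set T -> \bar R} :=
  mscale (NngNum (ltW c0))
    (measure_function_pushforward__canonical__measure_function_Measure
      mu (mulr_measurable c)).

Let scaled_lebesgueE (c : R) (c0 : 0 < c) (A : set T) : measurable A ->
  mu A = scaled_lebesgue c0 A.
Proof.
move=> mA; apply: lebesgue_measure_unique => //= _ [[a b]] _ <-.
rewrite /scaled_lebesgue/= /mscale /pushforward/=.
rewrite [X in (_ * lebesgue_measure X)%E](_ : _ = `]c^-1 * a, c^-1 * b]%classic); last first.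
  exact: preimage_scale_itvoc.
rewrite !lebesgue_measure_itv/= !lte_fin ltr_pM2l ?invr_gt0//.
case: ifPn => // _; last by rewrite mule0.
by rewrite -!EFinD -EFinM; congr EFin; field; rewrite gt_eqF.
Qed.

Lemma ge0_integral_scale (c : R) (f : R -> \bar R) : 0 < c ->
  measurable_fun (`]0%R, +oo[%classic : set R) f -> (forall t : R, 0 < t -> (0 <= f t)%E) ->
  (\int[mu]_(t in `]0%R, +oo[) f t =
   c%:E * \int[mu]_(t in `]0%R, +oo[) f (c * t)%R)%E.
Proof.
move=> c0 mf f0.
rewrite (eq_measure_integral (scaled_lebesgue c0)); last first.
  by move=> A mA _; exact: scaled_lebesgueE.
rewrite ge0_integral_mscale//=; last first.
  by move=> t; rewrite /= in_itv/= andbT; exact: f0.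
congr (_ * _)%E.
rewrite (ge0_integral_pushforward (mulr_measurable c))//=.
- by congr integral; exact: preimage_scale_itvoy.
- by move=> t; rewrite inE/= in_itv/= andbT; exact: f0.
Qed.

End scaling.

(** * Rearrangements and Lorentz quasi-norms *)

Section series_bounds.
Context (R : realType).

Lemma nneseries_le_bound (u : nat -> \bar R) (b : \bar R) :
  (forall n, 0 <= u n)%E -> (forall N, \sum_(0 <= i < N) u i <= b)%E ->
  (\sum_(i <oo) u i <= b)%E.
Proof.
move=> u0 ub; apply: lime_le; first exact: is_cvg_nneseries.
by apply: nearW => N; exact: ub.
Qed.

Lemma geometric_sum_le (x : R) N : 0 <= x < 1 ->
  \sum_(0 <= i < N) x ^+ i <= (1 - x)^-1.
Proof.
move=> /andP[x0 x1]; have x1' : 0 < 1 - x by rewrite subr_gt0.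
elim: N => [|N IH]; first by rewrite big_nil invr_ge0 ltW.
rewrite big_nat_recl//= expr0.
under eq_bigr do rewrite exprS.
rewrite -mulr_sumr.
apply: (@le_trans _ _ (1 + x * (1 - x)^-1)).
  by rewrite lerD2l ler_wpM2l.
by rewrite le_eqVlt; apply/orP; left; apply/eqP; field; rewrite gt_eqF.
Qed.

Lemma geometric_eseries_le (a x : R) : 0 <= a -> 0 <= x < 1 ->
  (\sum_(i <oo) (a * x ^+ i)%:E <= (a / (1 - x))%:E)%E.
Proof.
move=> a0 x01; have /andP[x0 x1] := x01.
apply: nneseries_le_bound => [n|N]; first by rewrite lee_fin mulr_ge0// exprn_ge0.
by rewrite sumEFin lee_fin -mulr_sumr ler_wpM2l// geometric_sum_le.
Qed.

End series_bounds.

Section rearrangement.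
Context (R : realType) (n : nat).
Local Notation leb := (@lebRn R n).
Implicit Types (F w : 'rV[R]_n -> \bar R).

(* [lebRn] is an outer measure, so no measurability is needed. *)
Lemma le_lebRn (A B : set 'rV[R]_n) : A `<=` B -> (leb A <= leb B)%E.
Proof. exact: le_mu_ext. Qed.

Lemma lebRn_ge0 (A : set 'rV[R]_n) : (0 <= leb A)%E.
Proof. exact: mu_ext_ge0. Qed.

Lemma distribution_fun_ge0 w a : (0 <= distribution_fun w a)%E.
Proof. exact: lebRn_ge0. Qed.

Lemma le_distribution_fun w (a b : R) : a <= b ->
  (distribution_fun w b <= distribution_fun w a)%E.
Proof.
move=> ab; apply: le_lebRn => x /=; apply: le_lt_trans.
by rewrite lee_fin.
Qed.

Lemma rearrangement_ge0 w t : (0 <= rearrangement w t)%E.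
Proof.
by apply: le_ereal_inf_tmp => _ [a [a0 _] <-]; rewrite lee_fin ltW.
Qed.

Lemma rearrangement_le w (a t : R) : 0 < a ->
  (distribution_fun w a <= t%:E)%E -> (rearrangement w t <= a%:E)%E.
Proof. by move=> a0 da; apply: ereal_inf_lbound; exists a. Qed.

Lemma rearrangement_lt w (a t : R) : (rearrangement w t < a%:E)%E ->
  (distribution_fun w a <= t%:E)%E.
Proof.
move=> /ereal_inf_lt[_ [b [b0 db] <-]]; rewrite lte_fin => ba.
by apply: le_trans db; apply: le_distribution_fun; exact: ltW.
Qed.

Lemma rearrangement_ge w (a t : R) : 0 < a ->
  (t%:E < distribution_fun w a)%E -> (a%:E <= rearrangement w t)%E.
Proof.
by move=> a0 ta; rewrite leNgt; apply/negP => /rearrangement_lt; rewrite leNgt ta.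
Qed.

Lemma le_rearrangement w (t t' : R) : t <= t' ->
  (rearrangement w t' <= rearrangement w t)%E.
Proof.
move=> tt'; apply: le_ereal_inf => _ [a [a0 da] <-]; exists a => //; split => //.
by apply: le_trans da _; rewrite lee_fin.
Qed.

(** Monotonicity suffices: preimages of upper rays are intervals. *)
Lemma measurable_rearrangement w (D : set R) : measurable D ->
  measurable_fun D (rearrangement w).
Proof.
move=> mD.
apply: (measurability (@ErealGenCInfty.G R)); first exact: ErealGenCInfty.measurableE.
move=> _ [_ [r] -> <-].
apply: measurableI => //; apply: is_interval_measurable => s t /=.
rewrite !in_itv/= !andbT => rs rt u /andP[su ut].
rewrite in_itv/= andbT; apply: le_trans rt _.
exact: le_rearrangement.
Qed.

(** The factor [(1 - 2 * rho) / 2] is the one for which the measures allotted to the terms,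
    [2 ^+ m.+1] times [(1 - 2 * rho) / 2 * rho ^+ m * t], add up to exactly [t]. At a height above
    [c^-1 * M] every term respects its allotment. *)
Lemma rearrangement_domination F w (c rho t : R) (M : \bar R) :
  0 < c -> 0 < rho -> 2 * rho < 1 -> 0 < t ->
  (forall a : R, 0 < a -> (distribution_fun F a <=
     \sum_(m <oo) (2 ^+ m.+1)%:E * distribution_fun w (c * 2 ^+ m * a)%R)%E) ->
  (forall m, ((2 ^- m)%:E *
     rearrangement w ((1 - 2 * rho) / 2 * rho ^+ m * t)%R <= M)%E) ->
  (rearrangement F t <= c^-1%:E * M)%E.
Proof.
move=> c0 rho0 rho1 t0 HF HM.
have M0 : (0 <= M)%E.
  by apply: le_trans (HM 0%N); rewrite mule_ge0// rearrangement_ge0.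
move: M M0 HM => [M| |]//.
  (* The margin [e] provides the strict inequality that [rearrangement_lt] asks for. *)
  rewrite lee_fin => M0 HM; apply/lee_addgt0Pr => e e0.
  rewrite -EFinM -EFinD; set a := c^-1 * M + e.
  have a0 : 0 < a by rewrite ltr_wpDl// mulr_ge0// invr_ge0 ltW.
  apply: rearrangement_le => //; apply: le_trans (HF a a0) _.
  have dm m : (distribution_fun w (c * 2 ^+ m * a)%R <=
      ((1 - 2 * rho) / 2 * rho ^+ m * t)%:E)%E.
    apply: rearrangement_lt.
    have m20 : (2 ^+ m : R) != 0 by rewrite expf_neq0.
    set r := rearrangement w _.
    have -> : r = ((2 ^+ m)%:E * ((2 ^- m)%:E * r))%E.
      by rewrite muleA -EFinM divff// mul1e.
    apply: (@le_lt_trans _ _ ((2 ^+ m)%:E * M%:E)%E).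
      by apply: lee_wpmul2l; [rewrite lee_fin exprn_ge0|exact: HM].
    rewrite -EFinM lte_fin [c * _]mulrC -mulrA ltr_pM2l ?exprn_gt0//.
    by rewrite /a mulrDr mulVKf ?gt_eqF// ltrDl mulr_gt0.
  apply: (@le_trans _ _ (\sum_(m <oo) (((1 - 2 * rho) * t) * (2 * rho) ^+ m)%:E)%E).
    apply: lee_nneseries => [m _ _|m _].
      by rewrite mule_ge0// ?distribution_fun_ge0.
    apply: (@le_trans _ _ ((2 ^+ m.+1)%:E * ((1 - 2 * rho) / 2 * rho ^+ m * t)%:E)%E).
      by apply: lee_wpmul2l; [rewrite lee_fin exprn_ge0|exact: dm].
    rewrite -EFinM lee_fin exprMn exprS le_eqVlt; apply/orP; left; apply/eqP.
    by field.
  apply: le_trans (geometric_eseries_le _ _) _.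
  - by rewrite mulr_ge0 ?subr_ge0// ltW.
  - by rewrite rho1 andbT mulr_ge0// ltW.
  by rewrite lee_fin mulrAC divff ?mul1r// subr_eq0 gt_eqF.
by move=> _ _; rewrite gt0_muley ?leey// lte_fin invr_gt0.
Qed.

End rearrangement.

(** * Dilation series for the Lorentz quasi-norm *)

Section lorentz.
Context (R : realType) (n : nat).
Implicit Types (F w : 'rV[R]_n -> \bar R).

Lemma ltr_powR2 (x y : R) : x < y -> 2 `^ x < 2 `^ y.
Proof. by move=> xy; rewrite /powR pnatr_eq0/= ltr_expR ltr_pM2r ?ln_gt0 ?ltr1n. Qed.

(** The witness is 2^(-(p + 1)/2): the exponent (p + 1)/2 lies strictly between 1, which gives
    [2 * rho < 1], and p, which gives rho^(-1/p) < 2. *)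
Lemma exists_dilation_ratio (p : R) : 1 < p ->
  exists rho : R, [/\ 0 < rho, 2 * rho < 1 & rho `^ (- p^-1) / 2 < 1].
Proof.
move=> p1; have p0 : 0 < p by rewrite (lt_trans _ p1).
exists (2 `^ (- ((p + 1) / 2))); split.
- by rewrite powR_gt0.
- rewrite -{1}(powRr1 (ltW (ltr0n R 2))) -powRD; last by rewrite pnatr_eq0 implybT.
  rewrite -[ltRHS](powRr0 2); apply: ltr_powR2; lra.
- rewrite ltr_pdivrMr// mul1r -powRrM -[ltRHS](powRr1 (ltW (ltr0n R 2))).
  by apply: ltr_powR2; rewrite mulrNN ltr_pdivrMr// mul1r; lra.
Qed.

Definition lorentz_integrand (p s : R) w (t : R) : \bar R :=
  (((t `^ p^-1)%:E * rearrangement w t) `^ s * (t^-1)%:E)%E.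

Lemma lorentz_integrand_ge0 p s w t : 0 < t -> (0 <= lorentz_integrand p s w t)%E.
Proof.
by move=> t0; rewrite mule_ge0 ?poweR_ge0// lee_fin invr_ge0 ltW.
Qed.

Lemma measurable_lorentz_integrand p s w :
  measurable_fun (`]0%R, +oo[%classic : set R) (lorentz_integrand p s w).
Proof.
apply: emeasurable_funM.
  apply: (measurableT_comp (measurable_poweR _)).
  apply: emeasurable_funM; last exact: measurable_rearrangement.
  apply/measurable_EFinP; apply: measurable_funTS; exact: measurable_powR.
apply/measurable_EFinP.
apply: open_continuous_measurable_fun => // t; rewrite inE/= in_itv/= andbT => t0.
by apply: inv_continuous; rewrite gt_eqF.
Qed.

(** The supremum over m in [rearrangement_domination] is replaced by an l^s sum, which dominates it
    for every [s > 0] and whose s-th power can be integrated term by term. The factor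
    [kap * rho ^+ m] restores the weight 1/t from the weight at the dilated point; the Jacobian of
    the dilation will cancel it. *)
Lemma lorentz_integrand_domination F w (p s c rho kap t : R) :
  kap = (1 - 2 * rho) / 2 ->
  1 < p -> 0 < s -> 0 < c -> 0 < rho -> 2 * rho < 1 -> 0 < t ->
  (forall a : R, 0 < a -> (distribution_fun F a <=
     \sum_(m <oo) (2 ^+ m.+1)%:E * distribution_fun w (c * 2 ^+ m * a)%R)%E) ->
  (lorentz_integrand p s F t <=
   \sum_(m <oo) (((c^-1 * kap `^ (- p^-1)) * (rho `^ (- p^-1) / 2) ^+ m) `^ s *
                 (kap * rho ^+ m))%:E *
      lorentz_integrand p s w (kap * rho ^+ m * t)%R)%E.
Proof.
move=> kapE p1 s0 c0 rho0 rho1 t0 HF.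
have kap0 : 0 < kap by rewrite kapE divr_gt0// subr_gt0.
pose W m := rearrangement w (kap * rho ^+ m * t)%R.
have W0 m : (0 <= W m)%E by exact: rearrangement_ge0.
pose u m := ((2 ^- m)%:E * W m)%E.
have u0 m : (0 <= u m)%E by rewrite mule_ge0.
have sig0 m : 0 < kap * rho ^+ m by rewrite mulr_gt0// exprn_gt0.
pose S := (\sum_(m <oo) (u m `^ s))%E.
have uS m : (u m `^ s <= S)%E.
  have us0 k : (0 <= u k `^ s)%E by exact: poweR_ge0.
  apply: (@le_trans _ _ (\sum_(0 <= i < m.+1) u i `^ s)%E).
    by rewrite big_nat_recr//= leeDr// sume_ge0.
  exact: nneseries_lim_ge.
have S0 : (0 <= S)%E by apply: nneseries_ge0 => m _ _; exact: poweR_ge0.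
have FS : (rearrangement F t <= c^-1%:E * S `^ s^-1)%E.
  apply: (rearrangement_domination c0 rho0 rho1 t0 HF) => m.
  rewrite -kapE -/(W m) -/(u m) -[leLHS]poweRe1// -(divff (lt0r_neq0 s0)) poweRrM.
  apply: gt0_ler_poweR; rewrite ?in_itv/= ?leey ?andbT//.
  - by rewrite invr_ge0 ltW.
  - exact: poweR_ge0.
apply: (@le_trans _ _ (((t `^ p^-1)%:E * (c^-1%:E * S `^ s^-1)) `^ s * (t^-1)%:E)%E).
  apply: lee_wpmul2r; first by rewrite lee_fin invr_ge0 ltW.
  have tp0 : (0 <= (t `^ p^-1)%:E)%E by rewrite lee_fin powR_ge0.
  apply: gt0_ler_poweR; rewrite ?in_itv/= ?leey ?andbT//.
  - exact: ltW.
  - by rewrite mule_ge0// rearrangement_ge0.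
  - by rewrite !mule_ge0 ?poweR_ge0// lee_fin invr_ge0 ltW.
  - exact: lee_wpmul2l.
rewrite muleA poweRM ?mule_ge0 ?poweR_ge0 ?lee_fin ?powR_ge0 ?invr_ge0 ?(ltW c0)//.
rewrite -poweRrM mulVf ?gt_eqF// poweRe1// -EFinM poweR_EFin muleAC -EFinM.
rewrite -nneseriesZl; last by move=> m _; exact: poweR_ge0.
apply: lee_nneseries => [m _ _|m _].
  by rewrite mule_ge0 ?poweR_ge0// lee_fin mulr_ge0 ?powR_ge0// invr_ge0 ltW.
rewrite /lorentz_integrand -/(W m).
set b := c^-1 * _ * _ ^+ m.
have b0 : 0 <= b.
  apply: mulr_ge0; last by rewrite exprn_ge0// mulr_ge0 ?powR_ge0// invr_ge0.
  by rewrite mulr_ge0 ?powR_ge0// invr_ge0 ltW.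
rewrite le_eqVlt; apply/orP; left; apply/eqP.
set sig := kap * rho ^+ m.
have rhom0 : 0 < rho ^+ m by rewrite exprn_gt0.
have bE : b * (sig * t) `^ p^-1 = t `^ p^-1 / c * 2 ^- m.
  rewrite powRM ?(ltW (sig0 m))// ?(ltW t0)// powRM ?(ltW kap0) ?(ltW rhom0)//.
  rewrite /b expr_div_n -[X in X / 2 ^+ m]powR_mulrn ?powR_ge0// -powRrM.
  rewrite -[rho ^+ m]powR_mulrn ?(ltW rho0)// -powRrM !mulNr !powRN.
  rewrite [m%:R * p^-1]mulrC.
  field; rewrite !gt_eqF// ?powR_gt0// exprn_gt0//.
transitivity ((t^-1)%:E * ((b * (sig * t) `^ p^-1)%:E * W m) `^ s)%E.
  have -> : ((b * (sig * t) `^ p^-1)%:E * W m = (t `^ p^-1 / c)%:E * u m)%E.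
    by rewrite bE EFinM -muleA.
  rewrite poweRM//; last by rewrite lee_fin mulr_ge0 ?powR_ge0// invr_ge0 ltW.
  by rewrite poweR_EFin muleA -EFinM [t^-1 * _]mulrC.
rewrite EFinM -muleA [in LHS]poweRM ?lee_fin//; last first.
  by rewrite mule_ge0// lee_fin powR_ge0.
rewrite poweR_EFin muleA -EFinM [X in _ = (_ * X)%E]muleC muleA -EFinM.
congr (_ * _)%E; congr EFin.
by field; rewrite !gt_eqF// /sig sig0.
Qed.

Lemma lorentz_norm_domination (p : R) (r : \bar R) (c : R) :
  1 < p -> (0 < r)%E -> 0 < c ->
  exists2 C : R, 0 < C & forall F w,
    (forall a : R, 0 < a -> (distribution_fun F a <=
     \sum_(m <oo) (2 ^+ m.+1)%:E * distribution_fun w (c * 2 ^+ m * a)%R)%E) ->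
    (lorentz_norm p r F <= C%:E * lorentz_norm p r w)%E.
Proof.
move=> p1 r0 c0; have [rho [rho0 rho1 eta1]] := exists_dilation_ratio p1.
have p0 : 0 < p by rewrite (lt_trans _ p1).
have [kap kapE] : {kap : R | kap = (1 - 2 * rho) / 2} by exists ((1 - 2 * rho) / 2).
have kap0 : 0 < kap by rewrite kapE divr_gt0// subr_gt0.
have sig0 m : 0 < kap * rho ^+ m by rewrite mulr_gt0// exprn_gt0.
pose B := c^-1 * kap `^ (- p^-1).
have B0 : 0 < B by rewrite mulr_gt0 ?invr_gt0// powR_gt0.
pose eta := rho `^ (- p^-1) / 2.
have eta0 : 0 < eta by rewrite divr_gt0// powR_gt0.
case: r r0 => [s| |]//; last first.
  move=> _; exists B => // F w HF.
  apply: ge_ereal_sup => _ [t /= t0 <-].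
  set N := ereal_sup _.
  have tp0 : 0 < t `^ p^-1 by rewrite powR_gt0.
  have HN u : 0 < u -> ((u `^ p^-1)%:E * rearrangement w u <= N)%E.
    by move=> u0; apply: ereal_sup_ubound; exists u.
  (* Brings the bound to the form t^(1/p) times [c^-1 * M], with [M] the quantity required by
     [rearrangement_domination]. *)
  have -> : (B%:E * N = (t `^ p^-1)%:E * (c^-1%:E * ((kap `^ (- p^-1) / t `^ p^-1)%:E * N)))%E.
    rewrite !muleA -!EFinM; congr (_%:E * _)%E; rewrite /B.
    by field; rewrite !gt_eqF.
  apply: lee_wpmul2l; first by rewrite lee_fin ltW.
  apply: (rearrangement_domination c0 rho0 rho1 t0 HF) => m.
  rewrite -kapE.
  have rhom0 : 0 < rho ^+ m by rewrite exprn_gt0.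
  have -> : ((2 ^- m)%:E * rearrangement w (kap * rho ^+ m * t)%R = 
     (kap `^ (- p^-1) / t `^ p^-1 * eta ^+ m)%:E *
     (((kap * rho ^+ m * t) `^ p^-1)%:E * rearrangement w (kap * rho ^+ m * t)%R))%E.
    rewrite muleA -EFinM; congr (_%:E * _)%E.
    rewrite !powRM ?(ltW kap0) ?(ltW rhom0) ?(ltW (sig0 m)) ?(ltW t0)//.
    rewrite /eta expr_div_n -[X in X / 2 ^+ m]powR_mulrn ?powR_ge0// -powRrM.
    rewrite -[rho ^+ m]powR_mulrn ?(ltW rho0)// -powRrM !mulNr !powRN.
    rewrite [m%:R * p^-1]mulrC.
    by field; rewrite !gt_eqF// ?powR_gt0// ?exprn_gt0.
  rewrite EFinM -muleA; apply: lee_wpmul2l.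
    by rewrite lee_fin mulr_ge0 ?powR_ge0// invr_ge0 ltW.
  apply: le_trans (HN (kap * rho ^+ m * t) (mulr_gt0 (sig0 m) t0)).
  rewrite -[leRHS]mul1e; apply: lee_wpmul2r.
    by rewrite mule_ge0 ?rearrangement_ge0// lee_fin powR_ge0.
  by rewrite lee_fin exprn_ile1// ltW.
rewrite lte_fin => s0.
(* After the change of variables the m-th dilated integral is B^s (eta^s)^m times the integral for
   [w]; [D] is the sum of these factors. *)
pose D := B `^ s / (1 - eta `^ s).
have es0 : 0 <= eta `^ s < 1.
  rewrite powR_ge0/=; apply: (@lt_le_trans _ _ (1 `^ s)); last by rewrite powR1.
  by apply: gt0_ltr_powR => //; rewrite nnegrE ltW.
have D0 : 0 < D by rewrite divr_gt0 ?powR_gt0// subr_gt0; case/andP: es0.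
exists (D `^ s^-1); first by rewrite powR_gt0.
move=> F w HF; rewrite /lorentz_norm -poweR_EFin -poweRM; last 2 first.
- by rewrite lee_fin ltW.
- by apply: integral_ge0 => t /=; rewrite in_itv/= andbT; exact: lorentz_integrand_ge0.
apply: gt0_ler_poweR; rewrite ?in_itv/= ?leey ?andbT ?invr_ge0 ?(ltW s0)//.
- by apply: integral_ge0 => t /=; rewrite in_itv/= andbT; exact: lorentz_integrand_ge0.
- rewrite mule_ge0 ?lee_fin ?(ltW D0)//.
  by apply: integral_ge0 => t /=; rewrite in_itv/= andbT; exact: lorentz_integrand_ge0.
pose A m := ((B * eta ^+ m) `^ s * (kap * rho ^+ m)).
have A0 m : 0 <= A m by rewrite mulr_ge0 ?powR_ge0// ltW.
have msc m : measurable_fun (`]0%R, +oo[%classic : set R)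
    (fun t => lorentz_integrand p s w (kap * rho ^+ m * t)%R).
  apply: (@measurable_comp _ _ _ _ _ _ (`]0%R, +oo[%classic : set R)
    (lorentz_integrand p s w) _ (fun t : R => kap * rho ^+ m * t)) => //.
  - move=> _ [t /= + <-]; rewrite !in_itv/= !andbT; exact: mulr_gt0.
  - exact: measurable_lorentz_integrand.
  - by apply: measurable_funTS; exact: mulrl_measurable.
apply: (@le_trans _ _ (\int[lebesgue_measure]_(t in `]0%R, +oo[)
   \sum_(m <oo) (A m)%:E * lorentz_integrand p s w (kap * rho ^+ m * t)%R)%E).
  apply: ge0_le_integral => //.
  - by move=> t /=; rewrite in_itv/= andbT; exact: lorentz_integrand_ge0.
  - exact: measurable_lorentz_integrand.
  - apply: ge0_emeasurable_sum => [m t|m _].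
      rewrite /= in_itv/= andbT => t0 _.
      by rewrite mule_ge0 ?lee_fin// lorentz_integrand_ge0// mulr_gt0.
    apply: measurable_funeM; exact: msc.
  - move=> t /=; rewrite in_itv/= andbT => t0.
    exact: (lorentz_integrand_domination kapE).
rewrite integral_nneseries//; last 2 first.
- by move=> m; apply: measurable_funeM; exact: msc.
- move=> m t /=; rewrite in_itv/= andbT => t0.
  by rewrite mule_ge0 ?lee_fin// lorentz_integrand_ge0// mulr_gt0.
set I := (\int[_]_(t in _) ((_ * _) `^ s * _)%E)%E.
have I0 : (0 <= I)%E.
  by apply: integral_ge0 => t /=; rewrite in_itv/= andbT; exact: lorentz_integrand_ge0.
have Im m : (\int[lebesgue_measure]_(t in `]0%R, +oo[)
    ((A m)%:E * lorentz_integrand p s w (kap * rho ^+ m * t)%R) =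
    (B `^ s * (eta `^ s) ^+ m)%:E * I)%E.
  rewrite ge0_integralZl ?lee_fin//; last 2 first.
  - exact: msc.
  - move=> t /=; rewrite in_itv/= andbT => t0.
    by rewrite lorentz_integrand_ge0// mulr_gt0.
  have -> : I = _ := ge0_integral_scale (sig0 m)
    (@measurable_lorentz_integrand p s w) (@lorentz_integrand_ge0 p s w).
  rewrite muleA -EFinM /A powRM ?exprn_ge0 ?(ltW B0) ?(ltW eta0)//.
  congr ((_ * _ * _)%:E * _)%E.
  by rewrite -(powR_mulrn m (ltW eta0)) -(powR_mulrn m (powR_ge0 eta s)) -!powRrM mulrC.
under eq_eseriesr do rewrite Im.
apply: nneseries_le_bound => [m|N].
  by rewrite mule_ge0// lee_fin mulr_ge0 ?exprn_ge0// powR_ge0.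
rewrite -ge0_sume_distrl => [|m _]; last first.
  by rewrite lee_fin mulr_ge0 ?exprn_ge0 ?powR_ge0.
apply: lee_wpmul2r => //.
rewrite sumEFin lee_fin -mulr_sumr ler_wpM2l ?powR_ge0//.
exact: geometric_sum_le.
Qed.

End lorentz.

(** * Lorentz functions are of weak type *)

Section weak_type.
Context (R : realType) (n : nat).
Implicit Types (F w : 'rV[R]_n -> \bar R).

Lemma ereal_le_real_bound (d : \bar R) (T : R) : 0 <= T ->
  (forall t : R, 0 < t -> (t%:E < d)%E -> t <= T) -> (d <= T%:E)%E.
Proof.
move=> T0 H; rewrite leNgt; apply/negP => Td.
have [t /andP[Tt td]] : exists t : R, (T < t) && (t%:E < d)%E.
  case: d Td {H} => [d| |]//.
    rewrite lte_fin => Td; exists ((T + d) / 2); rewrite lte_fin; lra.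
  by move=> _; exists (T + 1); rewrite ltrDl ltr01 ltry.
by have := H t (le_lt_trans T0 Tt) td; rewrite leNgt Tt.
Qed.

(** For finite r: if t is below the distribution function at a, the rearrangement is at least a on
    ]t/2, t], and this stretch alone contributes at least half of ((t/2)^(1/p) a)^s to the integral.
    Solving for t gives the constant. *)
Lemma lorentz_norm_weak (p : R) (r : \bar R) w : 0 < p -> (0 < r)%E ->
  (lorentz_norm p r w < +oo)%E ->
  exists2 A : R, 0 <= A & forall a : R, 0 < a ->
    (distribution_fun w a <= (A * a `^ (- p))%:E)%E.
Proof.
move=> p0; have p'0 : 0 < p^-1 by rewrite invr_gt0.
have key (N : R) a t : 0 <= N -> 0 < a -> 0 < t -> t `^ p^-1 * a <= N ->
    t <= N `^ p * a `^ (- p).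
  move=> N0 a0 t0; rewrite -ler_pdivlMr// => H.
  rewrite -[leLHS](powRr1 (ltW t0)) -(mulVf (lt0r_neq0 p0)) powRrM powRN.
  apply: (@le_trans _ _ ((N / a) `^ p)).
    apply: ge0_ler_powR => //; rewrite ?nnegrE ?powR_ge0 ?(ltW p0)//.
    by rewrite divr_ge0// ltW.
  by rewrite powRM ?invr_ge0 ?(ltW a0)// -powRN -powR_inv1 ?(ltW a0)// -powRrM mulN1r.
case: r => [s| |]//.
  rewrite lte_fin => s0 Nfin.
  set J := (\int[lebesgue_measure]_(t in `]0%R, +oo[) lorentz_integrand p s w t)%E.
  have J0 : (0 <= J)%E.
    by apply: integral_ge0 => t /=; rewrite in_itv/= andbT; exact: lorentz_integrand_ge0.
  have Jfin : (J < +oo)%E.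
    rewrite ltey; apply/eqP => Joo; move: Nfin.
    rewrite /lorentz_norm -/(lorentz_integrand _ _ _ _) -/J Joo poweRyr ?ltxx//.
    by rewrite invr_eq0 gt_eqF.
  have [j j0 jE] : exists2 j : R, 0 <= j & J = j%:E.
    by exists (fine J); rewrite ?fine_ge0// fineK// ge0_fin_numE.
  exists (2 * (((2 * j) `^ s^-1) `^ p)); first by rewrite mulr_ge0 ?powR_ge0.
  move=> a a0; apply: ereal_le_real_bound => [|t t0 td].
    by rewrite !mulr_ge0 ?powR_ge0.
  have t20 : 0 < t / 2 by rewrite divr_gt0.
  have lb : (((t / 2) `^ p^-1 * a) `^ s / 2) <= j.
    rewrite -lee_fin -jE.
    apply: (@le_trans _ _ (\int[lebesgue_measure]_(u in `](t / 2)%R, t])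
       ((((t / 2) `^ p^-1 * a) `^ s / t)%:E))%E).
      rewrite integral_cst//= lebesgue_measure_itv/= lte_fin.
      rewrite ltr_pdivrMr// mulr_natr mulr2n ltrDl t0 -EFinD -EFinM lee_fin.
      rewrite le_eqVlt; apply/orP; left; apply/eqP.
      by field; rewrite gt_eqF.
    apply: (@le_trans _ _ (\int[lebesgue_measure]_(u in `](t / 2)%R, t])
        lorentz_integrand p s w u)%E).
      apply: ge0_le_integral => //.
      - by move=> u _; rewrite lee_fin divr_ge0 ?powR_ge0// ltW.
      - apply: measurable_funS (@measurable_lorentz_integrand _ _ p s w) => //.
        move=> u /=; rewrite !in_itv/= andbT => /andP[+ _].
        exact: lt_trans.
      move=> u /=; rewrite in_itv/= => /andP[tu ut].
      have u0 : 0 < u by exact: lt_trans tu.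
      rewrite /lorentz_integrand EFinM; apply: lee_pmul.
      - by rewrite lee_fin powR_ge0.
      - by rewrite lee_fin invr_ge0 ltW.
      - rewrite -[leLHS]poweR_EFin; apply: gt0_ler_poweR; rewrite ?in_itv/= ?leey ?andbT ?(ltW s0)//.
        + by rewrite lee_fin mulr_ge0 ?powR_ge0// ltW.
        + by rewrite mule_ge0 ?rearrangement_ge0// lee_fin powR_ge0.
        rewrite EFinM; apply: lee_pmul; rewrite ?lee_fin ?powR_ge0 ?(ltW a0)//.
          by apply: ge0_ler_powR; rewrite ?nnegrE ?(ltW p'0) ?(ltW t20) ?(ltW u0) ?(ltW tu).
        apply: rearrangement_ge => //; apply: le_lt_trans td.
        by rewrite lee_fin.
      - by rewrite lee_fin lef_pV2.
    apply: ge0_subset_integral => //.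
    - exact: measurable_lorentz_integrand.
    - by move=> u /=; rewrite in_itv/= andbT; exact: lorentz_integrand_ge0.
    - move=> u /=; rewrite !in_itv/= andbT => /andP[+ _]; exact: lt_trans.
  rewrite -mulrA -ler_pdivrMl// mulrC.
  apply: key => //; first exact: powR_ge0.
  have X0 : 0 <= (t / 2) `^ p^-1 * a by rewrite mulr_ge0 ?powR_ge0// ltW.
  set X := _ * a in lb X0 *.
  have -> : X = (X `^ s) `^ s^-1 by rewrite -powRrM divff ?gt_eqF// powRr1.
  apply: ge0_ler_powR; rewrite ?nnegrE ?powR_ge0 ?invr_ge0 ?(ltW s0) ?mulr_ge0//.
  by rewrite -ler_pdivrMl// mulrC.
move=> _; set N := lorentz_norm _ _ _ => Nfin.
have N0 : (0 <= N)%E.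
  apply: ereal_sup_ge; exists ((1 `^ p^-1)%:E * rearrangement w 1)%E.
    by exists 1 => //=; exact: ltr01.
  by rewrite mule_ge0 ?rearrangement_ge0// lee_fin powR_ge0.
have NE : N = (fine N)%:E by rewrite fineK// ge0_fin_numE.
exists (fine N `^ p); first exact: powR_ge0.
move=> a a0; apply: ereal_le_real_bound => [|t t0 td].
  by rewrite mulr_ge0 ?powR_ge0.
apply: key; rewrite ?fine_ge0//.
rewrite -lee_fin -NE; apply: ereal_sup_ge.
exists ((t `^ p^-1)%:E * rearrangement w t)%E; first by exists t.
rewrite EFinM; apply: lee_wpmul2l; first by rewrite lee_fin powR_ge0.
exact: rearrangement_ge.
Qed.

End weak_type.

(** * Lebesgue measure and dyadic cubes *)

Section lebesgue_Rn.
Context (R : realType) (n : nat).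
Local Notation leb := (@lebRn R n).
Local Notation Rn := (LebRn R n).

Lemma measurable_LebRn (A : set 'rV[R]_n) :
  measurable A -> measurable (A : set Rn).
Proof. by move=> mA; apply: sub_caratheodory; exact: sub_sigma_algebra. Qed.

Lemma measurable_fun_LebRn d (T : measurableType d) (f : 'rV[R]_n -> T) :
  measurable_fun setT f -> measurable_fun (setT : set Rn) f.
Proof.
by move=> mf _ Y mY; rewrite setTI; apply: measurable_LebRn; rewrite -[X in measurable X]setTI; exact: mf.
Qed.

Lemma measurable_coord (i : 'I_n) :
  measurable_fun (setT : set 'rV[R]_n) (fun x => x 0 i : R).
Proof.
move=> _ Y mY; rewrite setTI; apply: sub_sigma_algebra.
rewrite -bigcup_seq/=; exists i; first by rewrite /= mem_index_enum.
by exists Y => //; rewrite setTI.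
Qed.

(** The identity is measurable from the Lebesgue to the Borel sigma-algebra and pushes [lebRn]
    forward to [borel_lebesgue]. Through it Tonelli's theorem for the product measure reaches the
    completed one. *)
Lemma ge0_integral_LebRn (f : 'rV[R]_n -> \bar R) :
  measurable_fun setT f -> (forall x, 0 <= f x)%E ->
  (\int[leb]_x f x = \int[borel_lebesgue R n]_x f x)%E.
Proof.
move=> mf f0.
pose phi : Rn -> 'rV[R]_n := id.
have mphi : measurable_fun setT phi by apply: (@measurable_fun_LebRn _ 'rV[R]_n id); exact: measurable_id.
transitivity (\int[pushforward leb phi]_x f x)%E.
  by rewrite (ge0_integral_pushforward mphi)// preimage_setT.
apply: eq_measure_integral => A mA _ /=.
exact: measurable_mu_extE.
Qed.

Lemma borel_lebesgue_sigma_finite : sigma_finite setT (borel_lebesgue R n).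
Proof.
exists (fun k => rV_box (fun _ => `[- k.+1%:R, k.+1%:R]%classic : set (measurableTypeR R))).
  apply/esym; rewrite -subTset => x _.
  exists (Num.truncn (\sum_i `|x 0 i|)) => //= i.
  rewrite /= in_itv/= -ler_norml; apply: le_trans (ltW (truncnS_gt _)).
  by rewrite (bigD1 i)//= lerDl sumr_ge0.
move=> k; split; first by apply: measurable_rV_box => i; exact: measurable_itv.
rewrite borel_lebesgue_box//.
under eq_bigr do rewrite lebesgue_measure_itv/= lte_fin gtrN// -EFinB.

by rewrite prodEFin ltry.
Qed.

End lebesgue_Rn.

(* [borel_lebesgue R n] is a variable of a structure type, which cannot carry
   a further canonical instance; this alias can. *)
Definition borel_lebesgue_fun (R : realType) (n : nat) :
  set 'rV[R]_n -> \bar R := borel_lebesgue R n.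
HB.instance Definition _ (R : realType) (n : nat) :=
  Measure.copy (@borel_lebesgue_fun R n) (Measure.sort (borel_lebesgue R n)).
HB.instance Definition _ (R : realType) (n : nat) :=
  Measure_isSigmaFinite.Build _ _ _ (@borel_lebesgue_fun R n)
    (@borel_lebesgue_sigma_finite R n).

Lemma measurable_prod_coord (R : realType) n (g : 'I_n -> R -> R) :
  (forall i, measurable_fun setT (g i)) ->
  measurable_fun (setT : set 'rV[R]_n) (fun x => \prod_(i < n) g i (x 0 i)).
Proof.
move=> mg; apply: measurable_prod => i _.
by apply: measurableT_comp; [exact: mg|exact: measurable_coord].
Qed.

(** Tonelli along [rV_snoc], splitting off the last coordinate. The moments of boxes and the
    integrability of Schwartz functions both rest on it. *)
Lemma ge0_integral_prod_coord (R : realType) n (g : 'I_n -> R -> R) :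
  (forall i, measurable_fun setT (g i)) -> (forall i t, 0 <= g i t) ->
  (\int[borel_lebesgue R n]_x (\prod_(i < n) g i (x 0 i))%:E =
   \prod_(i < n) \int[lebesgue_measure]_t (g i t)%:E)%E.
Proof.
elim: n g => [|n IH] g mg g0.
  under eq_integral do rewrite big_ord0.
  by rewrite big_ord0 integral_cst//= diracT mule1.
rewrite big_ord_recr/= -IH//.
have lastE x t : rV_snoc (x, t) 0 ord_max = t :> R.
  by rewrite /rV_snoc mxE unlift_none.
have initE (x : 'rV[R]_n) (t : R) i :
    rV_snoc (x, t) 0 (widen_ord (leqnSn n) i) = x 0 i.
  have -> : widen_ord (leqnSn n) i = lift ord_max i.
    by apply: val_inj; rewrite /= /bump leqNgt ltn_ord.
  by rewrite /rV_snoc mxE liftK.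
rewrite (ge0_integral_pushforward (@measurable_rV_snoc R n))//; last 2 first.
- by apply/measurable_EFinP; exact: measurable_prod_coord.
- by move=> x _; rewrite lee_fin prodr_ge0.
rewrite preimage_setT.
have gx (x : 'rV[R]_n) t : \prod_(i < n.+1) g i (rV_snoc (x, t) 0 i) =
    \prod_(i < n) g (widen_ord (leqnSn n) i) (x 0 i) * g ord_max t.
  rewrite big_ord_recr/= lastE; congr (_ * _).
  by apply: eq_bigr => i _; rewrite initE.
rewrite (@fubini_tonelli1 _ _ _ _ _ [the {sigma_finite_measure set _ -> \bar R} of
  @borel_lebesgue_fun R n] (@lebesgue_measure R)); last 2 first.
- apply: (measurableT_comp _ (@measurable_rV_snoc R n)).
  by apply/measurable_EFinP; exact: measurable_prod_coord.
- by move=> x; rewrite lee_fin prodr_ge0.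
transitivity (\int[borel_lebesgue R n]_x
   ((\prod_(i < n) g (widen_ord (leqnSn n) i) (x 0 i))%:E *
    \int[lebesgue_measure]_t (g ord_max t)%:E))%E.
  apply: eq_integral => x _; rewrite /fubini_F /=.
  under eq_integral do rewrite gx EFinM.
  rewrite ge0_integralZl//.
  - by apply/measurable_EFinP; exact: mg.
  - by move=> t _; rewrite lee_fin.
  - by rewrite lee_fin prodr_ge0.
rewrite ge0_integralZr//.
- apply/measurable_EFinP.
  exact: (measurable_prod_coord (g := fun i => g (widen_ord (leqnSn n) i))).
- by move=> x _; rewrite lee_fin prodr_ge0.
- by apply: integral_ge0 => t _; rewrite lee_fin.
Qed.

(* [pickle_inv] rather than [unpickle], which need not be injective. *)
Definition family_seq (I : countType) (T : Type) (F : I -> set T) (P : set I)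
    (i : nat) : set T :=
  if pickle_inv i is Some z then if pselect (P z) then F z else set0 else set0.

Section countable_family.
Context (I : countType) (T : Type).
Implicit Types (F : I -> set T) (P : set I).

Lemma family_seq_bigcup F P : \bigcup_i family_seq F P i = \bigcup_(z in P) F z.
Proof.
apply/seteqP; split=> [x [i _]|x [z Pz Fx]].
  rewrite /family_seq; case: pickle_inv => // z; case: pselect => // Pz Fx.
  by exists z.
by exists (pickle z) => //; rewrite /family_seq pickleK_inv; case: pselect.
Qed.

Lemma family_seq_trivIset F P : trivIset P F -> trivIset setT (family_seq F P).
Proof.
move=> tF i j _ _ [x []]; rewrite /family_seq.
case ei: (pickle_inv i) => [z|] //; case: pselect => //= Pz Fz.
case ej: (pickle_inv j) => [z'|] //; case: pselect => //= Pz' Fz'.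
have zz' : z = z' by apply: tF => //; exists x.
have := @pickle_invK I i; have := @pickle_invK I j.
by rewrite ei ej/= zz' => -> .
Qed.

Lemma family_seq_ind F P (Q : set T -> Prop) :
  Q set0 -> (forall z, P z -> Q (F z)) -> forall i, Q (family_seq F P i).
Proof.
move=> Q0 QF i; rewrite /family_seq; case: pickle_inv => // z.
by case: pselect => // Pz; exact: QF.
Qed.

End countable_family.

Section integral_countable_family.
Local Open Scope ereal_scope.
Context (I : countType) d (T : measurableType d) (R : realType).
Variable mu : {measure set T -> \bar R}.
Implicit Types (F : I -> set T) (P : set I).

Lemma measurable_bigcup_family F P : (forall z, P z -> measurable (F z)) ->
  measurable (\bigcup_(z in P) F z).
Proof.
move=> mF; rewrite -family_seq_bigcup; apply: bigcupT_measurable => i.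
by apply: (family_seq_ind (Q := fun A : set T => measurable A)).
Qed.

Lemma integral_family_le F P (w : T -> \bar R) (c : R) :
  (forall z, P z -> measurable (F z)) -> trivIset P F ->
  measurable_fun setT w -> (forall x, 0 <= w x) ->
  (forall z, P z -> \int[mu]_(x in F z) w x <= c%:E * mu (F z)) ->
  \int[mu]_(x in \bigcup_(z in P) F z) w x <= c%:E * mu (\bigcup_(z in P) F z).
Proof.
move=> mF tF mw w0 wc; rewrite -family_seq_bigcup.
have mG i : measurable (family_seq F P i).
  by apply: (family_seq_ind (Q := fun A : set T => measurable A)).
have tG := family_seq_trivIset tF.
rewrite ge0_integral_bigcup//; last exact: measurable_funTS.
rewrite measure_semi_bigcup//; last exact: bigcupT_measurable.
rewrite -nneseriesZl//; apply: lee_nneseries => [i _ _|i _].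
  exact: integral_ge0.
apply: (family_seq_ind
  (Q := fun A => \int[mu]_(x in A) w x <= c%:E * mu A)) => //.
by rewrite integral_set0 measure0 mule0.
Qed.

Lemma measure_family_le F P (w : T -> \bar R) (c : R) (D : set T) :
  measurable D -> (0 <= c)%R ->
  (forall z, P z -> measurable (F z)) -> trivIset P F ->
  measurable_fun setT w -> (forall x, 0 <= w x) ->
  (forall z, P z -> mu (F z) <= c%:E * \int[mu]_(x in F z `&` D) w x) ->
  mu (\bigcup_(z in P) F z) <= c%:E * \int[mu]_(x in D) w x.
Proof.
move=> mD c0 mF tF mw w0 wc; rewrite -family_seq_bigcup.
have mG i : measurable (family_seq F P i).
  by apply: (family_seq_ind (Q := fun A : set T => measurable A)).
have tG := family_seq_trivIset tF.
rewrite measure_semi_bigcup//; last exact: bigcupT_measurable.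
apply: (@le_trans _ _ (c%:E * \int[mu]_(x in \bigcup_i (family_seq F P i `&` D)) w x)).
  rewrite ge0_integral_bigcup//.
  - rewrite -nneseriesZl//; last by move=> i _; exact: integral_ge0.
    apply: lee_nneseries => // i _; apply: (family_seq_ind
      (Q := fun A => mu A <= c%:E * \int[mu]_(x in A `&` D) w x)) => //.
    by rewrite set0I integral_set0 measure0 mule0.
  - by move=> i; exact: measurableI.
  - exact: measurable_funTS.
  - exact: trivIset_setIr.
apply: lee_wpmul2l; first by rewrite lee_fin.
apply: ge0_subset_integral => //.
- by apply: bigcupT_measurable => i; exact: measurableI.
- exact: measurable_funTS.
- by move=> x [i _ []].
Qed.

End integral_countable_family.

(** * Dyadic cubes and their nesting *)

Section dyadic_cubes.
Context (R : realType) (n : nat).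
Local Notation leb := (@lebRn R n).
Local Notation Rn := (LebRn R n).
Implicit Types (m : int) (x y : 'rV[R]_n).

(** Level [m] has side [2 ^ m], so larger levels are coarser. With cubes as fibres of this map,
    disjointness within a level and nesting between levels become statements about equal indices. *)
Definition dyadic_index m x : {ffun 'I_n -> int} :=
  [ffun i => Num.floor (x 0 i / 2 ^ m)].

Definition dyadic_cube m (z : {ffun 'I_n -> int}) : set 'rV[R]_n :=
  [set x | dyadic_index m x = z].

Definition dyadic_corner m (z : {ffun 'I_n -> int}) : 'rV[R]_n :=
  \row_i (2 ^ m * (z i)%:~R).

Lemma side_gt0 m : 0 < 2 ^ m :> R. Proof. exact: exprz_gt0. Qed.

Lemma dyadic_cube_box m z : dyadic_cube m z =
  rV_box (fun i => `[dyadic_corner m z 0 i, dyadic_corner m z 0 i + 2 ^ m[%classic).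
Proof.
have m0 := side_gt0 m.
apply/seteqP; split=> x /=.
  move=> <- i; rewrite /= in_itv/= mxE ffunE.
  have /andP[h1 h2] := floor_itv (x 0 i / 2 ^ m).
  rewrite ![2 ^ m * _]mulrC -ler_pdivlMr// h1/=.
  by rewrite -[X in _ * _ + X]mul1r -mulrDl -ltr_pdivrMr// -intrD1.
move=> H; apply/ffunP => i; rewrite ffunE; apply: floor_def.
have := H i; rewrite /= in_itv/= mxE mulrC => /andP[h1 h2].
rewrite ler_pdivlMr// h1/= ltr_pdivrMr// rmorphD/= mulrDl mul1r//.
Qed.

Lemma measurable_dyadic_cube m z : measurable (dyadic_cube m z : set Rn).
Proof.
apply: measurable_LebRn; rewrite dyadic_cube_box; apply: measurable_rV_box => i.
exact: measurable_itv.
Qed.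

Lemma lebRn_dyadic_cube m z : leb (dyadic_cube m z) = ((2 ^ m) ^+ n)%:E.
Proof.
rewrite dyadic_cube_box lebRn_box => [|i]; last exact: measurable_itv.
under eq_bigr => i _.
  rewrite lebesgue_measure_itv/= lte_fin ltrDl side_gt0 -EFinB addrC addKr.
  over.
by rewrite prodEFin prodr_const card_ord.
Qed.

Lemma dyadic_corner_in m z : dyadic_cube m z (dyadic_corner m z).
Proof.
by rewrite dyadic_cube_box => i /=; rewrite in_itv/= lexx ltrDl side_gt0.
Qed.

Lemma dyadic_cube_index m x : dyadic_cube m (dyadic_index m x) x.
Proof. by []. Qed.

(** For an integer j, j <= t/2 holds iff 2j <= t, which depends only on the floor of t; hence the
    floor of t determines that of t/2. *)
Lemma dyadic_index_coarser m (k : nat) x y :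
  dyadic_index m x = dyadic_index m y ->
  dyadic_index (m + k%:Z) x = dyadic_index (m + k%:Z) y.
Proof.
move=> xy; elim: k => [|k IH]; first by rewrite addr0.
have -> : m + k.+1%:Z = m + k%:Z + 1 by rewrite -addrA -addn1 PoszD.
move: (m + k%:Z) IH => q /ffunP E; apply/ffunP => i; rewrite !ffunE.
have := E i; rewrite !ffunE => {}E.
have half (t : R) : t / 2 ^ (q + 1) = t / 2 ^ q / 2.
  by rewrite expfzDr// expr1z invfM mulrA.
rewrite !half; set s := _ / 2 ^ q in E *; set t := y 0 i / 2 ^ q in E *.
have /andP[h1 h2] := floor_itv (t / 2); apply: floor_def; apply/andP; split.
  rewrite ler_pdivlMr// -[2]/(2%:~R) -intrM -floor_ge_int E floor_ge_int.
  by rewrite intrM -ler_pdivlMr.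
rewrite ltr_pdivrMr// -[2]/(2%:~R) -intrM -floor_lt_int E floor_lt_int.
by rewrite intrM -ltr_pdivrMr.
Qed.

Lemma dyadic_index_le m m' x y : m <= m' ->
  dyadic_index m x = dyadic_index m y -> dyadic_index m' x = dyadic_index m' y.
Proof.
move=> mm' xy; have -> : m' = m + `|m' - m|%N%:Z.
  by rewrite gez0_abs ?subr_ge0// subrKC.
exact: dyadic_index_coarser.
Qed.

Lemma dyadic_cube_subset m m' z x : m <= m' -> dyadic_cube m z x ->
  dyadic_cube m z `<=` dyadic_cube m' (dyadic_index m' x).
Proof.
by move=> mm' xz y yz; apply: dyadic_index_le mm' _; exact: etrans yz (esym xz).
Qed.

(** Balls are taken in the maximum norm, so a cube of side below [e] lies in the ball of radius [e]
    around any of its points. Each set on the right is a union of cubes of a single level. *)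
Lemma open_dyadic_bigcup (U : set 'rV[R]_n) : open U ->
  U = \bigcup_(k : nat) [set x | dyadic_cube (- k%:Z) (dyadic_index (- k%:Z) x) `<=` U].
Proof.
move=> oU; apply/seteqP; split=> [x Ux|x [k _] /=]; last exact.
have /nbhs_ballP[e e0 xU] : nbhs x U by exact: open_nbhs_nbhs.
have [k ke] : exists k : nat, 2 ^ (- k%:Z) < e :> R.
  exists (Num.truncn e^-1).+1; rewrite -invr_expz -exprnP.
  rewrite -[ltRHS]invrK ltf_pV2 ?posrE ?exprn_gt0 ?invr_gt0//.
  apply: lt_le_trans (truncnS_gt _) _.
  by rewrite -natrX ler_nat ltnW// ltn_expl.
exists k => //= y yx; apply: xU.
have s0 := side_gt0 (- k%:Z).
split=> // i j; rewrite /ball/= ord1.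
have := dyadic_cube_index (- k%:Z) x; move: yx; rewrite dyadic_cube_box.
move=> /(_ j) /= + /(_ j) /=; rewrite !in_itv/= => /andP[h1 h2] /andP[h3 h4].
by rewrite ltr_norml; apply/andP; split; lra.
Qed.

Lemma dyadic_union_bigcup m (P : set {ffun 'I_n -> int}) :
  [set x | P (dyadic_index m x)] = \bigcup_(z in P) dyadic_cube m z.
Proof.
apply/seteqP; split=> [x /= Px|x [z Pz xz] /=]; first by exists (dyadic_index m x).
by rewrite (xz : dyadic_index m x = z).
Qed.

Lemma dyadic_cube_trivIset m (P : set {ffun 'I_n -> int}) :
  trivIset P (dyadic_cube m).
Proof. by move=> z z' _ _ [x [xz xz']]; exact: etrans (esym xz) xz'. Qed.

Lemma measurable_dyadic_union m (P : set {ffun 'I_n -> int}) :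
  measurable ([set x | P (dyadic_index m x)] : set Rn).
Proof.
rewrite dyadic_union_bigcup; apply: measurable_bigcup_family => z _.
exact: measurable_dyadic_cube.
Qed.

Lemma open_measurable_LebRn (U : set 'rV[R]_n) : open U -> measurable (U : set Rn).
Proof.
move=> /open_dyadic_bigcup ->; apply: bigcupT_measurable => k.
exact: (@measurable_dyadic_union _ (fun z => dyadic_cube _ z `<=` U)).
Qed.

Lemma continuous_measurable_LebRn (f : 'rV[R]_n -> R) :
  continuous f -> measurable_fun (setT : set Rn) f.
Proof.
move=> /continuousP cf; apply: (measurability (@RGenOpens.G R)).
  exact: RGenOpens.measurableE.
move=> _ [_ [a [b ->]] <-]; rewrite setTI; apply: open_measurable_LebRn.
by apply: cf; exact: interval_open.
Qed.

End dyadic_cubes.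

(** * Dyadic density *)

Section dyadic_approximation.
Context (R : realType) (n : nat).
Local Notation leb := (@lebRn R n).
Local Notation Rn := (LebRn R n).
Implicit Types (A B D : set 'rV[R]_n).

Lemma lebRnU A B : (leb (A `|` B) <= leb A + leb B)%E.
Proof. exact: (outer_measureU2 (mu_ext (borel_lebesgue R n))). Qed.

Lemma lebRn_bigcup_null (F : nat -> set 'rV[R]_n) :
  (forall k, leb (F k) = 0%E) -> leb (\bigcup_k F k) = 0%E.
Proof.
move=> F0; apply/eqP; rewrite eq_le lebRn_ge0 andbT.
apply: le_trans (mu_ext_sigma_subadditive _ F) _; first exact: measure_ge0.
by rewrite eseries0// => k _ _; exact: F0.
Qed.

(* Sets that can be approximated inside [S] by unions of dyadic cubes of one
   size; [[set x | ~ (A x <-> D x)]] is the symmetric difference. *)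
Definition dyadic_approximable (S A : set 'rV[R]_n) : Prop :=
  measurable (A : set Rn) /\ forall e : R, 0 < e ->
  exists (k : nat) (P : set {ffun 'I_n -> int}),
    (leb (S `&` [set x | ~ (A x <-> P (dyadic_index (- k%:Z) x))]) <= e%:E)%E.

(** Brings two approximations to a common level. *)
Lemma dyadic_index_refine (k k' : nat) (P : set {ffun 'I_n -> int}) :
  (k <= k')%N -> exists P' : set {ffun 'I_n -> int},
  forall x : 'rV[R]_n, P' (dyadic_index (- k'%:Z) x) <-> P (dyadic_index (- k%:Z) x).
Proof.
move=> kk'; exists [set z | exists2 x : 'rV[R]_n, dyadic_index (- k'%:Z) x = z &
  P (dyadic_index (- k%:Z) x)] => x; split=> /= [[y yx Py]|Px]; last by exists x.
have <- : dyadic_index (- k%:Z) y = dyadic_index (- k%:Z) x.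
  by apply: dyadic_index_le yx; rewrite lerN2 lez_nat.
by [].
Qed.

Section fixed.
Variables (S : set 'rV[R]_n) (mS : measurable (S : set Rn)).
Hypothesis Sfin : (leb S < +oo)%E.

Lemma dyadic_approximableU A B : dyadic_approximable S A ->
  dyadic_approximable S B -> dyadic_approximable S (A `|` B).
Proof.
move=> [mA HA] [mB HB]; split; first exact: measurableU.
move=> e e0; have e20 : 0 < e / 2 by rewrite divr_gt0.
have [k [P HP]] := HA _ e20; have [k' [P' HP']] := HB _ e20.
have [Q HQ] := dyadic_index_refine P (leq_maxl k k').
have [Q' HQ'] := dyadic_index_refine P' (leq_maxr k k').
exists (maxn k k'), (Q `|` Q').
apply: (@le_trans _ _ (leb ((S `&` [set x | ~ (A x <-> P (dyadic_index (- k%:Z) x))])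
   `|` (S `&` [set x | ~ (B x <-> P' (dyadic_index (- k'%:Z) x))])))).
  apply: le_lebRn => x /= [Sx xAB]; apply: contrapT => H; apply: xAB.
  have [hA hB] : (A x <-> P (dyadic_index (- k%:Z) x)) /\
      (B x <-> P' (dyadic_index (- k'%:Z) x)).
    by split; apply: contrapT => h; apply: H; [left|right].
  by have := HQ x; have := HQ' x; tauto.
apply: le_trans (lebRnU _ _) _.
by rewrite [e]splitr EFinD; apply: leeD.
Qed.

Lemma dyadic_approximable0 : dyadic_approximable S set0.
Proof.
split=> [|e e0]; first exact: measurable0.
exists 0%N, set0; rewrite (_ : _ `&` _ = set0) ?measure0 ?lee_fin ?ltW//.
by apply/seteqP; split=> // x [_] /=; tauto.
Qed.

Lemma dyadic_approximableC A : dyadic_approximable S A ->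
  dyadic_approximable S (~` A).
Proof.
move=> [mA HA]; split=> [|e e0]; first exact: measurableC.
have [k [P HP]] := HA _ e0; exists k, (~` P).
apply: le_trans HP; apply: le_lebRn => x [Sx /=] H; split=> // H'; apply: H.
by rewrite /=; tauto.
Qed.

Lemma dyadic_approximable_bigcup (F : nat -> set 'rV[R]_n) :
  (forall i, dyadic_approximable S (F i)) ->
  dyadic_approximable S (\bigcup_i F i).
Proof.
move=> HF.
have mF i : measurable (F i : set Rn) by have [] := HF i.
have mUF : measurable (\bigcup_i F i : set Rn) by exact: bigcupT_measurable.
split=> // e e0.
pose U N := \big[setU/set0]_(i < N) F i.
have HU N : dyadic_approximable S (U N).
  rewrite /U; elim: N => [|N IH]; first by rewrite big_ord0; exact: dyadic_approximable0.
  by rewrite big_ord_recr/=; exact: dyadic_approximableU.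
have mU N : measurable (U N : set Rn) by have [] := HU N.
pose W N := (S `&` (\bigcup_i F i `\` U N)) : set Rn.
have mW N : measurable (W N) by apply: measurableI => //; exact: measurableD.
have W0 : \bigcap_N W N = set0.
  apply/seteqP; split=> // x Wx.
  have [_ [[i _ Fix] _]] := Wx 0%N I.
  have [_ [_]] := Wx i.+1 I; apply.
  by rewrite /U big_ord_recr/=; right.
(* What the first [N] sets miss inside [S] decreases to the empty set; continuity from above uses
   the finite measure of [S]. *)
have Wcvg : leb (W N) @[N --> \oo] --> 0%E.
  rewrite -(measure0 leb) -W0; apply: nonincreasing_cvg_mu => //.
  - by apply: le_lt_trans Sfin; apply: le_lebRn => x [].
  - by rewrite W0; exact: measurable0.
  - move=> N M NM; apply/subsetPset => x [Sx [Fx nU]]; split=> //; split=> // UN.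
    by apply: nU; exact: (@subset_bigsetU _ F N M NM).
have e20 : (0 < (e / 2)%:E :> \bar R)%E by rewrite lte_fin divr_gt0.
have [N _ /(_ N (leqnn N)) /= WN] := Wcvg _ (open_nbhs_nbhs
  (conj (@open_ereal_lt_ereal R (e / 2)%:E) e20)).
have [_ /(_ (e / 2))] := HU N; rewrite divr_gt0// => /(_ isT)[k [P HP]].
exists k, P; apply: (@le_trans _ _ (leb (W N `|`
  (S `&` [set x | ~ (U N x <-> P (dyadic_index (- k%:Z) x))])))).
  apply: le_lebRn => x /= [Sx xAB].
  have UF : U N x -> (\bigcup_i F i) x by exact: bigsetU_bigcup.
  have [Ux|nUx] := pselect (U N x).
    by right; split=> // H; apply: xAB; tauto.
  have [Fx|nFx] := pselect ((\bigcup_i F i) x); first by left.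
  by right; split=> // H; apply: xAB; tauto.
apply: le_trans (lebRnU _ _) _.
by rewrite [e]splitr EFinD; apply: leeD => //; exact: ltW.
Qed.

Lemma dyadic_approximable_union (k : nat) (P : set {ffun 'I_n -> int}) :
  dyadic_approximable S [set x | P (dyadic_index (- k%:Z) x)].
Proof.
split=> [|e e0]; first exact: measurable_dyadic_union.
exists k, P; rewrite (_ : _ `&` _ = set0) ?measure0 ?lee_fin ?ltW//.
by apply/seteqP; split=> // x [_] /=; tauto.
Qed.

Lemma dyadic_approximable_open (U : set 'rV[R]_n) :
  open U -> dyadic_approximable S U.
Proof.
move=> /open_dyadic_bigcup ->; apply: dyadic_approximable_bigcup => k.
exact: (@dyadic_approximable_union _ (fun z => dyadic_cube _ z `<=` U)).
Qed.

(** The approximable sets form a sigma-algebra, and the preimage of an open interval under a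
    coordinate is open. *)
Lemma dyadic_approximable_borel A : measurable A -> dyadic_approximable S A.
Proof.
move: A; change ((measurable : set (set 'rV[R]_n)) `<=` dyadic_approximable S).
have GC A : dyadic_approximable S A -> dyadic_approximable S (~` A).
  exact: dyadic_approximableC.
apply: smallest_sub.
  split => [|A GA|F GF]; first exact: dyadic_approximable0.
  - by rewrite setTD; exact: GC.
  - exact: dyadic_approximable_bigcup.
rewrite -bigcup_seq/= => Y [i _ [B mB <-]] /=; rewrite setTI.
move: B mB; change ((measurable : set (set (measurableTypeR R))) `<=`
  [set B | dyadic_approximable S (@rV_coord R n i @^-1` B)]).
have -> : (measurable : set (set (measurableTypeR R))) = <<s @RGenOpens.G R >>.
  exact: RGenOpens.measurableE.
apply: smallest_sub.
  split => [|A GA|F GF] /=.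
  - by rewrite preimage_set0; exact: dyadic_approximable0.
  - by rewrite setTD preimage_setC; exact: GC.
  - by rewrite preimage_bigcup; exact: dyadic_approximable_bigcup.
move=> _ [a [b ->]] /=; apply: dyadic_approximable_open.
by move/continuousP : (@coord_continuous R 1 n 0 i); apply; exact: interval_open.
Qed.

End fixed.

Lemma lebRn_outer_borel A (e : R) : (leb A < +oo)%E -> 0 < e ->
  exists B : set 'rV[R]_n, [/\ measurable B, A `<=` B & (leb B <= leb A + e%:E)%E].
Proof.
move=> Afin e0.
have Af : leb A \is a fin_num by rewrite ge0_fin_numE// lebRn_ge0.
have : (leb A < leb A + e%:E)%E by rewrite lteDl// lte_fin.
move=> /ereal_inf_lt[_ [F [mF AF] <-] Fe].
exists (\bigcup_i F i); split => //; first exact: bigcupT_measurable.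
apply: le_trans (ltW Fe).
have mUF : measurable (\bigcup_i F i) by exact: bigcupT_measurable.
rewrite [leLHS](_ : _ = borel_lebesgue R n (\bigcup_i F i)); last exact: measurable_mu_extE.
exact: measure_sigma_subadditive.
Qed.

End dyadic_approximation.

Section dyadic_density.
Context (R : realType) (n : nat).
Local Notation leb := (@lebRn R n).
Local Notation Rn := (LebRn R n).
Variable w : 'rV[R]_n -> R.
Hypothesis mw : measurable_fun (setT : set Rn) w.
Hypothesis w0 : forall x, 0 <= w x.

Let mEw : measurable_fun (setT : set Rn) (EFin \o w).
Proof. exact/measurable_EFinP. Qed.

Let dyadic_density_arith (d v e : R) : 0 < d * v ->
  e * (2 * (3 + d)) = d * v -> (1 + d) * (v - e) <= v + e + e -> False.
Proof. move=> ? ? ?; lra. Qed.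

(** If [E] had measure [v > 0], it would be approximated up to errors [e] by a union [D'] of small
    cubes meeting [E]. The mean of [w] over each is at most [c], although [w >= c * (1 + d)] on most
    of [D']; this gives [(1 + d) * (v - e) <= v + e + e], false for small [e]. *)
Let dyadic_density_aux (E : set 'rV[R]_n) (z : {ffun 'I_n -> int}) (c d : R) :
  0 < c -> 0 < d -> measurable (E : set Rn) -> E `<=` dyadic_cube 0 z ->
  (forall x, E x -> c * (1 + d) <= w x) ->
  (forall x m, E x -> (\int[leb]_(x in dyadic_cube m (dyadic_index m x)) (w x)%:E
     <= c%:E * leb (dyadic_cube m (dyadic_index m x)))%E) ->
  leb E = 0%E.
Proof.
move=> c0 d0 mE Ez Ew Eavg.
set S := dyadic_cube 0 z in Ez.
have mS : measurable (S : set Rn) by exact: measurable_dyadic_cube.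
have Sfin : (leb S < +oo)%E by rewrite lebRn_dyadic_cube ltry.
have Efin : (leb E < +oo)%E by apply: le_lt_trans Sfin; exact: le_lebRn.
have Ef : leb E \is a fin_num by rewrite ge0_fin_numE// lebRn_ge0.
have [v v0 vE] : exists2 v : R, 0 <= v & leb E = v%:E.
  by exists (fine (leb E)); rewrite ?fine_ge0 ?lebRn_ge0// fineK.
move: v0; rewrite le_eqVlt => /orP[/eqP v0|v0]; first by rewrite vE -v0.
(* The final inequality amounts to [d * v <= (3 + d) * e]; half of the critical value contradicts
   it. *)
pose e := d * v / (2 * (3 + d)).
have d30 : 0 < 2 * (3 + d) by rewrite mulr_gt0// addr_gt0.
have e0 : 0 < e by rewrite divr_gt0// mulr_gt0.
have [B [mB EB lB]] := lebRn_outer_borel Efin e0.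
have [_ /(_ e e0)[k [P HP]]] := dyadic_approximable_borel mS Sfin mB.
pose D := [set x | P (dyadic_index (- k%:Z) x)] : set Rn.
have mD : measurable D by exact: measurable_dyadic_union.
(* Only cubes meeting [E] are kept, since [Eavg] bounds the means over these. *)
pose P' := [set q | P q /\ exists2 y, E y & dyadic_index (- k%:Z) y = q].
pose D' := [set x | P' (dyadic_index (- k%:Z) x)] : set Rn.
have mD' : measurable D' by exact: measurable_dyadic_union.
have D'D : D' `<=` S `&` D.
  move=> x [Px [y Ey yx]]; split=> //.
  change (dyadic_index 0 x = z); rewrite -(Ez y Ey : dyadic_index 0 y = z).
  by apply: (dyadic_index_le _ (esym yx)); rewrite oppr_le0.
have ED' : E `&` D `<=` D' by move=> x [Ex Dx]; split => //; exists x.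
have h1 : (v%:E <= leb (E `&` D) + e%:E)%E.
  rewrite -vE; apply: le_trans (leeD (lexx _) HP).
  apply: le_trans (lebRnU _ _); apply: le_lebRn => x Ex.
  have [Dx|nDx] := pselect (D x); first by left.
  by right; split; [exact: Ez|move=> /= H; apply: nDx; apply/H/EB].
have h2 : (leb D' <= v%:E + e%:E + e%:E)%E.
  rewrite -vE; apply: le_trans (leeD lB HP).
  apply: le_trans (lebRnU _ _); apply: le_lebRn => x /D'D [Sx Dx].
  have [Bx|nBx] := pselect (B x); first by left.
  by right; split => // H; apply: nBx; apply/H.
have h3 : ((c * (1 + d))%:E * leb (E `&` D) <= c%:E * leb D')%E.
  apply: (@le_trans _ _ (\int[leb]_(x in E `&` D) (w x)%:E)%E).
    rewrite -integral_cst//; last exact: measurableI.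
    apply: ge0_le_integral; first exact: measurableI.
    - by move=> x _; rewrite lee_fin !mulr_ge0 ?addr_ge0// ltW.
    - exact: measurable_cst.
    - exact: measurable_funTS.
    - by move=> x [Ex _]; rewrite lee_fin; exact: Ew.
  apply: (@le_trans _ _ (\int[leb]_(x in D') (w x)%:E)%E).
    apply: ge0_subset_integral; [exact: measurableI|exact: mD'|..].
    - exact: measurable_funTS.
    - by move=> x _; rewrite lee_fin.
    - exact: ED'.
  rewrite /D' dyadic_union_bigcup.
  apply: (@integral_family_le _ _ Rn R leb (dyadic_cube (- k%:Z)) P' (EFin \o w)) => //.
  - by move=> q _; exact: measurable_dyadic_cube.
  - exact: dyadic_cube_trivIset.
  - by move=> q [_ [y Ey <-]]; exact: Eavg.
have EDf : leb (E `&` D) \is a fin_num.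
  rewrite ge0_fin_numE ?lebRn_ge0//; apply: le_lt_trans Efin.
  by apply: le_lebRn => x [].
have D'f : leb D' \is a fin_num.
  rewrite ge0_fin_numE ?lebRn_ge0//; apply: le_lt_trans Sfin.
  by apply: le_lebRn => x /D'D [].
move: h1 h2 h3; rewrite -(fineK EDf) -(fineK D'f) -!EFinD -!EFinM !lee_fin.
set u := fine _; set u' := fine (leb D') => h1 h2.
rewrite -mulrA ler_pM2l// => h3.
have eE : e * (2 * (3 + d)) = d * v by rewrite /e divfK// gt_eqF.
have : (1 + d) * (v - e) <= v + e + e.
  apply: le_trans h2; apply: le_trans h3; apply: ler_wpM2l; last lra.
  by rewrite addr_ge0// ltW.
have dv0 : 0 < d * v by rewrite mulr_gt0.
by move=> /(dyadic_density_arith dv0 eE).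
Qed.

(** A substitute for the Lebesgue differentiation theorem. [E] is cut into countably many pieces,
    each inside a unit cube and with [w] above [c] by a fixed factor. *)
Lemma dyadic_density (E : set 'rV[R]_n) (c : R) : 0 < c ->
  measurable (E : set Rn) -> (forall x, E x -> c < w x) ->
  (forall x m, E x -> (\int[leb]_(x in dyadic_cube m (dyadic_index m x)) (w x)%:E
     <= c%:E * leb (dyadic_cube m (dyadic_index m x)))%E) ->
  leb E = 0%E.
Proof.
move=> c0 mE Ew Eavg.
pose G (j : nat) (z : {ffun 'I_n -> int}) :=
  E `&` dyadic_cube 0 z `&` [set x | c * (1 + j.+1%:R^-1) <= w x].
have mG j z : measurable (G j z : set Rn).
  apply: measurableI; first by apply: measurableI => //; exact: measurable_dyadic_cube.
  rewrite (_ : mkset _ = w @^-1` `[c * (1 + j.+1%:R^-1), +oo[%classic).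
    by rewrite -[X in measurable X]setTI; exact: mw.
  by apply/seteqP; split=> x /=; rewrite in_itv/= andbT.
have G0 j z : leb (G j z) = 0%E.
  apply: (@dyadic_density_aux _ z c j.+1%:R^-1) => //.
  - by move=> x [[]].
  - by move=> x [].
  - by move=> x m [[Ex _] _]; exact: Eavg.
apply/eqP; rewrite eq_le lebRn_ge0 andbT.
rewrite -(@lebRn_bigcup_null _ _ (fun j => \bigcup_i family_seq (G j) setT i)); last first.
  move=> j; apply: lebRn_bigcup_null => i.
  by apply: (family_seq_ind (Q := fun A => leb A = 0%E)) => //; exact: measure0.
apply: le_lebRn => x Ex.
pose t := w x / c - 1.
have t0 : 0 < t by rewrite subr_gt0 ltr_pdivlMr// mul1r Ew.
exists (Num.truncn t^-1) => //; rewrite family_seq_bigcup.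
exists (dyadic_index 0 x) => //; split=> //=.
rewrite mulrC -ler_pdivlMr// addrC -lerBrDr -/t.
by rewrite -[leRHS]invrK lef_pV2 ?posrE ?invr_gt0// ltW// truncnS_gt.
Qed.

End dyadic_density.

(** * Projections with prescribed moments *)

Section step_moments.
Context (R : realType) (K : nat).

Definition node (i : nat) : R := i%:R / K.+1%:R.

(* [step_moment i b] is the integral of [t ^ b] over [[node i, node i.+1]]. *)
Definition step_moment : 'M[R]_K.+1 :=
  \matrix_(i, b) ((node i.+1 ^+ b.+1 - node i ^+ b.+1) / b.+1%:R).

Lemma node_ge0 i : 0 <= node i. Proof. by rewrite divr_ge0. Qed.

Lemma node_lt i : node i < node i.+1.
Proof. by rewrite ltr_pM2r ?invr_gt0// ltr_nat. Qed.

Lemma node_le1 i : (i <= K.+1)%N -> node i <= 1.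
Proof. by move=> iK; rewrite ler_pdivrMr// mul1r ler_nat. Qed.

(* A row vector killed by the transpose is the coefficient vector of the
   derivative of a polynomial of degree [K.+1] with [K.+2] zeros. *)
Lemma step_moment_unit : step_moment \in unitmx.
Proof.
rewrite -unitmx_tr -row_free_unit -kermx_eq0; apply/eqP/row_matrixP => k.
rewrite row0; set u := row k _.
have uM : u *m step_moment^T = 0 by apply/sub_kermxP; exact: row_sub.
pose P : {poly R} := \poly_(j < K.+2) (if j is b.+1 then u 0 (inord b) / b.+1%:R else 0).
have PE x : P.[x] = \sum_(b < K.+1) u 0 b / b.+1%:R * x ^+ b.+1.
  rewrite horner_poly big_ord_recl/= mul0r add0r; apply: eq_bigr => b _.
  by rewrite /bump/= inord_val.
have step (i : 'I_K.+1) : P.[node i.+1] = P.[node i].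
  apply/eqP; rewrite -subr_eq0 !PE -sumrB.
  have /rowP/(_ i) := uM; rewrite !mxE => uMi; rewrite -[eqbRHS]uMi; apply/eqP.
  by apply: eq_bigr => b _; rewrite !mxE -mulrBr mulrAC mulrA.
have P0 i : (i <= K.+1)%N -> P.[node i] = 0.
  elim: i => [_|i IH iK].
    by rewrite PE big1// => b _; rewrite /node mul0r expr0n/= mulr0.
  by rewrite -(IH (ltnW iK)); exact: (step (Ordinal iK)).
have Pz : P = 0.
  apply: (@roots_geq_poly_eq0 _ _ [seq node i | i <- iota 0 K.+2]).
  - apply/allP => _ /mapP[i + ->]; rewrite mem_iota/= add0n ltnS => iK.
    by apply/rootP; exact: P0.
  - rewrite map_inj_uniq ?iota_uniq// => i j /(mulIf _) ij.
    apply/eqP; rewrite -(eqr_nat R); apply/eqP; apply: ij.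
    by rewrite invr_eq0 pnatr_eq0.
  - by rewrite size_map size_iota size_poly.
apply/rowP => b; rewrite [RHS]mxE.
have : P`_b.+1 = 0 by rewrite Pz coef0.
rewrite coef_poly ltnS ltn_ord inord_val => /eqP.
by rewrite mulf_eq0 invr_eq0 pnatr_eq0 orbF => /eqP.
Qed.

Lemma step_moment_dual (a b : 'I_K.+1) :
  \sum_i invmx step_moment a i * step_moment i b = (a == b)%:R.
Proof.
have /matrixP/(_ a b) := mulVmx step_moment_unit.
by rewrite !mxE.
Qed.

Lemma integral_step_monomial (c l : R) (i b : 'I_K.+1) : 0 < l ->
  (\int[lebesgue_measure]_t
     (\1_(`[(c + l * node i)%R, (c + l * node i.+1)%R[) t *
      ((t - c) / l) ^+ b)%:E = (l * step_moment i b)%:E)%E.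
Proof.
move=> l0; set A := `[_, _[%classic.
pose F (t : R) : R := l / b.+1%:R * ((t - c) / l) ^+ b.+1.
have ab : c + l * node i < c + l * node i.+1 by rewrite ltrD2l ltr_pM2l// node_lt.
have dF t : is_derive (t : R) (1 : R) F (((t - c) / l) ^+ b).
  pose q : {poly R} := (l / b.+1%:R) *: (l^-1 *: ('X - c%:P)) ^+ b.+1.
  have -> : F = horner q.
    by apply/funext => u; rewrite /F /q !hornerE [l^-1 * _]mulrC.
  have -> : ((t - c) / l) ^+ b = q^`().[t].
    rewrite /q derivZ deriv_exp derivZ derivXsubC !hornerE/=.
    rewrite hornerMn !hornerE -mulr_natr [l^-1 * (t - c)]mulrC.
    by set X := _ ^+ b; field; rewrite gt_eqF// addrC natr1 pnatr_eq0.
  exact: is_derive_poly.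
have cF : continuous F.
  move=> t; apply: differentiable_continuous; apply/derivable1_diffP.
  exact: (@ex_derive _ _ _ _ _ _ _ (dF t)).
have cf : continuous (fun t : R => ((t - c) / l) ^+ b).
  have -> : (fun t : R => ((t - c) / l) ^+ b) = horner ((l^-1 *: ('X - c%:P)) ^+ b).
    by apply/funext => u; rewrite !hornerE [l^-1 * _]mulrC.
  exact: continuous_horner.
transitivity (\int[lebesgue_measure]_(t in A) (((t - c) / l) ^+ b)%:E)%E.
  rewrite [RHS]integral_mkcond; apply: eq_integral => t _.
  rewrite patchE indicE; case: ifPn => _; by rewrite ?mul1r ?mul0r.
rewrite integral_itv_bndo_bndc; last first.
  apply/measurable_EFinP; apply: measurable_funTS; exact: continuous_measurable_fun.
rewrite (@continuous_FTC2 _ _ F) //.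
- rewrite -EFinB /F !mxE; congr EFin.
  have E u : (c + l * u - c) / l = u by field; rewrite gt_eqF.
  by rewrite !E -mulrBr -mulrA [_^-1 * _]mulrC.
- by apply: continuous_subspaceT.
- split.
  + by move=> t _; apply: ex_derive.
  + by apply: cvg_at_right_filter; exact: cF.
  + by apply: cvg_at_left_filter; exact: cF.
- by move=> t _; rewrite derive1E; exact: derive_val.
Qed.

End step_moments.

Section Rintegral_complements.
Context d (T : measurableType d) (R : realType) (mu : {measure set T -> \bar R}).
Variables (D : set T) (mD : measurable D).

Lemma Rintegral_sum (I : Type) (s : seq I) (f : I -> T -> R) :
  (forall i, mu.-integrable D (EFin \o f i)) ->
  (\int[mu]_(x in D) (\sum_(i <- s) f i x) =
   \sum_(i <- s) \int[mu]_(x in D) f i x)%R.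
Proof.
move=> fi; elim: s => [|i s IH].
  under eq_Rintegral do rewrite big_nil.
  by rewrite Rintegral_cst// mul0r big_nil.
under eq_Rintegral do rewrite big_cons.
rewrite RintegralD// ?IH ?big_cons//.
rewrite (_ : _ \o _ = fun x => (\sum_(j <- s) (EFin \o f j) x)%E).
  exact: integrable_sum.
by apply/funext => x /=; rewrite sumEFin.
Qed.

Lemma integrable_mul_bounded (f g : T -> R) (M : R) :
  mu.-integrable D (EFin \o f) -> measurable_fun D g ->
  (forall x, D x -> `|g x| <= M) ->
  mu.-integrable D (EFin \o (fun x => f x * g x)).
Proof.
move=> fi mg gM.
have := integrableMl mD fi mg; apply.
exists M; split; first exact: num_real.
by move=> y My x Dx /=; rewrite (le_trans (gM x Dx))// ltW.
Qed.

End Rintegral_complements.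

(** * A step function with the moments of f on a cube *)

Section moment_projection.
Context (R : realType) (n K : nat) (m : int) (z : {ffun 'I_n -> int}).
Local Notation leb := (@lebRn R n).
Local Notation Rn := (LebRn R n).
Local Notation multi := {ffun 'I_n -> 'I_K.+1}.
Implicit Types (al be ga : multi) (x : 'rV[R]_n).

Let c : 'rV[R]_n := dyadic_corner R m z.
Let l : R := 2 ^ m.
Let D : set 'rV[R]_n := dyadic_cube m z.
Let l0 : 0 < l. Proof. exact: side_gt0. Qed.
Let mD : measurable (D : set Rn). Proof. exact: measurable_dyadic_cube. Qed.

(** The exponents are bounded by [K] in each coordinate rather than in total degree, so that the
    moment problem on the cube is a tensor power of the one-dimensional one. *)
Definition scaled_monomial al x : R :=
  \prod_(j < n) ((x 0 j - c 0 j) / l) ^+ al j.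

Definition step_box ga : set 'rV[R]_n :=
  rV_box (fun j => `[c 0 j + l * node R K (ga j), c 0 j + l * node R K (ga j).+1[%classic).

Lemma measurable_step_box ga : measurable (step_box ga : set Rn).
Proof.
apply: measurable_LebRn; apply: measurable_rV_box => i; exact: measurable_itv.
Qed.

Lemma step_box_subset ga : step_box ga `<=` D.
Proof.
move=> x H; rewrite /D dyadic_cube_box => j; have := H j; rewrite /= !in_itv/= => /andP[h1 h2].
apply/andP; split.
  by apply: le_trans h1; rewrite lerDl mulr_ge0 ?node_ge0// ltW.
apply: lt_le_trans h2 _; rewrite lerD2l -[leRHS]mulr1 ler_pM2l//.
exact: node_le1.
Qed.

Lemma measurable_scaled_monomial al :
  measurable_fun (setT : set Rn) (scaled_monomial al).
Proof.
apply: measurable_fun_LebRn.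
apply: (measurable_prod_coord (g := fun j t => ((t - c 0 j) / l) ^+ al j)) => j.
apply: measurable_funX; apply: measurable_funM => //.
exact: measurable_funB.
Qed.

Lemma scaled_monomial_bound al x : D x -> 0 <= scaled_monomial al x <= 1.
Proof.
rewrite /D dyadic_cube_box => Dx; apply/andP; split.
  apply: prodr_ge0 => j _; apply: exprn_ge0; rewrite divr_ge0 ?(ltW l0)//.
  by have := Dx j; rewrite /= in_itv/= subr_ge0 => /andP[].
apply: prodr_ile1 => j _; have := Dx j; rewrite /= in_itv/= => /andP[h1 h2].
have h : 0 <= (x 0 j - c 0 j) / l <= 1.
  by rewrite divr_ge0 ?subr_ge0 ?(ltW l0)//= ler_pdivrMr// mul1r lerBlDl ltW.
by case/andP: h => h h'; rewrite exprn_ge0// exprn_ile1.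
Qed.

Lemma integral_step_box ga al :
  (\int[leb]_x (\1_(step_box ga) x * scaled_monomial al x)%:E =
   (l ^+ n * \prod_(j < n) step_moment R K (ga j) (al j))%:E)%E.
Proof.
pose A j : set R := `[c 0 j + l * node R K (ga j), c 0 j + l * node R K (ga j).+1[%classic.
pose g j (t : R) := \1_(A j) t * ((t - c 0 j) / l) ^+ al j.
have gE x : \1_(step_box ga) x * scaled_monomial al x = \prod_(j < n) g j (x 0 j).
  rewrite big_split/=; congr (_ * _).
  have [H|H] := pselect (step_box ga x); rewrite indicE ?(mem_set H) ?(memNset H).
    rewrite big1// => j _; rewrite indicE mem_set//; exact: H.
  have [j Hj] : exists j, ~ A j (x 0 j) by apply/existsNP.
  by rewrite (bigD1 j)//= indicE memNset// mul0r.
have mg j : measurable_fun setT (g j).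
  apply: measurable_funM; first by apply: measurable_indic; exact: measurable_itv.
  apply: measurable_funX; apply: measurable_funM => //; exact: measurable_funB.
have g0 j t : 0 <= g j t.
  rewrite /g indicE; case: (boolP (t \in A j)) => [|_]; last by rewrite mul0r.
  rewrite inE /A/= in_itv/= => /andP[h _].
  rewrite mul1r exprn_ge0// divr_ge0 ?(ltW l0)// subr_ge0.
  by apply: le_trans h; rewrite lerDl mulr_ge0 ?node_ge0// ltW.
under eq_integral do rewrite gE.
rewrite ge0_integral_LebRn; last 2 first.
- by apply/measurable_EFinP; exact: measurable_prod_coord.
- by move=> x; rewrite lee_fin prodr_ge0// => j _; exact: g0.
rewrite ge0_integral_prod_coord//.
under eq_bigr do rewrite integral_step_monomial//.
by rewrite prodEFin big_split/= prodr_const card_ord.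
Qed.

(** Entries of the inverse of the n-fold tensor power of [step_moment]. *)
Definition dual_coef al ga : R :=
  \prod_(j < n) invmx (step_moment R K) (al j) (ga j).

Lemma dual_coef_sum al be :
  \sum_ga dual_coef al ga * \prod_(j < n) step_moment R K (ga j) (be j) =
  (al == be)%:R.
Proof.
under eq_bigr do rewrite /dual_coef -big_split/=.
rewrite -(bigA_distr_bigA (fun j i =>
  invmx (step_moment R K) (al j) i * step_moment R K i (be j)))/=.
under eq_bigr do rewrite step_moment_dual.
have [->|/eqP ab] := eqVneq al be; first by rewrite big1// => j _; rewrite eqxx.
have [j /eqP Hj] : exists j, al j <> be j.
  by apply/existsNP => H; apply: ab; apply/ffunP.
by rewrite (bigD1 j)//= (negbTE Hj) mul0r.
Qed.

(* Independent of the cube, so that the projections are uniformly bounded. *)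
Definition projection_bound : R := \sum_ga \sum_al `|dual_coef al ga|.

Section projection.
Variable f : 'rV[R]_n -> R.
Hypothesis fi : leb.-integrable D (EFin \o f).

Definition scaled_moment al : R := \int[leb]_(x in D) (f x * scaled_monomial al x).

(** The combination of box indicators whose scaled moments are those of [f]; [l ^- n] offsets the
    volume factor of [integral_step_box]. *)
Definition projection x : R :=
  \sum_ga (l ^- n * \sum_al scaled_moment al * dual_coef al ga) * \1_(step_box ga) x.

Let mono_int (g : 'rV[R]_n -> R) al : leb.-integrable D (EFin \o g) ->
  leb.-integrable D (EFin \o (fun x => g x * scaled_monomial al x)).
Proof.
move=> gi; apply: (@integrable_mul_bounded _ _ _ _ _ mD _ _ 1) => //.
  by apply: measurable_funTS; exact: measurable_scaled_monomial.
by move=> x /(scaled_monomial_bound al)/andP[h1 h2]; rewrite ger0_norm.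
Qed.

Let indic_int ga : leb.-integrable D (EFin \o \1_(step_box ga)).
Proof.
apply/integrableP; split.
  by apply/measurable_EFinP; apply: measurable_indic; exact: measurable_step_box.
apply: (@le_lt_trans _ _ (leb D)); last by rewrite /D lebRn_dyadic_cube ltry.
under eq_integral do rewrite /= ger0_norm//.
rewrite integral_indic//; last exact: measurable_step_box.
by apply: le_lebRn => x [].
Qed.

Lemma measurable_projection : measurable_fun (setT : set Rn) projection.
Proof.
apply: measurable_sum => ga; apply: measurable_funM; first exact: measurable_cst.
by apply: measurable_indic; exact: measurable_step_box.
Qed.

Lemma projection_integrable : leb.-integrable D (EFin \o projection).
Proof.
rewrite (_ : _ \o _ = fun x => (\sum_ga
    (l ^- n * \sum_al scaled_moment al * dual_coef al ga)%:E *
    (\1_(step_box ga) x)%:E)%E).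
  by apply: integrable_sum => // ga _; apply: integrableZl => //; exact: indic_int.
by apply/funext => x; rewrite /= /projection -sumEFin.
Qed.

Lemma projection_moment al :
  \int[leb]_(x in D) (projection x * scaled_monomial al x) = scaled_moment al.
Proof.
transitivity (\sum_ga (l ^- n * \sum_be scaled_moment be * dual_coef be ga) *
    \int[leb]_(x in D) (\1_(step_box ga) x * scaled_monomial al x)).
  transitivity (\int[leb]_(x in D) (\sum_ga
     (l ^- n * \sum_be scaled_moment be * dual_coef be ga) *
     (\1_(step_box ga) x * scaled_monomial al x))).
    apply: eq_Rintegral => x _; rewrite /projection mulr_suml.
    by apply: eq_bigr => ga _; rewrite mulrA.
  rewrite Rintegral_sum//; last first.
    move=> ga; rewrite [X in leb.-integrable _ X](_ : _ = fun x =>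
      ((l ^- n * \sum_be scaled_moment be * dual_coef be ga)%:E *
       (EFin \o (fun x => \1_(step_box ga) x * scaled_monomial al x)%R) x)%E)//.
    by apply: integrableZl => //; apply: mono_int; exact: indic_int.
  apply: eq_bigr => ga _; rewrite RintegralZl//.
  by apply: mono_int; exact: indic_int.
have E ga : \int[leb]_(x in D) (\1_(step_box ga) x * scaled_monomial al x) =
    l ^+ n * \prod_(j < n) step_moment R K (ga j) (al j).
  rewrite /Rintegral integral_mkcond -[RHS]/(fine _%:E) -integral_step_box.
  congr fine; apply: eq_integral => x _; rewrite patchE.
  case: ifPn => //; rewrite notin_setE => nDx.
  rewrite indicE memNset ?mul0r// => /step_box_subset; exact: nDx.
under eq_bigr do rewrite E.
transitivity (\sum_ga \sum_be scaled_moment be *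
   (dual_coef be ga * \prod_(j < n) step_moment R K (ga j) (al j))).
  apply: eq_bigr => ga _; rewrite mulrCA !mulrA mulfV ?gt_eqF ?exprn_gt0// mul1r.
  by rewrite mulr_suml; apply: eq_bigr => be _; rewrite mulrA.
rewrite exchange_big/=.
under eq_bigr do rewrite -mulr_sumr dual_coef_sum.
rewrite (bigD1 al)//= eqxx mulr1 big1 ?addr0// => be /negbTE ->.
by rewrite mulr0.
Qed.

(** On the cube the scaled monomials take values between 0 and 1, so every scaled moment is at most
    the integral of |f|; the other coefficients do not see the cube. *)
Lemma projection_le x :
  `|projection x| <= projection_bound * (\int[leb]_(y in D) `|f y| / l ^+ n) * \1_D x.
Proof.
set I := \int[leb]_(y in D) `|f y|.
have I0 : 0 <= I by apply: Rintegral_ge0 => y _; exact: normr_ge0.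
have momle al : `|scaled_moment al| <= I.
  apply: le_trans (le_normr_Rintegral _ _) _ => //; first exact: mono_int.
  apply: le_Rintegral => //.
  - by apply: (integrable_norm (mono_int _ _)).
  - exact: (integrable_norm fi).
  move=> y /(scaled_monomial_bound al)/andP[h1 h2].
  by rewrite normrM ler_piMr// ger0_norm.
have [Dx|nDx] := pselect (D x); last first.
  rewrite (_ : projection x = 0) ?normr0.
    by rewrite indicE memNset// mulr0.
  rewrite /projection big1// => ga _.
  by rewrite indicE memNset ?mulr0// => /step_box_subset; exact: nDx.
rewrite indicE mem_set// mulr1; apply: le_trans (ler_norm_sum _ _ _) _.
rewrite /projection_bound mulr_suml; apply: ler_sum => ga _.
rewrite !normrM [X in X * _ * _]ger0_norm ?invr_ge0 ?exprn_ge0 ?(ltW l0)//.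
apply: (@le_trans _ _ (l ^- n * `|\sum_al scaled_moment al * dual_coef al ga|)).
  rewrite ler_piMr// ?mulr_ge0 ?invr_ge0 ?exprn_ge0 ?(ltW l0)// indicE.
  by case: (_ \in _); rewrite ?normr1 ?normr0.
rewrite mulrA mulrC; apply: ler_wpM2r.
  by rewrite invr_ge0 exprn_ge0// ltW.
apply: le_trans (ler_norm_sum _ _ _) _; rewrite mulr_suml; apply: ler_sum => al _.
by rewrite normrM mulrC ler_wpM2l.
Qed.

(** Binomial expansion around the corner in each coordinate. Every sum may run up to [K] because the
    binomial coefficients vanish beyond [be j]. *)
Lemma monomial_scaled (be : {ffun 'I_n -> nat}) : (forall j, be j <= K)%N ->
  exists k : multi -> R, forall x, monomial be x = \sum_al k al * scaled_monomial al x.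
Proof.
move=> beK.
pose kap j (a : 'I_K.+1) : R := c 0 j ^+ (be j - a) * l ^+ a *+ 'C(be j, a).
exists (fun al => \prod_(j < n) kap j (al j)) => x.
rewrite /monomial /scaled_monomial.
under [RHS]eq_bigr do rewrite -big_split/=.
rewrite -(bigA_distr_bigA (fun j a => kap j a * ((x 0 j - c 0 j) / l) ^+ a))/=.
apply: eq_bigr => j _.
set u := (x 0 j - c 0 j) / l.
have -> : x 0 j = c 0 j + l * u by rewrite /u; field; rewrite gt_eqF.
rewrite exprDn.
rewrite (big_ord_widen K.+1
  (fun a => c 0 j ^+ (be j - a) * (l * u) ^+ a *+ 'C(be j, a)))//; last exact: beK.
rewrite big_mkcond/=; apply: eq_bigr => a _; rewrite /kap ltnS.
case: leqP => [_|ab]; first by rewrite exprMn mulrA mulrnAl.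
by rewrite bin_small// mulr0n mul0r.
Qed.

Lemma projection_orthogonal (be : {ffun 'I_n -> nat}) : (forall j, be j <= K)%N ->
  \int[leb]_(x in D) ((f x - projection x) * monomial be x) = 0.
Proof.
move=> /monomial_scaled[k kE].
have hi : leb.-integrable D (EFin \o (fun x => f x - projection x)).
  have := integrableB mD fi projection_integrable.
  by apply: eq_integrable => // x _.
transitivity (\int[leb]_(x in D)
    (\sum_al k al * ((f x - projection x) * scaled_monomial al x))).
  apply: eq_Rintegral => x _; rewrite kE mulr_sumr.
  by apply: eq_bigr => al _; rewrite mulrCA.
rewrite Rintegral_sum//; last first.
  move=> al; rewrite [X in leb.-integrable _ X](_ : _ = fun x =>
    ((k al)%:E *
       (EFin \o (fun x => (f x - projection x) * scaled_monomial al x)%R) x)%E)//.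
  by apply: integrableZl => //; exact: mono_int.
rewrite big1// => al _; rewrite RintegralZl//; last exact: mono_int.
have -> : \int[leb]_(x in D) ((f x - projection x) * scaled_monomial al x) =
    scaled_moment al - \int[leb]_(x in D) (projection x * scaled_monomial al x).
  rewrite -RintegralB//; first by apply: eq_Rintegral => x _; rewrite mulrBl.
  - exact: mono_int.
  - by apply: mono_int; exact: projection_integrable.
by rewrite projection_moment subrr mulr0.
Qed.

End projection.
End moment_projection.

Lemma exists_moment_projection (R : realType) (n K : nat) :
  exists2 C : R, 0 < C & forall m (z : {ffun 'I_n -> int}) (f : 'rV[R]_n -> R),
    (@lebRn R n).-integrable (dyadic_cube m z) (EFin \o f) ->
    exists h : 'rV[R]_n -> R,
    [/\ measurable_fun (setT : set (LebRn R n)) h,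
      (@lebRn R n).-integrable (dyadic_cube m z) (EFin \o h),
      forall x, `|h x| <= C *
        (\int[@lebRn R n]_(y in dyadic_cube m z) `|f y| / (2 ^ m) ^+ n) *
        \1_(dyadic_cube m z) x &
      forall be : {ffun 'I_n -> nat}, (forall j, be j <= K)%N ->
        \int[@lebRn R n]_(x in dyadic_cube m z) ((f x - h x) * monomial be x) = 0].
Proof.
(* A sum of absolute values is only known to be nonnegative; adding 1 makes the constant
   positive. *)
exists (projection_bound R n K + 1).
  by rewrite ltr_wpDl// !sumr_ge0// => ga _; rewrite sumr_ge0.
move=> m z f fi; exists (projection K m z f); split.
- exact: measurable_projection.
- exact: projection_integrable.
- move=> x; apply: le_trans (projection_le K fi x) _.
  rewrite ler_wpM2r// ler_wpM2r ?lerDl// divr_ge0 ?exprn_ge0 ?(ltW (side_gt0 _ _))//.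
  by apply: Rintegral_ge0 => y _; exact: normr_ge0.
- by move=> be; exact: projection_orthogonal.
Qed.

(** * The dyadic maximal function *)

Section stopping_cubes.
Context (R : realType) (n : nat) (n0 : (0 < n)%N).
Local Notation leb := (@lebRn R n).
Local Notation Rn := (LebRn R n).
Local Notation cube := (int * {ffun 'I_n -> int})%type.
Variable w : 'rV[R]_n -> R.
Hypothesis mw : measurable_fun (setT : set Rn) w.
Hypothesis w0 : forall x, 0 <= w x.

Definition superlevel (a : R) : set 'rV[R]_n := [set x | a < w x].

Hypothesis w_tail : forall a : R, 0 < a ->
  (\int[leb]_(x in superlevel a) (w x)%:E < +oo)%E.
Implicit Types (q : cube) (x : 'rV[R]_n) (c : R).

Definition dcube q : set 'rV[R]_n := dyadic_cube q.1 q.2.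

Definition mass q : \bar R := (\int[leb]_(x in dcube q) (w x)%:E)%E.

Definition heavy c q := (c%:E * leb (dcube q) < mass q)%E.

(** Maximality is tested at points: the coarser dyadic cubes containing [q] are the cubes of level
    above [q.1] through its points. *)
Definition selected c : set cube := [set q | heavy c q /\
  forall x m, dcube q x -> q.1 < m -> ~ heavy c (m, dyadic_index m x)].

(** For [c > 0], by [heavy_selected], the set where the dyadic maximal function of [w] exceeds
    [c]. *)
Definition Omega c : set 'rV[R]_n := \bigcup_(q in selected c) dcube q.

Let mEw D : measurable_fun (D : set Rn) (EFin \o w).
Proof. by apply: measurable_funTS; exact/measurable_EFinP. Qed.

Lemma measurable_dcube q : measurable (dcube q : set Rn).
Proof. exact: measurable_dyadic_cube. Qed.

Lemma lebRn_dcube q : leb (dcube q) = ((2 ^ q.1) ^+ n)%:E.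
Proof. exact: lebRn_dyadic_cube. Qed.

Lemma measurable_superlevel a : measurable (superlevel a : set Rn).
Proof.
rewrite (_ : superlevel a = w @^-1` `]a, +oo[%classic).
  by rewrite -[X in measurable X]setTI; exact: mw.
by apply/seteqP; split=> x /=; rewrite in_itv/= andbT.
Qed.

Lemma measurable_Omega c : measurable (Omega c : set Rn).
Proof. by apply: measurable_bigcup_family => q _; exact: measurable_dcube. Qed.

Lemma mass_split (a : R) q : 0 < a -> (mass q <=
  a%:E * leb (dcube q) + \int[leb]_(x in dcube q `&` superlevel a) (w x)%:E)%E.
Proof.
move=> a0; have mq := measurable_dcube q; have ms := measurable_superlevel a.
rewrite /mass -{1}(setUIDK (dcube q) (superlevel a)) (ge0_integral_setU leb
  (measurableI _ _ mq ms) (measurableD mq ms))//; last 2 first.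
- by move=> x _; rewrite lee_fin.
- by apply/disj_setPS => x [[_ ?] []].
rewrite addeC; apply: leeD => //.
apply: (@le_trans _ _ (\int[leb]_(x in dcube q `\` superlevel a) a%:E)%E).
  apply: ge0_le_integral => //.
  - exact: measurableD.
  - by move=> x _; rewrite lee_fin.
  - by move=> x [_ /negP]; rewrite lee_fin -leNgt.
rewrite integral_cst//; last exact: measurableD.
apply: lee_wpmul2l; first by rewrite lee_fin ltW.
by apply: le_lebRn => x [].
Qed.

Lemma dcube_eq q x : dcube q x -> q = (q.1, dyadic_index q.1 x).
Proof. by case: q => k z /= xz; rewrite (xz : dyadic_index k x = z). Qed.

Lemma selected_trivIset c : trivIset (selected c) dcube.
Proof.
move=> q q' [hq sq] [hq' sq'] [x [qx q'x]].
have [qq'|qq'|qq'] := ltgtP q.1 q'.1.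
- by exfalso; apply: (sq x _ qx qq'); rewrite -(dcube_eq q'x).
- by exfalso; apply: (sq' x _ q'x qq'); rewrite -(dcube_eq qx).
- by rewrite (dcube_eq qx) (dcube_eq q'x) qq'.
Qed.

(** Values of [w] up to [c / 2] contribute at most [c / 2] to the mean; the others have a finite
    integral [t], spread over volumes that tend to infinity with the level because [0 < n]. *)
Lemma large_not_heavy c : 0 < c ->
  exists M : nat, forall m z, M%:Z <= m -> ~ heavy c (m, z).
Proof.
move=> c0; have c20 : 0 < c / 2 by rewrite divr_gt0.
set t := (\int[leb]_(x in superlevel (c / 2)) (w x)%:E)%E.
have tf : t \is a fin_num.
  by rewrite ge0_fin_numE ?w_tail//; apply: integral_ge0 => x _; rewrite lee_fin.
(* At level m >= M the volume is at least 2^m >= m >= M, and M exceeds t/(c/2). *)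
exists (Num.truncn (fine t / (c / 2))).+1 => m z Mm.
apply/negP; rewrite -leNgt; apply: le_trans (mass_split _ c20) _.
have -> : (c%:E = (c / 2)%:E + (c / 2)%:E)%E by rewrite -EFinD -splitr.
rewrite ge0_muleDl ?lee_fin ?(ltW c20)//; apply: leeD => //.
apply: (@le_trans _ _ t).
  apply: ge0_subset_integral => //.
  - by apply: measurableI; [exact: measurable_dcube|exact: measurable_superlevel].
  - exact: measurable_superlevel.
  - by move=> x _; rewrite lee_fin.
rewrite -(fineK tf) lebRn_dcube -EFinM lee_fin mulrC -ler_pdivrMr//.
apply: le_trans (ltW (truncnS_gt _)) _.
set M := (Num.truncn _).+1 in Mm *; case: m Mm => // m; rewrite lez_nat => Mm.
rewrite -exprnP -exprM -natrX ler_nat; apply: leq_trans Mm _.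
apply: leq_trans (ltnW (ltn_expl m (ltnSn 1))) _.
by rewrite leq_exp2l// leq_pmulr.
Qed.

(** The levels of heavy cubes through [x] are bounded above, so there is a largest one. *)
Lemma heavy_selected c x m : 0 < c -> heavy c (m, dyadic_index m x) ->
  exists m', m <= m' /\ selected c (m', dyadic_index m' x).
Proof.
move=> c0 hm; have [M HM] := large_not_heavy c0.
pose P := fun k : nat => `[< heavy c (m + k%:Z, dyadic_index (m + k%:Z) x) >].
have exP : exists k, P k by exists 0%N; apply/asboolP; rewrite addr0.
have Pb k : P k -> (k <= `|M%:Z - m|)%N.
  move=> /asboolP Pk; rewrite leqNgt; apply/negP => kM.
  apply: HM Pk; lia.
have [k /asboolP Pk kmax] := ex_maxnP exP Pb.
exists (m + k%:Z); split; first by rewrite lerDl.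
split=> // y m' yk /= km' hy.
have ym' : dyadic_index m' y = dyadic_index m' x.
  by apply: dyadic_index_le (ltW km') yk.
rewrite ym' in hy.
have m'E : m' = m + `|m' - m|%N%:Z by lia.
have : P `|m' - m|%N by apply/asboolP; rewrite -m'E.
by move=> /kmax; lia.
Qed.

Lemma notin_Omega c x m : 0 < c -> ~ Omega c x ->
  (mass (m, dyadic_index m x) <= c%:E * leb (dcube (m, dyadic_index m x)))%E.
Proof.
move=> c0 xO; rewrite leNgt; apply/negP => /(heavy_selected c0)[m' [_ sm']].
by apply: xO; exists (m', dyadic_index m' x).
Qed.

(** By maximality the dyadic parent is not heavy, and its volume is [2 ^+ n] times larger. *)
Lemma selected_mass_le c q : 0 < c -> selected c q ->
  (mass q <= (c * 2 ^+ n * (2 ^ q.1) ^+ n)%:E)%E.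
Proof.
move=> c0 [_ sq].
pose x := dyadic_corner R q.1 q.2.
have qx : dcube q x := dyadic_corner_in R q.1 q.2.
have /(_ _) /negP := sq x (q.1 + 1) qx _; rewrite ltrDl => /(_ isT); rewrite -leNgt.
move=> H; apply: (@le_trans _ _ (mass (q.1 + 1, dyadic_index (q.1 + 1) x))).
  apply: ge0_subset_integral => //.
  - exact: measurable_dcube.
  - exact: measurable_dcube.
  - by move=> y _; rewrite lee_fin.
  - by apply: dyadic_cube_subset => //; rewrite lerDl.
apply: le_trans H _; rewrite lebRn_dcube -EFinM lee_fin /=.
by rewrite expfzDr// expr1z exprMn mulrA mulrAC.
Qed.

Lemma selected_nested c c' q' x : 0 < c -> c <= c' -> selected c' q' -> dcube q' x ->
  exists q, [/\ selected c q, dcube q x & dcube q' `<=` dcube q].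
Proof.
move=> c0 cc' [hq' _] q'x.
have hq : heavy c (q'.1, dyadic_index q'.1 x).
  rewrite -(dcube_eq q'x); apply: le_lt_trans hq'.
  by apply: lee_wpmul2r; [exact: lebRn_ge0|rewrite lee_fin].
have [m' [mm' sm']] := heavy_selected c0 hq.
exists (m', dyadic_index m' x); split=> //.
exact: dyadic_cube_subset.
Qed.

Lemma le_Omega c c' : 0 < c -> c <= c' -> Omega c' `<=` Omega c.
Proof.
move=> c0 cc' x [q' sq' q'x].
by have [q [sq qx _]] := selected_nested c0 cc' sq' q'x; exists q.
Qed.

(* The weak type inequality, with only the part of [w] above [c / 2] on the
   right-hand side. *)
Lemma lebRn_Omega_tail c : 0 < c ->
  (leb (Omega c) <= (2 / c)%:E * \int[leb]_(x in superlevel (c / 2)) (w x)%:E)%E.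
Proof.
move=> c0; have c20 : 0 < c / 2 by rewrite divr_gt0.
apply: (@measure_family_le _ _ Rn R leb dcube (selected c) (EFin \o w)).
- exact: measurable_superlevel.
- by rewrite divr_ge0// ltW.
- by move=> q _; exact: measurable_dcube.
- exact: selected_trivIset.
- exact: mEw.
- by move=> x; rewrite lee_fin.
move=> q [hq _].
change (leb (dcube q) <= (2 / c)%:E *
  \int[leb]_(x in dcube q `&` superlevel (c / 2)) (w x)%:E)%E.
have := lt_le_trans hq (mass_split q c20); set J := (\int[_]_(x in _) _)%E.
rewrite lebRn_dcube; set v := (2 ^ q.1) ^+ n => H.
have J0 : (0 <= J)%E by apply: integral_ge0 => x _; rewrite lee_fin.
case: J H J0 => [J| |]//; last by move=> _ _; rewrite gt0_muley ?leey// lte_fin divr_gt0.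
rewrite -!EFinM -EFinD lte_fin => H _; rewrite lee_fin mulrAC.
rewrite ler_pdivlMr// mulrC; lra.
Qed.

Lemma lebRn_Omega_le c : 0 < c -> (leb (Omega c) <=
  \sum_(m <oo) (2 ^+ m.+1)%:E * leb (superlevel (2 ^+ m * (c / 2))%R))%E.
Proof.
move=> c0; have c20 : 0 < c / 2 by rewrite divr_gt0.
apply: le_trans (lebRn_Omega_tail c0) _.
have := @integral_tail_le _ Rn R leb (EFin \o w) _ (@mEw setT) _ c20.
rewrite (_ : [set x : Rn | ((c / 2)%:E < (EFin \o w) x)%E] = superlevel (c / 2)); last first.
  by apply/seteqP; split=> x /=; rewrite lte_fin.
move=> H; apply: le_trans (lee_wpmul2l _ (H _)) _.
- by rewrite lee_fin divr_ge0// ltW.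
- by move=> x; rewrite lee_fin.
rewrite -nneseriesZl; last first.
  by move=> m _; rewrite mule_ge0 ?lebRn_ge0// lee_fin mulr_ge0// ltW.
apply: lee_nneseries => [m _ _|m _].
  by rewrite !mule_ge0 ?lebRn_ge0// lee_fin ?divr_ge0 ?mulr_ge0// ltW.
rewrite muleA -EFinM.
have -> : 2 / c * (2 ^+ m.+1 * (c / 2)) = 2 ^+ m.+1.
  by set X := 2 ^+ m.+1; field; rewrite gt_eqF.
by rewrite (_ : [set x : Rn | _] = superlevel (2 ^+ m * (c / 2)))//.
Qed.

Lemma superlevel_minus_Omega_null c : 0 < c -> leb (superlevel c `\` Omega c) = 0%E.
Proof.
move=> c0; apply: (@dyadic_density _ _ w mw w0 _ c) => //.
- by apply: measurableD; [exact: measurable_superlevel|exact: measurable_Omega].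
- by move=> x [].
- by move=> x m [_ xO]; exact: notin_Omega.
Qed.

(** Almost every point thus lies outside some [Omega], which gives the telescoping sum there a
    highest level. The tail integrals are bounded by the one at height 1/2, so the measures decay
    like [2 ^- k]. *)
Lemma Omega_cap_null : leb (\bigcap_(k : nat) Omega (2 ^+ k)) = 0%E.
Proof.
apply/eqP; rewrite eq_le lebRn_ge0 andbT; apply/lee_addgt0Pr => e e0; rewrite add0e.
have h0 : 0 < 2^-1 :> R by rewrite invr_gt0.
set t := (\int[leb]_(x in superlevel 2^-1) (w x)%:E)%E.
have t0 : (0 <= t)%E by apply: integral_ge0 => x _; rewrite lee_fin.
have tf : t \is a fin_num by rewrite ge0_fin_numE// w_tail.
pose k := (Num.truncn (2 * fine t / e)).+1.
apply: (@le_trans _ _ (leb (Omega (2 ^+ k)))).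
  by apply: le_lebRn => x /(_ k I).
have k0 : 0 < 2 ^+ k :> R by rewrite exprn_gt0.
apply: le_trans (lebRn_Omega_tail k0) _.
apply: (@le_trans _ _ ((2 / 2 ^+ k)%:E * t)%E).
  apply: lee_wpmul2l; first by rewrite lee_fin divr_ge0// ltW.
  apply: ge0_subset_integral => //.
  - exact: measurable_superlevel.
  - exact: measurable_superlevel.
  - by move=> x _; rewrite lee_fin.
  - move=> x; apply: le_lt_trans; rewrite -[leLHS]mul1r ler_wpM2r ?invr_ge0//.
    by rewrite exprn_ege1// ler1n.
rewrite -(fineK tf) -EFinM lee_fin mulrAC ler_pdivrMr// -ler_pdivrMl// mulrC.
apply: le_trans (ltW (truncnS_gt _)) _.
by rewrite -/k -natrX ler_nat ltnW// ltn_expl.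
Qed.

End stopping_cubes.

(** * The decomposition of a real function *)

Section reindexed_series.
Context (R : realType) (u v : nat -> R) (A : set nat) (iota : nat -> nat).
Hypothesis u_out : forall j, ~ A j -> u j = 0.
Hypothesis u_in : forall j, A j -> u j = v (iota j).
Hypothesis iota_inj : forall j j', A j -> A j' -> iota j = iota j' -> j = j'.

(** At a fixed point [u] lists the terms in the order of their encoding and [v] lists them by level;
    [hit N i] tells whether level [i] occurs among the first [N] terms. *)
Let hit (N i : nat) : bool := `[< exists j, [/\ (j < N)%N, A j & iota j = i] >].

Let partial_sumE N : exists M0, forall M, (M0 <= M)%N ->
  \sum_(0 <= j < N) u j = \sum_(0 <= i < M) v i * (hit N i)%:R.
Proof.
elim: N => [|N [M0 IH]].
  exists 0%N => M _; rewrite big_nil big1// => i _.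
  by rewrite /hit asboolF ?mulr0// => -[j []].
have [AN|nAN] := pselect (A N); last first.
  exists M0 => M MM; rewrite big_nat_recr//= u_out// addr0 (IH M)//.
  apply: eq_bigr => i _; congr (_ * (nat_of_bool _)%:R).
  apply: asbool_equiv_eq; split=> -[j [jN Aj ji]]; exists j; split=> //.
    exact: ltnW.
  move: jN; rewrite ltnS leq_eqVlt => /orP[/eqP jN|//].
  by rewrite -jN in nAN.
exists (maxn M0 (iota N).+1) => M; rewrite geq_max => /andP[MM iM].
rewrite big_nat_recr//= u_in// (IH M)//.
have -> : v (iota N) = \sum_(0 <= i < M) v i * (i == iota N)%:R.
  rewrite big_mkord (bigD1 (Ordinal iM))//= eqxx mulr1 big1 ?addr0// => i ne.
  by rewrite (_ : (_ == _) = false) ?mulr0//; apply/negbTE.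
rewrite -big_split/=; apply: eq_bigr => i _; rewrite -mulrDr -natrD.
congr (_ * _%:R); rewrite /hit.
have [->|/eqP ne] := eqVneq i (iota N).
  rewrite [X in (nat_of_bool X + _)%N]asboolF ?[X in _ = nat_of_bool X]asboolT//; first by exists N.
  move=> [j [jN Aj ji]]; have jE := iota_inj Aj AN ji.
  by rewrite jE ltnn in jN.
rewrite addn0; congr nat_of_bool; apply: asbool_equiv_eq.
split=> -[j [jN Aj ji]]; exists j; split=> //; first exact: ltnW.
move: jN; rewrite ltnS leq_eqVlt => /orP[/eqP jN|//].
by exfalso; apply: ne; rewrite -ji jN.
Qed.

Lemma reindexed_partial_sum_le (c b : R) N : 0 <= c -> 0 <= b < 1 ->
  (forall i, 0 <= v i <= c * b ^+ i) -> \sum_(0 <= j < N) u j <= c / (1 - b).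
Proof.
move=> c0 b01 vb; have [M /(_ M (leqnn M)) ->] := partial_sumE N.
apply: (@le_trans _ _ (\sum_(0 <= i < M) c * b ^+ i)).
  apply: ler_sum => i _; have /andP[v0 vc] := vb i.
  by case: hit; rewrite ?mulr1// mulr0 (le_trans v0).
by rewrite -mulr_sumr ler_wpM2l// geometric_sum_le.
Qed.

Let geometric_tail_le (b : R) L M : 0 <= b < 1 ->
  \sum_(0 <= i < M) b ^+ i * (L <= i)%N%:R <= b ^+ L / (1 - b).
Proof.
move=> /andP[b0 b1]; have b1' : 0 < 1 - b by rewrite subr_gt0.
have pos : 0 <= b ^+ L / (1 - b) by rewrite divr_ge0 ?exprn_ge0// ltW.
have [ML|LM] := leqP M L.
  rewrite big_nat big1// => i /andP[_ iM].
  by rewrite leqNgt (leq_trans iM ML) mulr0.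
rewrite (big_cat_nat (n := L))//=; last exact: ltnW.
rewrite big_nat big1 ?add0r; last by move=> i /andP[_ iL]; rewrite leqNgt iL mulr0.
rewrite -{1}[L]add0n big_addn.
under eq_bigr do rewrite leq_addl mulr1 exprD mulrC.
rewrite -mulr_sumr ler_wpM2l ?exprn_ge0//.
by apply: geometric_sum_le; rewrite b0.
Qed.

(** Once every nonzero [v i] with [i < L] has been hit, the two orders of summation differ only in
    terms of index at least [L], hence by at most a geometric tail. *)
Lemma reindexed_series_cvg (c b s : R) : 0 <= c -> 0 <= b < 1 ->
  (forall i, v i != 0 -> exists2 j, A j & iota j = i) ->
  (forall i, `|v i| <= c * b ^+ i) ->
  (fun L => \sum_(0 <= i < L) v i) @ \oo --> s ->
  (fun N => \sum_(0 <= j < N) u j) @ \oo --> s.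
Proof.
move=> c0 b01 v_hit vb vs; have /andP[b0 b1] := b01.
apply/cvgrPdist_le => e e0.
have e20 : 0 < e / 2 by rewrite divr_gt0.
have [L tailL] : exists L, c * (b ^+ L / (1 - b)) <= e / 2.
  have cb : (fun L => c / (1 - b) * b ^+ L) @ \oo --> c / (1 - b) * 0.
    apply: cvgMr; apply: cvg_expr; by rewrite ger0_norm.
  rewrite mulr0 in cb.
  move/cvgrPdist_le : cb => /(_ _ e20)[L _ /(_ L (leqnn L))/=].
  rewrite sub0r normrN => /(le_trans (ler_norm _)) H; exists L.
  by apply: le_trans H; rewrite mulrA mulrAC.
have [N0 HN0] : exists N0, forall N, (N0 <= N)%N -> forall i, (i < L)%N ->
    v i != 0 -> hit N i.
  elim: L {tailL} => [|L [N0 HN0]]; first by exists 0%N.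
  have [vL|/v_hit[j Aj jL]] := eqVneq (v L) 0.
    exists N0 => N NN i; rewrite ltnS leq_eqVlt => /orP[/eqP ->|iL]; first by rewrite vL eqxx.
    exact: HN0.
  exists (maxn N0 j.+1) => N; rewrite geq_max => /andP[NN jN] i.
  rewrite ltnS leq_eqVlt => /orP[/eqP -> _|iL]; last exact: HN0.
  by apply/asboolP; exists j.
near=> N.
have [M0 HM0] := partial_sumE N.
have [M1 _ HM1] := (@cvgrPdist_le _ _ _ _ _ _ _).1 vs _ e20.
pose M := maxn M0 M1.
have MM0 : (M0 <= M)%N by exact: leq_maxl.
have /= sM := HM1 M (leq_maxr _ _).
rewrite (HM0 M)//.
apply: (@le_trans _ _ (`|s - \sum_(0 <= i < M) v i| +
    `|\sum_(0 <= i < M) v i - \sum_(0 <= i < M) v i * (hit N i)%:R|)).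
  exact: ler_distD.
rewrite [e]splitr; apply: lerD => //.
apply: le_trans tailL; rewrite -sumrB.
apply: le_trans (ler_norm_sum _ _ _) _.
apply: (@le_trans _ _ (c * \sum_(0 <= i < M) b ^+ i * (L <= i)%N%:R)); last first.
  by rewrite ler_wpM2l// geometric_tail_le.
rewrite mulr_sumr; apply: ler_sum => i _.
have [Li|iL] := leqP L i.
  rewrite mulr1; apply: le_trans (vb i).
  by case: hit; rewrite ?mulr1 ?subrr ?normr0// mulr0 subr0.
rewrite !mulr0; have [->|vi] := eqVneq (v i) 0; first by rewrite mul0r subrr normr0.
rewrite HN0 ?mulr1 ?subrr ?normr0//.
by near: N; exists N0.
Unshelve. all: by end_near. Qed.

End reindexed_series.

(** * Functions glued from disjoint pieces *)

Section piecewise.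
Context (I : countType) (T : Type) (R : realType).
Variables (F : I -> set T) (P : set I) (g : I -> T -> R).

Definition piecewise (x : T) : R :=
  if pselect (exists z, P z /\ F z x) is left h then g (projT1 (cid h)) x else 0.

Lemma piecewiseE z x : trivIset P F -> P z -> F z x -> piecewise x = g z x.
Proof.
move=> tF Pz Fz; rewrite /piecewise; case: pselect => [h|]; last by case; exists z.
by case: cid => z' [Pz' Fz'] /=; congr g; apply: tF => //; exists x.
Qed.

Lemma piecewise_out x : ~ (\bigcup_(z in P) F z) x -> piecewise x = 0.
Proof. by move=> nx; rewrite /piecewise; case: pselect => // -[z [Pz Fz]]; case: nx; exists z. Qed.

End piecewise.

Section measurable_piecewise.
Context (I : countType) d (T : measurableType d) (R : realType).
Variable mu : {measure set T -> \bar R}.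
Variables (F : I -> set T) (P : set I) (g : I -> T -> R).
Hypothesis mF : forall z, P z -> measurable (F z).
Hypothesis tF : trivIset P F.

Lemma measurable_piecewise : (forall z, P z -> measurable_fun setT (g z)) ->
  measurable_fun setT (piecewise F P g).
Proof.
move=> mg _ Y mY; rewrite setTI.
have -> : piecewise F P g @^-1` Y = (\bigcup_(z in P) (F z `&` g z @^-1` Y)) `|`
    (~` (\bigcup_(z in P) F z) `&` [set _ | Y 0]).
  apply/seteqP; split=> [x /= Yx|x [[z Pz [Fz Yg]]|[nx Y0]]] /=.
  - have [[z Pz Fz]|nx] := pselect ((\bigcup_(z in P) F z) x).
      by left; exists z => //; split=> //; rewrite /= -(piecewiseE g tF Pz Fz).
    by right; split => //; rewrite -(piecewise_out g nx).
  - by rewrite (piecewiseE g tF Pz Fz).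
  - by rewrite (piecewise_out g nx).
apply: measurableU.
  apply: measurable_bigcup_family => z Pz; apply: measurableI; first exact: mF.
  by rewrite -[X in measurable X]setTI; exact: mg.
apply: measurableI; first by apply: measurableC; exact: measurable_bigcup_family.
have [Y0|nY0] := pselect (Y 0).
  by rewrite (_ : mkset _ = setT)//; apply/seteqP; split.
by rewrite (_ : mkset _ = set0)//; apply/seteqP; split.
Qed.

Lemma Rintegral_family0 (D : set T) (u : T -> R) :
  measurable D -> mu.-integrable D (EFin \o u) ->
  \bigcup_(z in P) F z `<=` D ->
  (forall x, D x -> ~ (\bigcup_(z in P) F z) x -> u x = 0) ->
  (forall z, P z -> \int[mu]_(x in F z) u x = 0)%R ->
  (\int[mu]_(x in D) u x = 0)%R.
Proof.
move=> mD ui UD u0 uF0.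
set U := \bigcup_(z in P) F z in UD u0.
have mU : measurable U by exact: measurable_bigcup_family.
have E : (\int[mu]_(x in D) (u x)%:E = \int[mu]_(x in U) (u x)%:E)%E.
  rewrite -[in RHS](setIidr UD) integral_mkcondr; apply: eq_integral => x.
  rewrite inE patchE => Dx; case: ifPn => //; rewrite notin_setE => nUx.
  by rewrite u0.
rewrite /Rintegral E /U -family_seq_bigcup integral_bigcup.
- rewrite eseries0// => i _ _; apply: (family_seq_ind
    (Q := fun A => \int[mu]_(x in A) (u x)%:E = 0)%E); first exact: integral_set0.
  move=> z Pz; rewrite -[LHS]fineK; first by congr EFin; exact: uF0.
  apply: integrable_fin_num; first exact: mF.
  apply: integrableS ui => //; first exact: mF.
  by apply: subset_trans UD => x Fx; exists z.
- exact: family_seq_trivIset.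
- by move=> i; apply: (family_seq_ind (Q := fun A : set T => measurable A)).
- by rewrite family_seq_bigcup; apply: integrableS ui.
Qed.

End measurable_piecewise.

Lemma monomial_bounded (R : realType) n m (z : {ffun 'I_n -> int})
    (be : {ffun 'I_n -> nat}) :
  exists M : R, forall x, dyadic_cube m z x -> `|monomial be x| <= M.
Proof.
exists (\prod_(j < n) (`|dyadic_corner R m z 0 j| + 2 ^ m) ^+ be j) => x.
rewrite dyadic_cube_box => Dx; rewrite /monomial normr_prod.
apply: ler_prod => j _; rewrite normr_ge0/= normrX lerXn2r ?nnegrE ?addr_ge0 ?(ltW (side_gt0 _ _))//.
have := Dx j; rewrite /= in_itv/= => /andP[h1 h2].
have s0 := side_gt0 R m.
rewrite ler_norml; apply/andP; split.
  apply: le_trans h1; rewrite opprD lerBlDr ler_wpDr ?(ltW s0)//.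
  by rewrite lerNl ler_normr lexx orbT.
by apply: le_trans (ltW h2) _; rewrite lerD2r ler_norm.
Qed.

Lemma measurable_monomial (R : realType) n (be : {ffun 'I_n -> nat}) :
  measurable_fun (setT : set (LebRn R n)) (monomial be).
Proof.
apply: measurable_fun_LebRn.
apply: (measurable_prod_coord (g := fun j t => t ^+ be j)) => j.
exact: measurable_funX.
Qed.

(** * Calderon-Zygmund decomposition at all dyadic heights *)

Section calderon_zygmund.
Context (R : realType) (n : nat) (n0 : (0 < n)%N) (K : nat).
Local Notation leb := (@lebRn R n).
Local Notation Rn := (LebRn R n).
Local Notation cube := (int * {ffun 'I_n -> int})%type.
Local Notation dcube := (@dcube R n).
Variable w : 'rV[R]_n -> R.
Hypothesis mw : measurable_fun (setT : set Rn) w.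
Hypothesis w0 : forall x, 0 <= w x.
Hypothesis w_tail : forall a : R, 0 < a ->
  (\int[leb]_(x in superlevel w a) (w x)%:E < +oo)%E.
Variable C : R.
Hypothesis C0 : 0 < C.
Hypothesis HC : forall m (z : {ffun 'I_n -> int}) (f : 'rV[R]_n -> R),
    leb.-integrable (dyadic_cube m z) (EFin \o f) ->
    exists h : 'rV[R]_n -> R,
    [/\ measurable_fun (setT : set (LebRn R n)) h,
      leb.-integrable (dyadic_cube m z) (EFin \o h),
      forall x, `|h x| <= C *
        (\int[leb]_(y in dyadic_cube m z) `|f y| / (2 ^ m) ^+ n) *
        \1_(dyadic_cube m z) x &
      forall be : {ffun 'I_n -> nat}, (forall j, be j <= K)%N ->
        \int[leb]_(x in dyadic_cube m z) ((f x - h x) * monomial be x) = 0].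
Variable f : 'rV[R]_n -> R.
Hypothesis mf : measurable_fun (setT : set Rn) f.
Hypothesis fw : forall x, `|f x| <= w x.
Hypothesis f_Omega : forall (k : int) x, ~ Omega w (2 ^ k) x -> `|f x| <= 2 ^ k.
Implicit Types (q : cube) (x : 'rV[R]_n) (k : int).

Let pow0 k : 0 < 2 ^ k :> R. Proof. exact: exprz_gt0. Qed.

Lemma mass_fin q : mass w q \is a fin_num.
Proof.
rewrite ge0_fin_numE; last by apply: integral_ge0 => x _; rewrite lee_fin.
apply: le_lt_trans (mass_split mw w0 _ ltr01) _.
rewrite lebRn_dcube -EFinM; apply: lte_add_pinfty; first exact: ltry.
apply: le_lt_trans (w_tail ltr01).
apply: ge0_subset_integral.
- by apply: measurableI; [exact: measurable_dcube|exact: measurable_superlevel].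
- exact: measurable_superlevel.
- by apply: measurable_funTS; exact/measurable_EFinP.
- by move=> x _; rewrite lee_fin.
- by move=> x [].
Qed.

Lemma integrable_dcube q : leb.-integrable (dcube q) (EFin \o f).
Proof.
apply: (@le_integrable _ Rn R leb _ (@measurable_dcube R n q) _ (EFin \o w)).
- by apply: measurable_funTS; exact/measurable_EFinP.
- by move=> x _ /=; rewrite lee_fin (ger0_norm (w0 x)).
apply/integrableP; split; first by apply: measurable_funTS; exact/measurable_EFinP.
under eq_integral do rewrite /= ger0_norm//.
by rewrite -ge0_fin_numE ?mass_fin//; apply: integral_ge0 => x _; rewrite lee_fin.
Qed.

Definition cube_projection q : 'rV[R]_n -> R :=
  projT1 (cid (HC (integrable_dcube q))).

(** The good part is [f - bad k], so the difference of consecutive good parts is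
    [bad k - bad (k + 1)]. Unlike the good parts, the bad ones vanish off [Omega] and have vanishing
    moments on the selected cubes. *)
Definition bad k : 'rV[R]_n -> R :=
  piecewise dcube (selected w (2 ^ k)) (fun q x => f x - cube_projection q x).

Lemma measurable_cube_projection q : measurable_fun (setT : set Rn) (cube_projection q).
Proof. by rewrite /cube_projection; case: cid => h []. Qed.

Lemma cube_projection_moment q (be : {ffun 'I_n -> nat}) : (forall j, be j <= K)%N ->
  \int[leb]_(x in dcube q) ((f x - cube_projection q x) * monomial be x) = 0.
Proof. by rewrite /cube_projection; case: cid => h [_ _ _] /= H; exact: H. Qed.

Lemma cube_projection_le q k x : selected w (2 ^ k) q ->
  `|cube_projection q x| <= C * 2 ^+ n * 2 ^ k.
Proof.
move=> sq; rewrite /cube_projection; case: cid => h /= [_ _ H _].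
apply: le_trans (H x) _.
have side0 : 0 < (2 ^ q.1) ^+ n :> R by rewrite exprn_gt0.
have avg : \int[leb]_(y in dcube q) `|f y| / (2 ^ q.1) ^+ n <= 2 ^+ n * 2 ^ k.
  rewrite ler_pdivrMr//.
  have := selected_mass_le mw w0 (pow0 k) sq; rewrite -(fineK (mass_fin q)) lee_fin.
  rewrite [2 ^ k * _]mulrC; apply: le_trans.
  apply: le_Rintegral => //.
  - exact: measurable_dcube.
  - exact: (integrable_norm (integrable_dcube q)).
  - apply/integrableP; split; first by apply: measurable_funTS; exact/measurable_EFinP.
    under eq_integral do rewrite /= ger0_norm//.
    by rewrite -ge0_fin_numE ?mass_fin//; apply: integral_ge0 => y _; rewrite lee_fin.
have avg0 : 0 <= \int[leb]_(y in dcube q) `|f y| / (2 ^ q.1) ^+ n.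
  by rewrite divr_ge0 ?(ltW side0)//; apply: Rintegral_ge0 => y _; exact: normr_ge0.
rewrite -[leRHS]mulr1; apply: ler_pM => //.
- by rewrite mulr_ge0// ltW.
- by rewrite -mulrA ler_wpM2l// ltW.
Qed.

(** [C * 2 ^+ n] serves on the selected cubes; the summand 1 serves off [Omega], where |f| is at
    most [2 ^ k]. *)
Definition good_bound : R := C * 2 ^+ n + 1.

Lemma good_bound_gt0 : 0 < good_bound.
Proof. by rewrite ltr_wpDl// mulr_ge0 ?exprn_ge0// ltW. Qed.

Lemma good_le k x : `|f x - bad k x| <= good_bound * 2 ^ k.
Proof.
have [[q sq qx]|nx] := pselect (Omega w (2 ^ k) x).
  rewrite /bad (piecewiseE _ (@selected_trivIset _ _ _ _) sq qx) subKr.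
  apply: le_trans (cube_projection_le _ sq) _.
  by rewrite ler_wpM2r ?(ltW (pow0 k))// lerDl.
rewrite /bad piecewise_out// subr0; apply: le_trans (f_Omega nx) _.
by rewrite ler_peMl ?(ltW (pow0 k))// lerDr mulr_ge0 ?exprn_ge0// ltW.
Qed.

Lemma measurable_bad k : measurable_fun (setT : set Rn) (bad k).
Proof.
apply: (@measurable_piecewise _ _ Rn).
- by move=> q _; exact: measurable_dcube.
- exact: selected_trivIset.
- by move=> q _; apply: measurable_funB; [exact: mf|exact: measurable_cube_projection].
Qed.

(** On a cube [bad k] differs from the integrable [f] by a bounded function, and the monomial is
    bounded. *)
Lemma bad_integrable k q (be : {ffun 'I_n -> nat}) :
  leb.-integrable (dcube q) (EFin \o (fun x => bad k x * monomial be x)).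
Proof.
have [M HM] := monomial_bounded R q.1 q.2 be.
apply: (@integrable_mul_bounded _ _ _ _ _ (@measurable_dcube R n q) _ _ M) => //; last first.
  by apply: measurable_funTS; exact: measurable_monomial.
have gi : leb.-integrable (dcube q) (EFin \o (fun x => f x - bad k x)).
  apply: measurable_bounded_integrable.
  - exact: measurable_dcube.
  - by rewrite -[X in (X < _)%E]/(@lebRn R n (dcube q)) lebRn_dcube ltry.
  - apply: measurable_funTS; apply: measurable_funB; [exact: mf|exact: measurable_bad].
  - exists (good_bound * 2 ^ k); split; first exact: num_real.
    by move=> y My x _ /=; rewrite (le_trans (good_le k x))// ltW.
have := integrableB (@measurable_dcube R n q) (integrable_dcube q) gi.
apply: eq_integrable; first exact: measurable_dcube.
by move=> x _ /=; rewrite -EFinB subKr.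
Qed.

(** By nesting, a cube selected at height [2 ^ k] that meets [q] lies inside [q], so [bad k]
    restricted to [q] splits into pieces with vanishing moments. This is what lets one atom combine
    [bad k] and [bad (k + 1)]. *)
Lemma bad_moment j k q (be : {ffun 'I_n -> nat}) : (forall i, be i <= K)%N ->
  j <= k -> selected w (2 ^ j) q ->
  \int[leb]_(x in dcube q) (bad k x * monomial be x) = 0.
Proof.
move=> beK jk sq.
pose P := [set q' | selected w (2 ^ k) q' /\ dcube q' `<=` dcube q] : set cube.
have pjk : 2 ^ j <= 2 ^ k :> R by rewrite ler_weXz2l// ler1n.
have tP : trivIset P dcube.
  by move=> q1 q2 [s1 _] [s2 _]; exact: selected_trivIset s1 s2.
apply: (@Rintegral_family0 _ _ Rn R leb dcube P) => //.
- by move=> q' _; exact: measurable_dcube.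
- exact: measurable_dcube.
- exact: bad_integrable.
- by move=> x [q' [_ sub] q'x]; exact: sub.
- move=> x qx nx; rewrite /bad piecewise_out ?mul0r// => -[q' sq' q'x].
  have [q1 [s1 q1x sub]] := selected_nested n0 mw w0 w_tail (pow0 j) pjk sq' q'x.
  have qq1 : q1 = q by apply: selected_trivIset s1 sq _; exists x.
  by apply: nx; exists q' => //; split=> //; rewrite -qq1.
- move=> q' [sq' _]; rewrite -[RHS](cube_projection_moment q' beK).
  apply: eq_Rintegral => x; rewrite inE => q'x.
  by rewrite /bad (piecewiseE _ (@selected_trivIset _ _ _ _) sq' q'x).
Qed.

(** The good parts of levels [k] and [k + 1] differ by at most [good_bound * (1 + 2) * 2 ^ k];
    doubling this keeps the atoms below 1/2. *)
Definition height k : R := 6 * good_bound * 2 ^ k.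

Lemma height_gt0 k : 0 < height k.
Proof. by rewrite !mulr_gt0// good_bound_gt0. Qed.

Definition atom k q x : R := (bad k x - bad (k + 1) x) / height k * \1_(dcube q) x.

Lemma bad_diff_le k x : `|bad k x - bad (k + 1) x| <= height k / 2.
Proof.
have -> : bad k x - bad (k + 1) x = (f x - bad (k + 1) x) - (f x - bad k x) by ring.
apply: le_trans (ler_normB _ _) _; apply: le_trans (lerD (good_le _ _) (good_le _ _)) _.
rewrite /height expfzDr// expr1z le_eqVlt; apply/orP; left; apply/eqP.
by set X := 2 ^ k; field.
Qed.

Lemma atom_le k q x : `|atom k q x| <= \1_(dcube q) x / 2.
Proof.
rewrite /atom normrM [X in _ * X]ger0_norm ?indicE// mulrC ler_wpM2l//.
rewrite normrM normfV (gtr0_norm (height_gt0 k)) ler_pdivrMr ?height_gt0//.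
by rewrite mulrC; exact: bad_diff_le.
Qed.

Lemma measurable_atom k q : measurable_fun (setT : set Rn) (atom k q).
Proof.
apply: measurable_funM; last by apply: measurable_indic; exact: measurable_dcube.
apply: measurable_funM; first by apply: measurable_funB; exact: measurable_bad.
exact: measurable_cst.
Qed.

Lemma atom_moment k q (be : {ffun 'I_n -> nat}) : (forall i, be i <= K)%N ->
  selected w (2 ^ k) q ->
  \int[leb]_x (monomial be x * atom k q x) = 0.
Proof.
move=> beK sq.
transitivity (\int[leb]_(x in dcube q)
   ((height k)^-1 * (bad k x * monomial be x - bad (k + 1) x * monomial be x))).
  rewrite [RHS]Rintegral_mkcond; apply: eq_Rintegral => x _.
  rewrite patchE /atom indicE; case: ifPn => _; last by rewrite !mulr0.
  by rewrite mulr1; ring.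
rewrite RintegralZl; last 2 first.
- exact: measurable_dcube.
- have := integrableB (@measurable_dcube R n q) (bad_integrable k q be) (bad_integrable (k + 1) q be).
  by apply: eq_integrable; [exact: measurable_dcube|move=> x _].
rewrite RintegralB ?(bad_moment beK _ sq) ?subrr ?mulr0// ?lerDl//.
- exact: measurable_dcube.
- exact: bad_integrable.
- exact: bad_integrable.
Qed.

(** Pairs are enumerated, not cubes: one cube may be selected at several heights and must then carry
    several atoms. *)
Definition active (j : nat) : option (int * cube) :=
  if pickle_inv j is Some (k, q) then
    if pselect (selected w (2 ^ k) q) then Some (k, q) else None
  else None.

Lemma active_selected j k q : active j = Some (k, q) -> selected w (2 ^ k) q.
Proof.
rewrite /active; case: pickle_inv => // -[k' q'].
by case: pselect => // sq [<- <-].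
Qed.

Lemma active_inj j j' kq : active j = Some kq -> active j' = Some kq -> j = j'.
Proof.
have H i kq' : active i = Some kq' -> pickle_inv i = Some kq'.
  rewrite /active; case: pickle_inv => // -[k q].
  by case: pselect.
move=> /H jk /H j'k.
have := @pickle_invK (int * cube)%type j; rewrite jk/= => <-.
by have := @pickle_invK (int * cube)%type j'; rewrite j'k.
Qed.

Lemma active_pickle k q : selected w (2 ^ k) q -> exists j, active j = Some (k, q).
Proof.
move=> sq; exists (pickle (k, q)); rewrite /active pickleK_inv.
by case: pselect.
Qed.

Definition closed_cube q : set 'rV[R]_n :=
  [set x | forall i, dyadic_corner R q.1 q.2 0 i <= x 0 i <=
     dyadic_corner R q.1 q.2 0 i + 2 ^ q.1].

(** Neither [lam] nor [cubes] refers to [f], so they can be shared by several functions. An inactive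
    index gets coefficient 0, the zero atom and, arbitrarily, the unit cube at the origin. *)
Definition lam j : R := if active j is Some (k, q) then height k else 0.

Definition cubes j : set 'rV[R]_n :=
  closed_cube (if active j is Some (k, q) then q else (0, [ffun=> 0])).

Definition atoms j x : R := if active j is Some (k, q) then atom k q x else 0.

Lemma dcube_closed q : dcube q `<=` closed_cube q.
Proof.
move=> x; rewrite /dcube dyadic_cube_box => Dx i; have := Dx i.
by rewrite /= in_itv/= => /andP[-> /ltW].
Qed.

Lemma closed_cube_box q : closed_cube q =
  rV_box (fun i => `[dyadic_corner R q.1 q.2 0 i, dyadic_corner R q.1 q.2 0 i + 2 ^ q.1]%classic).
Proof. by apply/seteqP; split=> x H i; have := H i; rewrite /= in_itv. Qed.

Lemma measurable_closed_cube q : measurable (closed_cube q : set Rn).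
Proof.
apply: measurable_LebRn; rewrite closed_cube_box; apply: measurable_rV_box => i.
exact: measurable_itv.
Qed.

Lemma closed_cube_boundary_null q : leb (closed_cube q `\` dcube q) = 0%E.
Proof.
have mq := @measurable_dcube R n q; have mc := measurable_closed_cube q.
have lc : leb (closed_cube q) = ((2 ^ q.1) ^+ n)%:E.
  rewrite closed_cube_box lebRn_box => [|i]; last exact: measurable_itv.
  under eq_bigr => i _.
    rewrite lebesgue_measure_itv/= lte_fin ltrDl side_gt0 -EFinB addrC addKr.
    over.
  by rewrite prodEFin prodr_const card_ord.
have cfin : (leb (closed_cube q) < +oo)%E by rewrite lc ltry.
have -> := measureD mc mq cfin.
rewrite setIidr; last exact: dcube_closed.
by rewrite [X in (X - _)%E]lc [X in (_ - X)%E]lebRn_dcube subee.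
Qed.

Definition cube_boundaries : set 'rV[R]_n :=
  \bigcup_(q in [set: cube]) (closed_cube q `\` dcube q).

Lemma cube_boundaries_null : leb cube_boundaries = 0%E.
Proof.
rewrite /cube_boundaries -family_seq_bigcup; apply: lebRn_bigcup_null => i.
apply: (family_seq_ind (Q := fun A => leb A = 0%E)); first exact: measure0.
by move=> q _; exact: closed_cube_boundary_null.
Qed.

Lemma lam_ge0 j : 0 <= lam j.
Proof. by rewrite /lam; case: active => // -[k q]; rewrite ltW// height_gt0. Qed.

Lemma cubes_is_cube j : is_cube (cubes j).
Proof.
suff H q : is_cube (closed_cube q) by exact: H.
by exists (dyadic_corner R q.1 q.2), (2 ^ q.1); split; first exact: pow0.
Qed.

Lemma measurable_cubes j : measurable (cubes j : set Rn).
Proof. exact: measurable_closed_cube. Qed.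

Lemma atoms_le j x : `|atoms j x| <= \1_(cubes j) x / 2.
Proof.
rewrite /atoms /cubes; case: active => [[k q]|]; last by rewrite normr0 divr_ge0.
apply: le_trans (atom_le _ _ _) _; rewrite ler_wpM2r//.
rewrite !indicE ler_nat; case: (boolP (x \in dcube q)) => //.
by rewrite inE => /dcube_closed /mem_set ->.
Qed.

Lemma measurable_atoms j : measurable_fun (setT : set Rn) (atoms j).
Proof.
rewrite /atoms; case: active => [[k q]|]; last exact: measurable_cst.
exact: measurable_atom.
Qed.

Lemma atoms_moment j (be : {ffun 'I_n -> nat}) : (forall i, be i <= K)%N ->
  \int[leb]_x (monomial be x * atoms j x) = 0.
Proof.
move=> beK; rewrite /atoms; case ej: (active j) => [[k q]|].
  by apply: atom_moment => //; exact: active_selected ej.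
by under eq_Rintegral do rewrite mulr0; rewrite Rintegral_cst// mul0r.
Qed.

Definition hitting x : set nat :=
  [set j | if active j is Some (k, q) then dcube q x else False].

(** Meant for points off [Omega w (2 ^ k)]: the levels met there are at most [k - 1], which has
    depth 0, and the depth counts downwards. *)
Definition depth (k : int) j : nat :=
  if active j is Some (k', q) then absz (k - 1 - k')%R else 0%N.

Lemma hitting_level k x j : ~ Omega w (2 ^ k) x -> hitting x j ->
  exists k' q, [/\ active j = Some (k', q), dcube q x & k' = k - 1 - (depth k j)%:Z].
Proof.
move=> nx; rewrite /hitting /depth /=; case ej: (active j) => [[k' q]|] // qx.
exists k', q; split=> //.
have kk' : k' < k.
  rewrite ltNge; apply/negP => kk'; apply: nx.
  apply: (le_Omega n0 mw w0 w_tail (pow0 k) (c' := 2 ^ k')).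
    by rewrite ler_weXz2l// ler1n.
  by exists q => //; exact: active_selected ej.
lia.
Qed.

Lemma depth_inj k x j j' : ~ Omega w (2 ^ k) x -> hitting x j -> hitting x j' ->
  depth k j = depth k j' -> j = j'.
Proof.
move=> nx /(hitting_level nx)[k1 [q1 [e1 x1 k1E]]] /(hitting_level nx)[k2 [q2 [e2 x2 k2E]]].
move=> d12; have k12 : k1 = k2 by rewrite k1E k2E d12.
rewrite -k12 in e2; apply: (active_inj e1).
have s1 := active_selected e1; have s2 := active_selected e2.
by have -> : q1 = q2 by apply: selected_trivIset s1 s2 _; exists x.
Qed.

Lemma bad_out k x : ~ Omega w (2 ^ k) x -> bad k x = 0.
Proof. by move=> nx; rewrite /bad piecewise_out. Qed.

(** In level order the series telescopes to [bad (k0 - L)], since [bad k0] vanishes at [x], and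
    [f - bad (k0 - L)] is O(2^(k0 - L)). *)
Lemma atoms_series k0 x : ~ Omega w (2 ^ k0) x ->
  (fun N => \sum_(0 <= j < N) lam j * atoms j x) @ \oo --> f x.
Proof.
move=> nx.
pose v (i : nat) := bad (k0 - 1 - i%:Z) x - bad (k0 - 1 - i%:Z + 1) x.
apply: (@reindexed_series_cvg _ _ v (hitting x) (depth k0) _ _ _
   (height (k0 - 1) / 2) 2^-1) => //.
- move=> j; rewrite /hitting /lam /atoms /=; case: active => [[k q]|]; last by rewrite mul0r.
  by move=> nqx; rewrite /atom indicE memNset// !mulr0.
- move=> j /(hitting_level nx)[k [q [ej qx kE]]].
  rewrite /lam /atoms ej /atom indicE mem_set// mulr1 mulrCA mulfV ?gt_eqF ?height_gt0//.
  by rewrite mulr1 /v -kE.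
- by move=> j j'; exact: depth_inj.
- by rewrite divr_ge0// ltW// height_gt0.
- lra.
(* A nonzero difference forces [x] into the [Omega] of its lower level, so an active cube of that
   level contains [x]. *)
- move=> i vi; pose k := k0 - 1 - i%:Z.
  have [[q sq qx]|nkx] := pselect (Omega w (2 ^ k) x); last first.
    move: vi; rewrite /v -/k !bad_out ?subrr ?eqxx// => kx; apply: nkx.
    apply: (le_Omega n0 mw w0 w_tail (pow0 k) _ kx).
    by rewrite ler_weXz2l ?ler1n// lerDl.
  have [j ej] := active_pickle sq; exists j; first by rewrite /hitting /= ej.
  rewrite /depth ej /k; lia.
- move=> i; apply: le_trans (bad_diff_le _ _) _.
  rewrite /height expfzDr// -invr_expz -exprnP -exprVn mulrA le_eqVlt; apply/orP; left; apply/eqP.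
  by rewrite mulrAC.
have -> : (fun L => \sum_(0 <= i < L) v i) = (fun L : nat => bad (k0 - L%:Z) x).
  apply/funext => L; elim: L => [|L IH].
    by rewrite big_nil subr0 bad_out.
  rewrite big_nat_recr//= IH /v.
  have -> : k0 - 1 - L%:Z + 1 = k0 - L%:Z by ring.
  have -> : k0 - 1 - L%:Z = k0 - L.+1%:Z by lia.
  by rewrite addrC subrK.
apply/cvgrPdist_le => e e0.
have cb : (fun L : nat => good_bound * 2 ^ k0 * 2^-1 ^+ L) @ \oo --> good_bound * 2 ^ k0 * 0.
  by apply: cvgMr; apply: cvg_expr; rewrite ger0_norm// invf_lt1// ltr1n.
rewrite mulr0 in cb; move/cvgrPdist_le : cb => /(_ _ e0).
apply: filterS => L; rewrite sub0r normrN => HL.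
apply: le_trans (good_le _ _) _; apply: le_trans HL.
rewrite ger0_norm; last by rewrite !mulr_ge0 ?exprn_ge0 ?(ltW (pow0 k0)) ?(ltW good_bound_gt0).
by rewrite expfzDr// -invr_expz -exprnP -exprVn mulrA.
Qed.

(** At most one half-open cube per level contains [x], and only levels below [k] occur, so the sum
    is dominated by a geometric one of ratio 2^(-v). A closed cube containing [x] outside its
    half-open part would put [x] in [cube_boundaries]. *)
Lemma lv_sum_le k x (v : R) : 0 < v -> ~ Omega w (2 ^ k) x ->
  ~ cube_boundaries x ->
  (lv_sum v lam cubes x <=
   (6 * good_bound * ((1 - 2 `^ (- v))^-1) `^ v^-1 * 2 ^ k)%:E)%E.
Proof.
move=> v0 nx nbx.
have b01 : (0 : R) <= 2 `^ (- v) < 1.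
  by rewrite powR_ge0/= -[ltRHS](powRr0 2); apply: ltr_powR2; rewrite oppr_lt0.
have b1 : (0 : R) < 1 - 2 `^ (- v) by rewrite subr_gt0; case/andP: b01.
have h0 k' : 0 <= height k' by rewrite ltW// height_gt0.
rewrite /lv_sum.
apply: (@le_trans _ _ (((height k `^ v) / (1 - 2 `^ (- v)))%:E `^ v^-1)%E).
  apply: gt0_ler_poweR; rewrite ?in_itv/= ?leey ?andbT ?invr_ge0 ?(ltW v0)//.
  - by apply: nneseries_ge0 => j _ _; rewrite lee_fin powR_ge0.
  - by rewrite lee_fin divr_ge0 ?powR_ge0// ltW.
  apply: nneseries_le_bound => [j|N]; first by rewrite lee_fin powR_ge0.
  rewrite sumEFin lee_fin.
  apply: (@reindexed_partial_sum_le _ _ (fun i => height (k - 1 - i%:Z) `^ v)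
    (hitting x) (depth k)) => //.
  - move=> j; rewrite /hitting /lam /cubes /=.
    case: active => [[k' q]|]; last by rewrite mul0r powR0 ?gt_eqF.
    move=> nqx; rewrite indicE memNset ?mulr0 ?powR0 ?gt_eqF// => cx.
    by apply: nbx; exists q.
  - move=> j /(hitting_level nx)[k' [q [ej qx kE]]].
    rewrite /lam /cubes ej indicE mem_set ?mulr1 -?kE//; exact: dcube_closed.
  - by move=> j j'; exact: depth_inj.
  - exact: powR_ge0.
  - move=> i; rewrite powR_ge0/=.
    have -> : (2 `^ (- v)) ^+ i = (2^-1 ^+ i) `^ v :> R.
      rewrite -mulN1r powRrM powR_inv1// -powR_mulrn ?powR_ge0// -powRrM.
      by rewrite mulrC powRrM powR_mulrn// invr_ge0.
    rewrite -powRM ?exprn_ge0//.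
    apply: ge0_ler_powR; rewrite ?nnegrE ?(ltW v0)//.
      by apply: mulr_ge0 => //; exact: exprn_ge0.
    rewrite /height !expfzDr// -invr_expz -exprnP -exprVn !mulrA.
    rewrite ler_wpM2r ?exprn_ge0//.
    rewrite ler_piMr ?invr_ge0 ?ler0n ?invf_le1 ?ler1n//.
    by rewrite !mulr_ge0 ?(ltW good_bound_gt0) ?(ltW (pow0 k)).
rewrite poweR_EFin lee_fin powRM ?powR_ge0 ?invr_ge0 ?(ltW b1)//.
rewrite -powRrM divff ?gt_eqF// powRr1// /height.
by rewrite le_eqVlt; apply/orP; left; apply/eqP; ring.
Qed.

End calderon_zygmund.

(** Only the atoms are existential; [lam w C] and [cubes w] are named, so that two functions
    dominated by [w] receive the same coefficients and cubes. *)
Lemma real_atomic_decomposition (R : realType) (n : nat) (n0 : (0 < n)%N)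
    (K : nat) (w : 'rV[R]_n -> R) (C : R) :
  measurable_fun (setT : set (LebRn R n)) w -> (forall x, 0 <= w x) ->
  (forall a : R, 0 < a ->
    (\int[@lebRn R n]_(x in superlevel w a) (w x)%:E < +oo)%E) ->
  0 < C ->
  (forall m (z : {ffun 'I_n -> int}) (f : 'rV[R]_n -> R),
    (@lebRn R n).-integrable (dyadic_cube m z) (EFin \o f) ->
    exists h : 'rV[R]_n -> R,
    [/\ measurable_fun (setT : set (LebRn R n)) h,
      (@lebRn R n).-integrable (dyadic_cube m z) (EFin \o h),
      forall x, `|h x| <= C *
        (\int[@lebRn R n]_(y in dyadic_cube m z) `|f y| / (2 ^ m) ^+ n) *
        \1_(dyadic_cube m z) x &
      forall be : {ffun 'I_n -> nat}, (forall j, be j <= K)%N ->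
        \int[@lebRn R n]_(x in dyadic_cube m z) ((f x - h x) * monomial be x) = 0]) ->
  forall f : 'rV[R]_n -> R,
  measurable_fun (setT : set (LebRn R n)) f -> (forall x, `|f x| <= w x) ->
  (forall (k : int) x, ~ Omega w (2 ^ k) x -> `|f x| <= 2 ^ k) ->
  exists a : nat -> 'rV[R]_n -> R,
  [/\ forall j x, `|a j x| <= \1_(cubes w j) x / 2,
      forall j, measurable_fun (setT : set (LebRn R n)) (a j),
      forall j (be : {ffun 'I_n -> nat}), (forall i, be i <= K)%N ->
        \int[@lebRn R n]_x (monomial be x * a j x) = 0 &
      forall (k : int) x, ~ Omega w (2 ^ k) x ->
        (fun N => \sum_(0 <= j < N) lam w C j * a j x) @ \oo --> f x].
Proof.
move=> mw w0 w_tail C0 HC f mf fw f_Omega.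
exists (atoms mw w0 w_tail HC mf fw); split.
- by move=> j x; exact: atoms_le.
- by move=> j; exact: measurable_atoms.
- by move=> j be beK; exact: atoms_moment.
- by move=> k x; exact: atoms_series.
Qed.

(** * Pairing with Schwartz functions *)

Section schwartz_real.
Context (R : realType) (n : nat).
Local Notation leb := (@lebRn R n).
Local Notation Rn := (LebRn R n).
Implicit Types (phi : 'rV[R]_n -> R).

Lemma schwartzR_measurable phi : schwartzR phi -> measurable_fun (setT : set Rn) phi.
Proof. by move=> /(_ [::])[cphi _ _]; exact: continuous_measurable_LebRn. Qed.

Lemma schwartzR_monomial_bounded phi (al : {ffun 'I_n -> nat}) : schwartzR phi ->
  exists M : R, forall x, `|monomial al x * phi x| <= M.
Proof. by move=> /(_ [::])[_ _ /(_ al)]. Qed.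

Lemma schwartzR_bounded phi : schwartzR phi ->
  exists2 M : R, 0 <= M & forall x, `|phi x| <= M.
Proof.
move=> /(@schwartzR_monomial_bounded _ [ffun=> 0%N])[M HM].
have H x : `|phi x| <= M.
  have := HM x; rewrite /monomial big1 ?mul1r// => i _.
  by rewrite ffunE expr0.
by exists M => //; exact: le_trans (H 0).
Qed.

(* [prod_i (1 + x_i ^ 2)] is a sum of monomials. *)
Lemma schwartzR_decay phi : schwartzR phi ->
  exists2 M : R, 0 <= M & forall x, `|phi x| <= M * \prod_(i < n) (1 + x 0 i ^+ 2)^-1.
Proof.
move=> sphi.
pose al (b : {ffun 'I_n -> bool}) : {ffun 'I_n -> nat} := [ffun i => if b i then 2%N else 0%N].
have /choice[M HM] : forall b, exists M : R, forall x, `|monomial (al b) x * phi x| <= M.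
  by move=> b; exact: schwartzR_monomial_bounded.
have M0 b : 0 <= M b by exact: le_trans (HM b 0).
exists (\sum_b M b); first exact: sumr_ge0.
move=> x; rewrite prodfV ler_pdivlMr; last first.
  by apply: prodr_gt0 => i _; rewrite ltr_wpDr// sqr_ge0.
have -> : \prod_(i < n) (1 + x 0 i ^+ 2) = \sum_(b : {ffun 'I_n -> bool}) monomial (al b) x.
  transitivity (\prod_(i < n) \sum_(b : bool) (if b then x 0 i ^+ 2 else 1)).
    by apply: eq_bigr => i _; rewrite big_bool addrC.
  rewrite bigA_distr_bigA; apply: eq_bigr => b _; apply: eq_bigr => i _.
  by rewrite ffunE; case: (b i).
rewrite mulr_sumr; apply: ler_sum => b _; apply: le_trans (HM b x).
rewrite normrM mulrC ler_wpM2r// ler_norm//.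
Qed.

Lemma integral_oneDsqrV :
  (\int[lebesgue_measure]_t ((1 + t ^+ 2)^-1 : R)%:E < +oo)%E.
Proof.
rewrite (@ge0_symfun_integralT R (fun t => (1 + t ^+ 2)^-1)).
- rewrite -set_itvcy (@integral0y_oneDsqr R) -EFinM ltry//.
- by move=> t; rewrite invr_ge0 addr_ge0// sqr_ge0.
- exact: (@continuous_oneDsqrV R).
- by move=> t /=; rewrite sqrrN.
Qed.

(** By the decay bound and Tonelli, the integral of |phi| is at most a constant times the n-th power
    of the integral of 1/(1 + t^2). *)
Lemma schwartzR_integrable phi : schwartzR phi ->
  leb.-integrable setT (EFin \o phi).
Proof.
move=> sphi; have [M M0 HM] := schwartzR_decay sphi.
pose g (i : 'I_n) (t : R) : R := (1 + t ^+ 2)^-1.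
have g0 i t : 0 <= g i t by rewrite invr_ge0 addr_ge0// sqr_ge0.
have mg i : measurable_fun setT (g i).
  by apply: continuous_measurable_fun; exact: (@continuous_oneDsqrV R).
apply/integrableP; split; first by apply/measurable_EFinP; exact: schwartzR_measurable.
apply: (@le_lt_trans _ _ (\int[leb]_x (M%:E * (\prod_(i < n) g i (x 0 i))%:E))%E).
  apply: ge0_le_integral; first exact: measurableT.
  - by move=> x _; exact: abse_ge0.
  - apply: measurableT_comp; first exact: abse_measurable.
    apply/measurable_EFinP; exact: schwartzR_measurable.
  - apply: measurable_funeM; apply/measurable_EFinP; apply: measurable_fun_LebRn.
    exact: measurable_prod_coord.
  - by move=> x _; rewrite /= -EFinM lee_fin; exact: HM.
rewrite (ge0_integralZl _ measurableT); last 3 first.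
- apply/measurable_EFinP; apply: measurable_fun_LebRn; exact: measurable_prod_coord.
- by move=> x _; rewrite lee_fin prodr_ge0.
- by rewrite lee_fin.
apply: lte_mul_pinfty => //.
rewrite ge0_integral_LebRn; last 2 first.
- by apply/measurable_EFinP; exact: measurable_prod_coord.
- by move=> x; rewrite lee_fin prodr_ge0.
rewrite ge0_integral_prod_coord//.
have fint i : (\int[lebesgue_measure]_t (g i t)%:E)%E \is a fin_num.
  rewrite ge0_fin_numE; first exact: integral_oneDsqrV.
  by apply: integral_ge0 => t _; rewrite lee_fin.
by under eq_bigr do rewrite -(fineK (fint _)); rewrite prodEFin ltry.
Qed.

End schwartz_real.

(** * Functions dominated in weak L^p against Schwartz functions *)

Section weak_domination.
Context (R : realType) (n : nat).
Local Notation leb := (@lebRn R n).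
Local Notation Rn := (LebRn R n).
Variables (G : 'rV[R]_n -> \bar R) (p A : R).
Hypothesis p1 : 1 < p.
Hypothesis A0 : 0 <= A.
Hypothesis mG : measurable_fun (setT : set Rn) G.
Hypothesis G0 : forall x, (0 <= G x)%E.
Hypothesis G_weak : forall a : R, 0 < a ->
  (distribution_fun G a <= (A * a `^ (- p))%:E)%E.

(** The weak bound turns the series of [integral_tail_le] into a geometric one of ratio 2^(1 - p),
    which is below 1 because [p > 1]. *)
Lemma weak_integral_tail (a : R) : 0 < a ->
  (\int[leb]_(x in [set x : Rn | (a%:E < G x)%E]) G x < +oo)%E.
Proof.
move=> a0; apply: le_lt_trans (integral_tail_le _ mG G0 a0) _.
pose b : R := 2 `^ (1 - p).
have b01 : 0 <= b < 1.
  by rewrite powR_ge0/= -[ltRHS](powRr0 2); apply: ltr_powR2; rewrite subr_lt0.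
pose D : R := 2 * a * (A * a `^ (- p)).
have D0 : 0 <= D by rewrite !mulr_ge0 ?powR_ge0// ltW.
apply: (@le_lt_trans _ _ (\sum_(m <oo) (D * b ^+ m)%:E)%E); last first.
  by apply: le_lt_trans (geometric_eseries_le D0 b01) _; rewrite ltry.
apply: lee_nneseries => [m _ _|m _].
  by rewrite mule_ge0 ?lebRn_ge0// lee_fin mulr_ge0// ltW.
have ma0 : 0 < 2 ^+ m * a by rewrite mulr_gt0// exprn_gt0.
apply: (@le_trans _ _ ((2 ^+ m.+1 * a)%:E * (A * (2 ^+ m * a) `^ (- p))%:E)%E).
  apply: lee_wpmul2l; first by rewrite lee_fin mulr_ge0// ltW.
  apply: le_trans (G_weak ma0); apply: le_lebRn => x /=.
  by rewrite gee0_abs.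
rewrite -EFinM lee_fin le_eqVlt; apply/orP; left; apply/eqP.
rewrite powRM ?exprn_ge0 ?(ltW a0)//.
have -> : b ^+ m = 2 ^+ m * (2 ^+ m) `^ (- p).
  rewrite /b -[in RHS](powR_mulrn m (ler0n R 2)) -powRrM -powRD; last by rewrite pnatr_eq0 implybT.
  by rewrite -powR_mulrn ?powR_ge0// -powRrM; congr (2 `^ _); ring.
by rewrite /D exprS; ring.
Qed.

Variable phi : 'rV[R]_n -> R.
Hypothesis sphi : schwartzR phi.

(* Where [G <= 1] the product [G phi] is controlled by the integrable [phi];
   where [G > 1], by the integrable tail of [G] and the bounded [phi]. *)
Definition schwartz_dominator (M : R) (x : 'rV[R]_n) : \bar R :=
  ((`|phi x|)%:E + M%:E * (G \_ [set x : Rn | (1%:E < G x)%E]) x)%E.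

Let mtail : measurable ([set x : Rn | (1%:E < G x)%E]).
Proof. by rewrite -[X in measurable X]setTI; exact: emeasurable_fun_o_infty. Qed.

Lemma schwartz_dominator_integrable (M : R) : 0 <= M ->
  leb.-integrable setT (schwartz_dominator M).
Proof.
move=> M0; apply: (integrableD measurableT).
  exact: (integrable_norm (schwartzR_integrable sphi)).
apply: integrableZl => //.
suff H : leb.-integrable ([set x : Rn | (1%:E < G x)%E]) G.
  exact: (@integrable_mkcond _ Rn R leb _ G mtail).1 H.
apply/integrableP; split; first exact: measurable_funTS.
under eq_integral do rewrite gee0_abs//.
exact: weak_integral_tail.
Qed.

Lemma schwartz_dominatorP (M : R) (g : 'rV[R]_n -> R) x :
  (forall x, `|phi x| <= M) -> ((`|g x|)%:E <= G x)%E ->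
  ((`|g x * phi x|)%:E <= schwartz_dominator M x)%E.
Proof.
move=> HM gG; rewrite /schwartz_dominator patchE normrM.
have M0 : 0 <= M by exact: le_trans (HM 0).
case: ifPn => [|]; rewrite ?inE ?notin_setE /= => H.
  apply: (@le_trans _ _ (M%:E * G x)%E); last by rewrite leeDr// lee_fin.
  rewrite mulrC EFinM; apply: lee_pmul; rewrite ?lee_fin//.
rewrite mule0 adde0 lee_fin ler_piMl//.
by rewrite -lee_fin; apply: le_trans gG _; rewrite leNgt; apply/negP.
Qed.

Lemma weak_schwartz_integrable (g : 'rV[R]_n -> R) :
  measurable_fun (setT : set Rn) g -> (forall x, ((`|g x|)%:E <= G x)%E) ->
  leb.-integrable setT (EFin \o (fun x => g x * phi x)).
Proof.
move=> mg gG; have [M M0 HM] := schwartzR_bounded sphi.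
apply: (le_integrable measurableT _ _ (schwartz_dominator_integrable M0)).
  apply/measurable_EFinP; apply: measurable_funM => //; exact: schwartzR_measurable.
move=> x _; rewrite [leRHS]gee0_abs.
  exact: schwartz_dominatorP.
apply: le_trans (schwartz_dominatorP HM (gG x)); by rewrite lee_fin.
Qed.

Lemma weak_schwartz_cvg (s : nat -> 'rV[R]_n -> R) (g : 'rV[R]_n -> R)
    (N : set 'rV[R]_n) :
  (forall k, measurable_fun (setT : set Rn) (s k)) ->
  (forall k x, ((`|s k x|)%:E <= G x)%E) ->
  measurable_fun (setT : set Rn) g ->
  measurable (N : set Rn) -> leb N = 0%E ->
  (forall x, ~ N x -> s ^~ x @ \oo --> g x) ->
  (fun k => \int[leb]_x (s k x * phi x)) @ \oo --> \int[leb]_x (g x * phi x).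
Proof.
move=> ms sG mg mN N0 sg; have [M M0 HM] := schwartzR_bounded sphi.
have mphi : measurable_fun (setT : set Rn) phi by exact: schwartzR_measurable.
have [gi _ cvg] : [/\ leb.-integrable setT (EFin \o (fun x => g x * phi x)%R),
    [sequence \int[leb]_x `|(s k x * phi x)%R%:E - (g x * phi x)%R%:E|]_k @ \oo --> 0 &
    [sequence \int[leb]_x (s k x * phi x)%R%:E]_k @ \oo --> \int[leb]_x (g x * phi x)%R%:E]%E.
  apply: (@dominated_convergence _ Rn R leb setT measurableT
    (fun k x => (s k x * phi x)%:E) (fun x => (g x * phi x)%:E) (schwartz_dominator M)).
  - by move=> k; apply/measurable_EFinP; exact: measurable_funM.
  - by apply/measurable_EFinP; exact: measurable_funM.
  - exists N; split => // x /=; apply: contra_notP => nNx _.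
    apply: cvg_EFin; first by apply: nearW.
    by apply: cvgMl; exact: sg.
  - exact: schwartz_dominator_integrable.
  - by apply: aeW => x k _; exact: schwartz_dominatorP.
rewrite /Rintegral; apply: fine_cvg; rewrite fineK//.
exact: integrable_fin_num gi.
Qed.

End weak_domination.

Lemma exists_dyadic_scale (R : realType) (t : R) : 0 < t ->
  exists k : int, 2 ^ k <= t < 2 ^ (k + 1).
Proof.
move=> t0; pose s := ln t / ln 2.
have ln2 : 0 < ln 2 :> R by rewrite ln_gt0// ltr1n.
have tE : t = 2 `^ s by rewrite /powR pnatr_eq0/= divfK ?gt_eqF// lnK.
exists (Num.floor s); have /andP[h1 h2] := floor_itv s.
rewrite tE -!powR_intmul//; apply/andP; split; last exact: ltr_powR2.
by apply: ler_powR => //; rewrite ler1n.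
Qed.

(** * Distribution function of the sums over cubes *)

Section lv_sum_bounds.
Context (R : realType) (n : nat) (n0 : (0 < n)%N).
Local Notation leb := (@lebRn R n).
Local Notation Rn := (LebRn R n).
Variable w : 'rV[R]_n -> R.
Hypothesis mw : measurable_fun (setT : set Rn) w.
Hypothesis w0 : forall x, 0 <= w x.
Hypothesis w_tail : forall a : R, 0 < a ->
  (\int[leb]_(x in superlevel w a) (w x)%:E < +oo)%E.
Variable C : R.
Hypothesis C0 : 0 < C.

(** The factor of [2 ^ k] in [lv_sum_le]. *)
Definition lv_constant (n : nat) (C v : R) : R :=
  6 * good_bound n C * (1 - 2 `^ (- v))^-1 `^ v^-1.

Lemma lv_constant_gt0 v : 0 < v -> 0 < lv_constant n C v.
Proof.
move=> v0; rewrite !mulr_gt0 ?good_bound_gt0// powR_gt0// invr_gt0 subr_gt0.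
by rewrite -[ltRHS](powRr0 2); apply: ltr_powR2; rewrite oppr_lt0.
Qed.

Lemma lv_sum_ge0 v x : (0 <= lv_sum v (lam w C) (cubes w) x)%E.
Proof. exact: poweR_ge0. Qed.

Lemma measurable_lv_sum v : measurable_fun (setT : set Rn) (lv_sum v (lam w C) (cubes w)).
Proof.
apply: (measurableT_comp (measurable_poweR _)).
apply: ge0_emeasurable_sum => [j x _ _|j _]; first by rewrite lee_fin powR_ge0.
apply/measurable_EFinP; apply: (measurableT_comp (measurable_powR _)).
apply: measurable_funM; first exact: measurable_cst.
by apply: measurable_indic; exact: measurable_cubes.
Qed.

(** Of the factor 4, one 2 is lost in rounding [a / lv_constant n C v] down to a power of 2, the
    other in the halved height of the weak type inequality. *)
Lemma lv_sum_distribution v a : 0 < v -> 0 < a ->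
  (distribution_fun (lv_sum v (lam w C) (cubes w)) a <=
   \sum_(m <oo) (2 ^+ m.+1)%:E * distribution_fun (EFin \o w)
      ((4 * lv_constant n C v)^-1 * 2 ^+ m * a)%R)%E.
Proof.
move=> v0 a0; set B := lv_constant n C v.
have B0 : 0 < B by exact: lv_constant_gt0.
have [k /andP[ka ak]] := exists_dyadic_scale (divr_gt0 a0 B0).
have k0 : 0 < 2 ^ k :> R by exact: exprz_gt0.
apply: (@le_trans _ _ (leb (Omega w (2 ^ k) `|` @cube_boundaries R n))).
  apply: le_lebRn => x /=; rewrite gee0_abs ?lv_sum_ge0// => ax.
  apply: contrapT => /not_orP[nO nb]; move: ax; apply/negP; rewrite -leNgt.
  apply: le_trans (lv_sum_le n0 mw w0 w_tail C0 v0 nO nb) _.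
  by rewrite lee_fin -/(lv_constant n C v) -/B mulrC -ler_pdivlMr.
apply: le_trans (lebRnU _ _) _.
rewrite [X in (_ + X)%E](@cube_boundaries_null R n) adde0.
apply: le_trans (lebRn_Omega_le mw w0 k0) _.
apply: lee_nneseries => [m _ _|m _].
  by rewrite mule_ge0 ?lebRn_ge0// lee_fin.
apply: lee_wpmul2l; first by rewrite lee_fin.
apply: le_lebRn => x /=; rewrite (ger0_norm (w0 x)) lte_fin; apply: le_lt_trans.
rewrite mulrAC mulrC ler_wpM2l//.
move: ak; rewrite expfzDr// expr1z ltr_pdivrMr// => /ltW ak.
have B40 : 0 < 4 * B by exact: mulr_gt0.
rewrite mulrC ler_pdivrMr//; apply: le_trans ak _.
rewrite le_eqVlt; apply/orP; left; apply/eqP; field.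
by [].
Qed.

End lv_sum_bounds.

(** * Real and imaginary parts *)

Section complex_components.
Context (R : realType).
Local Notation normc := ComplexField.Normc.normc.

Lemma normc_le (z : R[i]) : normc z <= `|complex.Re z| + `|complex.Im z|.
Proof.
case: z => a b /=; rewrite -[leRHS]ger0_norm ?addr_ge0// -sqrtr_sqr.
apply: ler_wsqrtr; rewrite sqrrD !real_normK ?num_real// addrAC lerDl.
by rewrite mulrn_wge0// mulr_ge0.
Qed.

Lemma Re_le_normc (z : R[i]) : `|complex.Re z| <= normc z.
Proof.
by case: z => a b /=; rewrite -sqrtr_sqr; apply: ler_wsqrtr; rewrite lerDl sqr_ge0.
Qed.

Lemma Im_le_normc (z : R[i]) : `|complex.Im z| <= normc z.
Proof.
by case: z => a b /=; rewrite -sqrtr_sqr; apply: ler_wsqrtr; rewrite lerDr sqr_ge0.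
Qed.

Lemma normc_ge0 (z : R[i]) : 0 <= normc z.
Proof. exact: le_trans (Re_le_normc z). Qed.

Lemma ReM (y z : R[i]) : complex.Re (y * z) =
  complex.Re y * complex.Re z - complex.Im y * complex.Im z.
Proof. by case: y => a b; case: z. Qed.

Lemma ImM (y z : R[i]) : complex.Im (y * z) =
  complex.Re y * complex.Im z + complex.Im y * complex.Re z.
Proof. by case: y => a b; case: z. Qed.

Lemma Re_sum (l : nat -> R) (z : nat -> R[i]) N :
  complex.Re (\sum_(0 <= j < N) real_complex R (l j) * z j) =
  \sum_(0 <= j < N) l j * complex.Re (z j).
Proof.
elim: N => [|N IH]; first by rewrite !big_nil.
rewrite !big_nat_recr//= -IH; case: (z N) => a b /=.
by case: (bigop _ _ _) => c d /=; rewrite mul0r subr0.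
Qed.

Lemma Im_sum (l : nat -> R) (z : nat -> R[i]) N :
  complex.Im (\sum_(0 <= j < N) real_complex R (l j) * z j) =
  \sum_(0 <= j < N) l j * complex.Im (z j).
Proof.
elim: N => [|N IH]; first by rewrite !big_nil.
rewrite !big_nat_recr//= -IH; case: (z N) => a b /=.
by case: (bigop _ _ _) => c d /=; rewrite mul0r addr0.
Qed.

End complex_components.

Section complex_functions.
Context (R : realType) (n : nat).
Local Notation leb := (@lebRn R n).
Local Notation Rn := (LebRn R n).
Local Notation normc := ComplexField.Normc.normc.
Implicit Types (f : 'rV[R]_n -> R[i]).

Lemma measurable_normc f : cmeasurable f ->
  measurable_fun (setT : set Rn) (fun x => normc (f x)).
Proof.
move=> [mRe mIm].
have -> : (fun x => normc (f x)) = Num.sqrt \o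
    (fun x => complex.Re (f x) ^+ 2 + complex.Im (f x) ^+ 2).
  by apply/funext => x /=; case: (f x).
apply: measurableT_comp.
  by apply: continuous_measurable_fun; exact: sqrt_continuous.
by apply: measurable_funD; exact: measurable_funX.
Qed.

Section weak.
Variables (G : 'rV[R]_n -> \bar R) (p A : R).
Hypothesis p1 : 1 < p.
Hypothesis A0 : 0 <= A.
Hypothesis mG : measurable_fun (setT : set Rn) G.
Hypothesis G0 : forall x, (0 <= G x)%E.
Hypothesis G_weak : forall a : R, 0 < a ->
  (distribution_fun G a <= (A * a `^ (- p))%:E)%E.

Let component_integrable (g phi : 'rV[R]_n -> R) : schwartzR phi ->
  measurable_fun (setT : set Rn) g -> (forall x, ((`|g x|)%:E <= G x)%E) ->
  leb.-integrable setT (EFin \o (fun x => g x * phi x)).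
Proof. by move=> sphi; exact: (weak_schwartz_integrable p1 A0 mG G0 G_weak sphi). Qed.

Lemma cintegrable_schwartz f phi : cmeasurable f -> schwartz phi ->
  (forall x, ((`|complex.Re (f x)|)%:E <= G x)%E) ->
  (forall x, ((`|complex.Im (f x)|)%:E <= G x)%E) ->
  cintegrable (fun x => f x * phi x).
Proof.
move=> [mRe mIm] [s1 s2] fRe fIm; split.
  have := integrableB measurableT (component_integrable s1 mRe fRe)
    (component_integrable s2 mIm fIm).
  by apply: eq_integrable => // x _; rewrite /= ReM.
have := integrableD measurableT (component_integrable s2 mRe fRe)
  (component_integrable s1 mIm fIm).
by apply: eq_integrable => // x _; rewrite /= ImM.
Qed.

Lemma cintegral_schwartz f phi : cmeasurable f -> schwartz phi ->
  (forall x, ((`|complex.Re (f x)|)%:E <= G x)%E) ->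
  (forall x, ((`|complex.Im (f x)|)%:E <= G x)%E) ->
  cintegral (fun x => f x * phi x) = Complex
   (\int[leb]_x (complex.Re (f x) * complex.Re (phi x)) -
    \int[leb]_x (complex.Im (f x) * complex.Im (phi x)))
   (\int[leb]_x (complex.Re (f x) * complex.Im (phi x)) +
    \int[leb]_x (complex.Im (f x) * complex.Re (phi x))).
Proof.
move=> [mRe mIm] [s1 s2] fRe fIm; rewrite /cintegral; congr Complex.
  rewrite -RintegralB//; [|exact: component_integrable..].
  by apply: eq_Rintegral => x _; rewrite ReM.
rewrite -RintegralD//; [|exact: component_integrable..].
by apply: eq_Rintegral => x _; rewrite ImM.
Qed.

End weak.

End complex_functions.

(** * The atomic decomposition *)

Section atoms_perp.
Context (R : realType) (n : nat).
Local Notation leb := (@lebRn R n).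
Local Notation Rn := (LebRn R n).
Local Notation normc := ComplexField.Normc.normc.

Lemma is_cube_measurable (Q : set 'rV[R]_n) : is_cube Q ->
  measurable (Q : set Rn) /\ (leb Q < +oo)%E.
Proof.
move=> [c [l [l0 QE]]].
have {}QE : Q = rV_box (fun i => `[c 0 i, c 0 i + l]%classic).
  by rewrite QE; apply/seteqP; split=> x H i; have := H i; rewrite /= in_itv.
rewrite QE; split.
  apply: measurable_LebRn; apply: measurable_rV_box => i; exact: measurable_itv.
rewrite lebRn_box => [|i]; last exact: measurable_itv.
under eq_bigr => i _.
  rewrite lebesgue_measure_itv/= lte_fin ltrDl l0 -EFinB.
  over.
by rewrite prodEFin ltry.
Qed.

Lemma bounded_supported_integrable (u : 'rV[R]_n -> R) (M : R) (Q : set 'rV[R]_n) :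
  0 <= M -> measurable_fun (setT : set Rn) u -> is_cube Q ->
  (forall x, `|u x| <= M * \1_Q x) -> leb.-integrable setT (EFin \o u).
Proof.
move=> M0 mu /is_cube_measurable[mQ Qfin] uM.
apply/integrableP; split; first exact/measurable_EFinP.
apply: (@le_lt_trans _ _ (\int[leb]_x (M%:E * (\1_Q x)%:E))%E).
  apply: ge0_le_integral; first exact: measurableT.
  - by move=> x _; exact: abse_ge0.
  - by apply: measurableT_comp; [exact: abse_measurable|exact/measurable_EFinP].
  - by apply: measurable_funeM; apply/measurable_EFinP; exact: measurable_indic.
  - by move=> x _; rewrite -EFinM lee_fin.
rewrite (ge0_integralZl _ measurableT); last 3 first.
- by apply/measurable_EFinP; exact: measurable_indic.
- by move=> x _; rewrite lee_fin.
- by rewrite lee_fin.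
rewrite integral_indic// setIT; exact: lte_mul_pinfty.
Qed.

Lemma measurable_japanese : measurable_fun (setT : set Rn) (@japanese R n).
Proof.
apply: measurable_fun_LebRn.
rewrite (_ : @japanese R n =
  Num.sqrt \o (fun x : 'rV[R]_n => 1 + \sum_(i < n) x 0 i ^+ 2))//.
apply: measurableT_comp.
  by apply: continuous_measurable_fun; exact: sqrt_continuous.
apply: measurable_funD => //; apply: measurable_sum => i.
by apply: measurable_funX; exact: measurable_coord.
Qed.

Lemma japanese_bounded (Q : set 'rV[R]_n) : is_cube Q ->
  exists2 M : R, 0 <= M & forall x, Q x -> 0 <= japanese x <= M.
Proof.
move=> [c [l [l0 ->]]].
exists (Num.sqrt (1 + \sum_(i < n) (`|c 0 i| + l) ^+ 2)); first exact: sqrtr_ge0.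
move=> x Qx; rewrite sqrtr_ge0/=; apply: ler_wsqrtr; rewrite lerD2l.
apply: ler_sum => i _; rewrite -[leLHS]real_normK ?num_real//.
rewrite lerXn2r ?nnegrE ?addr_ge0 ?(ltW l0)//.
have /andP[h1 h2] := Qx i; rewrite ler_norml; apply/andP; split.
  apply: le_trans h1; rewrite opprD lerBlDr ler_wpDr ?(ltW l0)//.
  by rewrite lerNl ler_normr lexx orbT.
by apply: le_trans h2 _; rewrite lerD2r ler_norm.
Qed.

Lemma atom_PKperp (K : nat) (Q : set 'rV[R]_n) (a b : 'rV[R]_n -> R) :
  is_cube Q -> measurable_fun (setT : set Rn) a -> measurable_fun (setT : set Rn) b ->
  (forall x, `|a x| <= \1_Q x / 2) -> (forall x, `|b x| <= \1_Q x / 2) ->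
  (forall be : {ffun 'I_n -> nat}, (forall i, be i <= K)%N ->
     \int[leb]_x (monomial be x * a x) = 0) ->
  (forall be : {ffun 'I_n -> nat}, (forall i, be i <= K)%N ->
     \int[leb]_x (monomial be x * b x) = 0) ->
  [/\ cLinfty (fun x => Complex (a x) (b x)),
     PKperp K (fun x => Complex (a x) (b x)) &
     forall x, normc (Complex (a x) (b x)) <= \1_Q x].
Proof.
move=> cQ ma mb aQ bQ a0 b0.
have abQ x : normc (Complex (a x) (b x)) <= \1_Q x.
  apply: le_trans (normc_le _) _ => /=.
  by rewrite [leRHS]splitr; apply: lerD.
have mab : cmeasurable (fun x => Complex (a x) (b x)) by [].
split => //.
  split => //; rewrite Lnorm.unlock; case: ifPn => // _.
  apply: (@le_lt_trans _ _ 1%:E); last exact: ltry.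
  apply/ess_supP; apply: aeW => x /=.
  rewrite lee_fin ger0_norm ?normc_ge0//; apply: le_trans (abQ x) _.
  by rewrite indicE; case: (_ \in _).
have [M M0 HM] := japanese_bounded cQ.
have jint (u : 'rV[R]_n -> R) : measurable_fun (setT : set Rn) u ->
    (forall x, `|u x| <= \1_Q x / 2) ->
    leb.-integrable setT (EFin \o (fun x => japanese x ^+ K * u x)).
  move=> mu uQ; apply: (@bounded_supported_integrable _ (M ^+ K) Q).
  - exact: exprn_ge0.
  - apply: measurable_funM; last exact: mu.
    apply: measurable_funX; exact: measurable_japanese.
  - exact: cQ.
  - move=> x; rewrite normrM; have := uQ x; rewrite !indicE.
    case: (boolP (x \in Q)) => [|_ ux]; last first.
      rewrite mul0r in ux; rewrite mulr0.
      have -> : `|u x| = 0 by apply/eqP; rewrite eq_le ux normr_ge0.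
      by rewrite mulr0.
    rewrite inE => /HM /andP[j0 jM] ux.
    apply: ler_pM => //; last by apply: le_trans ux _; rewrite mul1r invf_le1// ler1n.
    by rewrite normrX ger0_norm// lerXn2r// nnegrE.
have RCRe r (z : R[i]) : complex.Re (real_complex R r * z) = r * complex.Re z.
  by case: z => c d /=; rewrite mul0r subr0.
have RCIm r (z : R[i]) : complex.Im (real_complex R r * z) = r * complex.Im z.
  by case: z => c d /=; rewrite mul0r addr0.
split => //.
- split.
    by have := jint a ma aQ; apply: eq_integrable => // x _; rewrite /= mul0r subr0.
  by have := jint b mb bQ; apply: eq_integrable => // x _; rewrite /= mul0r addr0.
move=> al alK.
(* Total degree at most [K] bounds each exponent by [K], which is the form of the moment conditions
   on [a] and [b]. *)
have alK' i : (al i <= K)%N.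
  by apply: leq_trans alK; rewrite /mdeg (bigD1 i)//= leq_addr.
rewrite /cintegral.
under eq_Rintegral do rewrite RCRe/=.
under [X in Complex _ X]eq_Rintegral do rewrite RCIm/=.
by rewrite a0// b0.
Qed.

End atoms_perp.

(** * The null set where means do not control w *)

Section exceptional_set.
Context (R : realType) (n : nat).
Local Notation leb := (@lebRn R n).
Local Notation Rn := (LebRn R n).
Variable w : 'rV[R]_n -> R.
Hypothesis mw : measurable_fun (setT : set Rn) w.
Hypothesis w0 : forall x, 0 <= w x.

(** After setting a function dominated by [w] to 0 here, the bound [2 ^ k] off [Omega w (2 ^ k)]
    holds at every point and for every [k], as the pointwise estimates on atoms require. *)
Definition exceptional_set : set 'rV[R]_n :=
  \bigcup_(k in [set: int]) (superlevel w (2 ^ k) `\` Omega w (2 ^ k)).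

Lemma measurable_exceptional_set : measurable (exceptional_set : set Rn).
Proof.
apply: measurable_bigcup_family => k _; apply: measurableD.
  exact: measurable_superlevel.
exact: measurable_Omega.
Qed.

Hypothesis n0 : (0 < n)%N.
Hypothesis w_tail : forall a : R, 0 < a ->
  (\int[leb]_(x in superlevel w a) (w x)%:E < +oo)%E.

Lemma exceptional_set_null : leb exceptional_set = 0%E.
Proof.
rewrite /exceptional_set -family_seq_bigcup; apply: lebRn_bigcup_null => i.
apply: (family_seq_ind (Q := fun A => leb A = 0%E)); first exact: measure0.
by move=> k _; apply: superlevel_minus_Omega_null => //; exact: exprz_gt0.
Qed.

Definition truncated (g : 'rV[R]_n -> R) (x : 'rV[R]_n) : R :=
  g x * \1_(~` exceptional_set) x.

Lemma measurable_truncated g : measurable_fun (setT : set Rn) g ->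
  measurable_fun (setT : set Rn) (truncated g).
Proof.
move=> mg; apply: measurable_funM; first exact: mg.
apply: measurable_indic.
by apply: measurableC; exact: measurable_exceptional_set.
Qed.

Lemma truncated_le g x : `|g x| <= w x -> `|truncated g x| <= w x.
Proof.
move=> gw; rewrite normrM; apply: le_trans gw; rewrite ler_piMr//.
by rewrite indicE; case: (_ \in _); rewrite ?normr1 ?normr0.
Qed.

Lemma truncated_Omega g (k : int) x : `|g x| <= w x ->
  ~ Omega w (2 ^ k) x -> `|truncated g x| <= 2 ^ k.
Proof.
move=> gw nO; rewrite /truncated indicE.
case: (boolP (x \in ~` exceptional_set)) => [|_]; last first.
  by rewrite mulr0 normr0 ltW// exprz_gt0.
rewrite inE mulr1 => nE; apply: le_trans gw _; rewrite leNgt; apply/negP => kw.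
by apply: nE; exists k.
Qed.

Lemma truncatedE g x : ~ exceptional_set x -> truncated g x = g x.
Proof. by move=> nE; rewrite /truncated indicE mem_set ?mulr1. Qed.

End exceptional_set.

Theorem corollary1p5 (R : realType) (n : nat) (hn : (0 < n)%N)
    (p : R) (r : \bar R) (K : nat) (hp : 1 < p) (hr : (0 < r)%E) :
  exists C : R -> R,
    (forall v : R, 0 < v -> 0 < C v) /\
    forall f : 'rV[R]_n -> R[i], lorentz p r f ->
    exists (lam : nat -> R) (Q : nat -> set 'rV[R]_n)
           (a : nat -> 'rV[R]_n -> R[i]),
      (forall j, 0 <= lam j) /\
      (forall j, is_cube (Q j)) /\
      (forall j, cLinfty (a j) /\ PKperp K (a j)) /\
      cvg_tempered
        (fun N x => \sum_(0 <= j < N) real_complex R (lam j) * a j x) f /\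
      (forall j x, ComplexField.Normc.normc (a j x) <= \1_(Q j) x) /\
      (forall v : R, 0 < v ->
        (lorentz_norm p r (lv_sum v lam Q)
           <= (C v)%:E * lorentz_norm p r (cabs f))%E).
Proof.
have p0 : 0 < p by rewrite (lt_trans _ hp).
have [B B0 HB] := exists_moment_projection R n K.
(* The constants are chosen before [f] is introduced, from the dilation factor that
   [lv_sum_distribution] will produce. *)
have [C HC] : exists C : R -> R, forall v, 0 < C v /\ (0 < v -> forall F w : 'rV[R]_n -> \bar R,
    (forall a : R, 0 < a -> (distribution_fun F a <=
     \sum_(m <oo) (2 ^+ m.+1)%:E *
       distribution_fun w ((4 * lv_constant n B v)^-1 * 2 ^+ m * a)%R)%E) ->
    (lorentz_norm p r F <= (C v)%:E * lorentz_norm p r w)%E).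
  suff : forall v : R, exists Cv : R, 0 < Cv /\ (0 < v -> forall F w : 'rV[R]_n -> \bar R,
    (forall a : R, 0 < a -> (distribution_fun F a <=
     \sum_(m <oo) (2 ^+ m.+1)%:E *
       distribution_fun w ((4 * lv_constant n B v)^-1 * 2 ^+ m * a)%R)%E) ->
    (lorentz_norm p r F <= Cv%:E * lorentz_norm p r w)%E).
    by move=> /choice[C HC]; exists C.
  (* For [v <= 0] only positivity is claimed, and 1 will do. *)
  move=> v; have [v0|nv0] := pselect (0 < v); last by exists 1.
  have c0 : 0 < (4 * lv_constant n B v)^-1.
    by rewrite invr_gt0 mulr_gt0// lv_constant_gt0.
  by have [Cv Cv0 HCv] := lorentz_norm_domination n hp hr c0; exists Cv.
exists C; split=> [v _|f [mf fnorm]]; first by have [] := HC v.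
pose w x := ComplexField.Normc.normc (f x).
have w0 x : 0 <= w x by exact: normc_ge0.
have mw : measurable_fun (setT : set (LebRn R n)) w by exact: measurable_normc.
have mcabs : measurable_fun (setT : set (LebRn R n)) (cabs f) by exact/measurable_EFinP.
have cabs0 x : (0 <= cabs f x)%E by rewrite /cabs lee_fin; exact: w0.
have [A A0 f_weak] := lorentz_norm_weak p0 hr fnorm.
have w_tail a : 0 < a -> (\int[@lebRn R n]_(x in superlevel w a) (w x)%:E < +oo)%E.
  by move=> a0; exact: (weak_integral_tail hp A0 mcabs cabs0 f_weak a0).
pose la := lam w B; pose Q := cubes w.
have key v : 0 < v ->
    (lorentz_norm p r (lv_sum v la Q) <= (C v)%:E * lorentz_norm p r (cabs f))%E.
  move=> v0; have [_ /(_ v0)] := HC v; apply => a a0.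
  exact: lv_sum_distribution.
(* A common majorant for the partial sums of both components; its finite quasi-norm yields, by
   [lorentz_norm_weak], the bound needed to pair it with Schwartz functions. *)
pose G := lv_sum 1 la Q.
have Gnorm : (lorentz_norm p r G < +oo)%E.
  apply: le_lt_trans (key 1 ltr01) _; apply: lte_mul_pinfty => //.
  by rewrite lee_fin ltW//; have [] := HC 1.
have [A' A'0 G_weak] := lorentz_norm_weak p0 hr Gnorm.
have mG : measurable_fun (setT : set (LebRn R n)) G by exact: measurable_lv_sum.
have G0 x : (0 <= G x)%E by exact: lv_sum_ge0.
have [mRe mIm] := mf.
(* With [w] and [B] fixed, both applications below produce atoms for the same [la] and [Q]. *)
have decomp (g : 'rV[R]_n -> R) := @real_atomic_decomposition R n hn K w B mw w0 w_tail B0 HB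
  (truncated w g).
have wRe x : `|complex.Re (f x)| <= w x by exact: Re_le_normc.
have wIm x : `|complex.Im (f x)| <= w x by exact: Im_le_normc.
have [a [aQ ma a0 a_series]] := decomp (fun x => complex.Re (f x))
  (measurable_truncated mw mRe) (fun x => truncated_le (wRe x))
  (fun k x => truncated_Omega (wRe x)).
have [b [bQ mb b0 b_series]] := decomp (fun x => complex.Im (f x))
  (measurable_truncated mw mIm) (fun x => truncated_le (wIm x))
  (fun k x => truncated_Omega (wIm x)).
pose at_ j x : R[i] := Complex (a j x) (b j x).
have la0 j : 0 <= la j by exact: lam_ge0.
have cQ j : is_cube (Q j) by exact: cubes_is_cube.
have perp j := atom_PKperp (cQ j) (ma j) (mb j) (aQ j) (bQ j) (a0 j) (b0 j).
exists la, Q, at_.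
split; first exact: la0.
split; first exact: cQ.
split; first by move=> j; have [h1 h2 _] := perp j; split; [exact: h1|exact: h2].
split; last first.
  by split; [move=> j x; have [_ _ h] := perp j; exact: h|exact: key].
pose u N x := \sum_(0 <= j < N) real_complex R (la j) * at_ j x.
have uRe N x : complex.Re (u N x) = \sum_(0 <= j < N) la j * a j x by exact: Re_sum.
have uIm N x : complex.Im (u N x) = \sum_(0 <= j < N) la j * b j x by exact: Im_sum.
have sum_le (c : nat -> 'rV[R]_n -> R) N x :
    (forall j, `|c j x| <= \1_(Q j) x / 2) ->
    ((`|\sum_(0 <= j < N) la j * c j x|)%:E <= G x)%E.
  move=> cQx; rewrite /G /lv_sum invr1 poweRe1; last first.
    by apply: nneseries_ge0 => j _ _; rewrite lee_fin powR_ge0.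
  apply: (@le_trans _ _ (\sum_(0 <= j < N) ((la j * \1_(Q j) x) `^ 1)%:E)%E).
    rewrite sumEFin lee_fin; apply: le_trans (ler_norm_sum _ _ _) _.
    apply: ler_sum => j _; rewrite powRr1 ?mulr_ge0// normrM ger0_norm//.
    apply: ler_wpM2l => //; apply: le_trans (cQx j) _.
    by rewrite ler_pdivrMr// ler_peMr// ler1n.
  by apply: nneseries_lim_ge => j _ _; rewrite lee_fin powR_ge0.
have msum (c : nat -> 'rV[R]_n -> R) N :
    (forall j, measurable_fun (setT : set (LebRn R n)) (c j)) ->
    measurable_fun (setT : set (LebRn R n)) (fun x => \sum_(0 <= j < N) la j * c j x).
  by move=> mc; apply: measurable_sum => j; exact: measurable_funM.
have mu N : cmeasurable (u N).
  split.
    by rewrite (_ : (fun x => _) = (fun x => \sum_(0 <= j < N) la j * a j x));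
      [exact: msum|apply/funext => x; exact: uRe].
  by rewrite (_ : (fun x => _) = (fun x => \sum_(0 <= j < N) la j * b j x));
    [exact: msum|apply/funext => x; exact: uIm].
have uReG N x : ((`|complex.Re (u N x)|)%:E <= G x)%E by rewrite uRe; exact: sum_le.
have uImG N x : ((`|complex.Im (u N x)|)%:E <= G x)%E by rewrite uIm; exact: sum_le.
have fReG x : ((`|complex.Re (f x)|)%:E <= cabs f x)%E by rewrite /cabs lee_fin; exact: wRe.
have fImG x : ((`|complex.Im (f x)|)%:E <= cabs f x)%E by rewrite /cabs lee_fin; exact: wIm.
split.
- move=> N; split; first exact: mu.
  move=> phi sphi.
  exact: (cintegrable_schwartz hp A'0 mG G0 G_weak (mu N) sphi (uReG N) (uImG N)).
- split; first exact: mf.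
  move=> phi sphi.
  exact: (cintegrable_schwartz hp A0 mcabs cabs0 f_weak mf sphi fReG fImG).
move=> phi sphi; have [s1 s2] := sphi.
(* Off [N0] the truncation changes nothing and some [Omega] misses the point, so both series
   converge to the components of [f] itself. *)
pose N0 := exceptional_set w `|` \bigcap_(k : nat) Omega w (2 ^+ k).
have mN0 : measurable (N0 : set (LebRn R n)).
  apply: measurableU; first exact: measurable_exceptional_set.
  by apply: bigcapT_measurable => k; exact: measurable_Omega.
have N00 : @lebRn R n N0 = 0%E.
  apply/eqP; rewrite eq_le lebRn_ge0 andbT; apply: le_trans (lebRnU _ _) _.
  rewrite (exceptional_set_null mw w0 hn w_tail) add0e.
  by rewrite (Omega_cap_null mw w0 w_tail).
have N0C x : ~ N0 x -> ~ exceptional_set w x /\ exists k : int, ~ Omega w (2 ^ k) x.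
  move=> nN; split; first by move=> ex; apply: nN; left.
  apply: contrapT => /forallNP nO; apply: nN; right => k _.
  by apply: contrapT => nOk; apply: (nO k%:Z); rewrite -exprnP.
have a_cvg x : ~ N0 x ->
    (fun N => \sum_(0 <= j < N) la j * a j x) @ \oo --> complex.Re (f x).
  by move=> /N0C[nex [k nOk]]; have := a_series _ _ nOk; rewrite (truncatedE _ nex).
have b_cvg x : ~ N0 x ->
    (fun N => \sum_(0 <= j < N) la j * b j x) @ \oo --> complex.Im (f x).
  by move=> /N0C[nex [k nOk]]; have := b_series _ _ nOk; rewrite (truncatedE _ nex).
pose T (g : 'rV[R]_n -> R) (h : 'rV[R]_n -> R) : R := \int[@lebRn R n]_x (g x * h x).
have T_cvg (c : nat -> 'rV[R]_n -> R) (g h : 'rV[R]_n -> R) : schwartzR h ->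
    (forall j, measurable_fun (setT : set (LebRn R n)) (c j)) ->
    (forall j x, `|c j x| <= \1_(Q j) x / 2) ->
    measurable_fun (setT : set (LebRn R n)) g ->
    (forall x, ~ N0 x -> (fun N => \sum_(0 <= j < N) la j * c j x) @ \oo --> g x) ->
    (fun N => T (fun x => \sum_(0 <= j < N) la j * c j x) h - T g h) @ \oo --> (0 : R).
  move=> sh mc cQx mg cg; have := (weak_schwartz_cvg hp A'0 mG G0 G_weak sh (fun N => msum c N mc)
    (fun N x => sum_le c N x (cQx^~ x)) mg mN0 N00 cg).
  move=> /cvgB/(_ (cvg_cst (T g h))); rewrite subrr; exact.
have u_pairing N : cintegral (fun x => u N x * phi x) = Complex
    (T (fun x => \sum_(0 <= j < N) la j * a j x) (fun x => complex.Re (phi x)) -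
     T (fun x => \sum_(0 <= j < N) la j * b j x) (fun x => complex.Im (phi x)))
    (T (fun x => \sum_(0 <= j < N) la j * a j x) (fun x => complex.Im (phi x)) +
     T (fun x => \sum_(0 <= j < N) la j * b j x) (fun x => complex.Re (phi x))).
  rewrite (cintegral_schwartz hp A'0 mG G0 G_weak (mu N) sphi (uReG N) (uImG N)) /T.
  by congr Complex; congr (_ + _); try congr (- _);
    apply: eq_Rintegral => x _; rewrite ?uRe ?uIm.
have c1 := T_cvg a _ _ s1 ma aQ mRe a_cvg.
have c2 := T_cvg b _ _ s2 mb bQ mIm b_cvg.
have c3 := T_cvg a _ _ s2 ma aQ mRe a_cvg.
have c4 := T_cvg b _ _ s1 mb bQ mIm b_cvg.
(* The modulus of the error is at most the sum of the absolute values of its real and imaginary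
   parts, each of which combines two real pairings. *)
apply: (@squeeze_cvgr _ _ _ _ (cst 0) (fun N =>
  `|(T (fun x => \sum_(0 <= j < N) la j * a j x) (fun x => complex.Re (phi x)) -
     T (fun x => complex.Re (f x)) (fun x => complex.Re (phi x))) -
    (T (fun x => \sum_(0 <= j < N) la j * b j x) (fun x => complex.Im (phi x)) -
     T (fun x => complex.Im (f x)) (fun x => complex.Im (phi x)))| +
  `|(T (fun x => \sum_(0 <= j < N) la j * a j x) (fun x => complex.Im (phi x)) -
     T (fun x => complex.Re (f x)) (fun x => complex.Im (phi x))) +
    (T (fun x => \sum_(0 <= j < N) la j * b j x) (fun x => complex.Re (phi x)) -
     T (fun x => complex.Im (f x)) (fun x => complex.Re (phi x)))|)).
- apply: nearW => N; rewrite normc_ge0/=.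
  set bound := leRHS.
  change (ComplexField.Normc.normc (cintegral (fun x => u N x * phi x) -
    cintegral (fun x => f x * phi x)) <= bound).
  rewrite u_pairing (cintegral_schwartz hp A0 mcabs cabs0 f_weak mf sphi fReG fImG).
  apply: le_trans (normc_le _) _; rewrite {}/bound /= /T.
  apply: lerD; last by rewrite opprD addrACA.
  by rewrite opprD addrACA -opprD.
- exact: cvg_cst.
have := cvgD (cvg_norm (cvgB c1 c2)) (cvg_norm (cvgD c3 c4)).
by rewrite subrr addr0 normr0 addr0; exact.
Qed.
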